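(* Let $(M,J,\langle\cdot,\cdot\rangle)$ be an almost Hermitian manifold of dimension $2n$ with $n>2$, with intrinsic torsion $\xi=\xi_{(1)}+\dots+\xi_{(4)}$ and Lee form $\theta$. (i) If the structure is of type $\mathcal W_2\oplus\mathcal W_4$, then $\theta$ is closed. (ii) If the structure is of type $\mathcal W_1\oplus\mathcal W_4$, then $(d\theta)_{[\lambda^{1,1}_0]}=0$. In particular, if $n=3$, then $d\theta=0$ for this type. Moreover, for $n=3$ and type $\mathcal W_1\oplus\mathcal W_4$: if $\xi_{(1)}=0$ at some point, then $\xi_{(1)}=0$ on the whole connected component containing that point, i.e. there the structure is of type $\mathcal W_4$ (locally conformal Kähler); if $\xi_{(1)}\neq0$, then on the connected component the Lee form is $\theta=d\ln\dfrac1{\|\xi_{(1)}\|^2}$, and hence there the structure is globally conformal to a structure of type $\mathcal W_1$ (nearly Kähler).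
   Context: An almost Hermitian manifold is a smooth $2n$-manifold with an almost complex structure $J$ ($J^2=-I$) and a Riemannian metric with $\langle JX,JY\rangle=\langle X,Y\rangle$. Kähler form: $\omega(X,Y)=\langle X,JY\rangle$. $\nabla$ is the Levi-Civita connection. The intrinsic torsion is the $(1,2)$-tensor $\xi_XY=-\tfrac12J(\nabla_XJ)Y$; each $\xi_X$ is skew-symmetric and anticommutes with $J$. Let $\mathcal W$ be the space (bundle) of $(1,2)$-tensors $\xi$ with each $\xi_X$ skew-symmetric and $J\xi_X+\xi_XJ=0$. For $n\ge3$ it decomposes orthogonally as $\mathcal W_1\oplus\mathcal W_2\oplus\mathcal W_3\oplus\mathcal W_4$ (Gray–Hervella), where: $\mathcal W_1$: $\xi_XX=0$ for all $X$; $\mathcal W_2$: the cyclic sum over $X,Y,Z$ of $\langle\xi_XY,JZ\rangle$ vanishes; $\mathcal W_3$: $\xi_{JX}JY=\xi_XY$ and $\sum_i\xi_{e_i}e_i=0$; $\mathcal W_4$: tensors of the form $4\xi_XY=\langle X,Y\rangle\theta^\sharp-\theta(Y)X-\langle JX,Y\rangle J\theta^\sharp+(J\theta)(Y)JX$ for a one-form $\theta$, where $(J\theta)(X)=-\theta(JX)$ and $\theta^\sharp$ is the metric dual. $\xi_{(a)}$ is the component of $\xi$ in $\mathcal W_a$. A structure is of type $\mathcal W_a\oplus\mathcal W_b$ if $\xi_{(c)}=0$ everywhere for all $c\ne a,b$ (similarly for type $\mathcal W_a$). Norm: $\|\xi_{(1)}\|^2=\sum_{i,j}\langle\xi_{(1)e_i}e_j,\xi_{(1)e_i}e_j\rangle$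 for a local orthonormal frame $\{e_1,\dots,e_{2n}\}$. Lee form: $\theta=-\tfrac1{n-1}Jd^*\omega$, with $d^*$ the codifferential and $(Ja)(X)=-a(JX)$ for one-forms $a$; equivalently $\sum_i\xi_{e_i}e_i=\tfrac{n-1}2\theta^\sharp$. For a two-form $\alpha$: $\alpha_{[\lambda^{1,1}_0]}(X,Y)=\tfrac12(\alpha(X,Y)+\alpha(JX,JY))-\tfrac1n\langle\alpha,\omega\rangle\omega(X,Y)$, where $\langle\alpha,\beta\rangle=\tfrac12\sum_{i,j}\alpha(e_i,e_j)\beta(e_i,e_j)$. Two almost Hermitian structures are globally conformal if they have the same $J$ and metrics related by $\langle\cdot,\cdot\rangle'=e^{2f}\langle\cdot,\cdot\rangle$ for a globally defined smooth function $f$. *)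

(* Defs.v *)
From HB Require Import structures.
From mathcomp Require Export all_boot all_order all_algebra.
From mathcomp Require Export all_classical all_reals all_analysis.
From mathcomp Require Import ring.
Set Implicit Arguments.
Unset Strict Implicit.
Unset Printing Implicit Defensive.
Import Order.TTheory GRing.Theory Num.Theory.
Export numFieldNormedType.Exports.
Local Open Scope classical_set_scope.
Local Open Scope ring_scope.

(** * Smooth functions and smooth manifolds *)

Section Smooth.
Variables (R : realType) (m : nat).
Local Notation V := 'cV[R]_m.

Definition basis_vec (i : 'I_m) : V := delta_mx i 0.

Definition partial (W : normedModType R) (i : 'I_m) (f : V -> W) (x : V) : W :=
  'D_(basis_vec i) f x.

(* On an open set, being C^oo is the same as all iterated directional
   derivatives being (Frechet) differentiable. *)
Definition smooth_on (W : normedModType R) (O : set V) (f : V -> W) : Prop :=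
  forall (s : seq V) (x : V), O x ->
    differentiable (foldl (fun (h : V -> W) (v y : V) => 'D_v h y) f s) x.

Definition Jac (f : V -> V) (x : V) : 'M[R]_m :=
  \matrix_(k, i) partial i f x k 0.

(* [coord] is only meaningful on [dom], and [point] only on its image. *)
Record chart (M : topologicalType) := Chart {
  dom : set M;
  coord : M -> V;
  point : V -> M;
  dom_open : open dom;
  img_open : open (coord @` dom);
  coord_cont : {within dom, continuous coord};
  point_cont : {within coord @` dom, continuous point};
  coordK : forall p, dom p -> point (coord p) = p }.

Definition chart_img (M : topologicalType) (c : chart M) : set V :=
  coord c @` dom c.

Record smooth_manifold (M : topologicalType) := SmoothManifold {
  atlas : set (chart M);
  atlas_cover : forall p, exists2 c, atlas c & dom c p;
  atlas_compat : forall c c', atlas c -> atlas c' ->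
    smooth_on (coord c @` (dom c `&` dom c')) (coord c' \o point c);
  manifold_hausdorff : hausdorff_space M;
  manifold_second_countable : @second_countable M }.

(* The coordinate expression domain of an open set A of M in the chart c. *)
Definition patch (M : topologicalType) (c : chart M) (A : set M) : set V :=
  coord c @` (dom c `&` A).

Definition smooth_fun (M : topologicalType) (X : smooth_manifold M)
    (A : set M) (f : M -> R) : Prop :=
  forall c, atlas X c -> smooth_on (patch c A) (f \o point c).

End Smooth.

(** * Tensors on a Euclidean vector space with Gram matrix G

  Vectors are columns, one-forms are rows, endomorphisms are matrices acting on
  columns, and a bilinear form B is the matrix with entries B(d_i, d_j). *)

Section LinearAlgebra.
Variables (R : realType) (m : nat).
Local Notation V := 'cV[R]_m.
Local Notation d := (@basis_vec R m).
Implicit Types (G J : 'M[R]_m) (X Y Z : V).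

Definition bilin (B : 'M[R]_m) X Y : R := (X^T *m B *m Y) 0 0.

Definition app_form (a : 'rV[R]_m) X : R := (a *m X) 0 0.

Definition sharp G (a : 'rV[R]_m) : V := invmx G *m a^T.

Definition form_J J (a : 'rV[R]_m) : 'rV[R]_m := - (a *m J).

(* Metric contraction; see [mtrace_frame]: for bilinear T this is
   \sum_i T (e i) (e i) for any orthonormal frame e. *)
Definition mtrace (W : lmodType R) G (T : V -> V -> W) : W :=
  \sum_a \sum_b invmx G a b *: T (d a) (d b).

Definition orthonormal G (e : 'I_m -> V) : Prop :=
  forall i j, bilin G (e i) (e j) = (i == j)%:R.

(* A (1,2)-tensor xi is stored as the family of endomorphisms xi_{d_i}. *)
Definition tensor12 := {ffun 'I_m -> 'M[R]_m}.

Definition tens (xi : tensor12) X : 'M[R]_m := \sum_i X i 0 *: xi i.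

Definition tensor_sqnorm G (xi : tensor12) : R :=
  mtrace (W := R^o) G (fun X X' =>
    mtrace (W := R^o) G (fun Y Y' =>
      bilin G (tens xi X *m Y) (tens xi X' *m Y'))).

Definition form2_inner G (al be : 'M[R]_m) : R :=
  2^-1 * mtrace (W := R^o) G (fun X X' =>
    mtrace (W := R^o) G (fun Y Y' => bilin al X Y * bilin be X' Y')).

Definition space_W G J : set tensor12 := [set xi |
  (forall X Y Z, bilin G (tens xi X *m Y) Z = - bilin G Y (tens xi X *m Z)) /\
  (forall X, J *m tens xi X + tens xi X *m J = 0)].

Definition space_W1 G J : set tensor12 := [set xi | space_W G J xi /\
  forall X, tens xi X *m X = 0].

Definition space_W2 G J : set tensor12 := [set xi | space_W G J xi /\
  forall X Y Z,
    bilin G (tens xi X *m Y) (J *m Z) + bilin G (tens xi Y *m Z) (J *m X)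
    + bilin G (tens xi Z *m X) (J *m Y) = 0].

Definition space_W3 G J : set tensor12 := [set xi | space_W G J xi /\
  (forall X Y, tens xi (J *m X) *m (J *m Y) = tens xi X *m Y) /\
  mtrace G (fun X Y => tens xi X *m Y) = 0].

Definition space_W4 G J : set tensor12 := [set xi | space_W G J xi /\
  exists th : 'rV[R]_m, forall X Y,
    4 *: (tens xi X *m Y) =
      bilin G X Y *: sharp G th - app_form th Y *: X
      - bilin G (J *m X) Y *: (J *m sharp G th)
      + app_form (form_J J th) Y *: (J *m X)].

Definition gh_space G J (a : nat) : set tensor12 :=
  match a with
  | 1 => space_W1 G J
  | 2 => space_W2 G J
  | 3 => space_W3 G J
  | 4 => space_W4 G J
  | _ => [set 0]
  end.

(* [gh_component G J xi a] is the W_a-component of xi (a = 1, 2, 3, 4): the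
   a-th term of the decomposition of xi along W_1 + W_2 + W_3 + W_4. *)
Definition gh_decomposition G J (xi : tensor12) : set (nat -> tensor12) :=
  [set eta | (forall a, gh_space G J a (eta a)) /\
             xi = \sum_(1 <= a < 5) eta a].

Definition gh_component G J (xi : tensor12) : nat -> tensor12 :=
  xget (fun=> 0) (gh_decomposition G J xi).

Lemma mtrace_frame (W : lmodType R) G (T : V -> V -> W) (e : 'I_m -> V) :
  (forall Y, linear (T^~ Y)) -> (forall X, linear (T X)) ->
  orthonormal G e -> \sum_i T (e i) (e i) = mtrace G T.
Proof.
move=> linl linr oe.
pose E : 'M[R]_m := \matrix_(a, i) e i a 0.
have eE i : e i = \sum_a E a i *: d a.
  rewrite {1}(matrix_sum_delta (e i)); apply: eq_bigr => a _.
  by rewrite big_ord1 mxE.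
have EGE : E^T *m G *m E = 1%:M.
  apply/matrixP => i j; rewrite mxE [RHS]mxE -oe /bilin [RHS]mxE.
  apply: eq_bigr => k _; rewrite !mxE; congr (_ * _).
  by apply: eq_bigr => l _; rewrite !mxE.
have iG : invmx G = E *m E^T.
  have /mulmx1_unit[_ Eu] := EGE.
  have EEG : E *m E^T *m G = 1%:M.
    by rewrite -mulmxA; apply: mulmx1C.
  have [_ Gu] := mulmx1_unit EEG.
  by rewrite -[RHS](mulmxK Gu) EEG mul1mx.
have T0l Y : T 0 Y = 0.
  by have /= := linl Y (-1) 0 0; rewrite scaler0 addr0 scaleN1r addNr.
have T0r X : T X 0 = 0.
  by have := linr X (-1) 0 0; rewrite scaler0 addr0 scaleN1r addNr.
have suml I (r : seq I) (c : I -> R) (v : I -> V) Y :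
    T (\sum_(i <- r) c i *: v i) Y = \sum_(i <- r) c i *: T (v i) Y.
  elim: r => [|i r IH]; rewrite ?big_nil ?T0l // !big_cons.
  by have := linl Y (c i) (v i) (\sum_(i <- r) c i *: v i) => /= ->; rewrite IH.
have sumr I (r : seq I) (c : I -> R) (v : I -> V) X :
    T X (\sum_(i <- r) c i *: v i) = \sum_(i <- r) c i *: T X (v i).
  elim: r => [|i r IH]; rewrite ?big_nil ?T0r // !big_cons.
  by rewrite (linr X (c i) (v i)) IH.
rewrite /mtrace iG.
under eq_bigr => i _ do rewrite eE suml.
under eq_bigr => i _ do under eq_bigr => a _ do rewrite sumr scaler_sumr.
rewrite exchange_big; apply: eq_bigr => a _; rewrite exchange_big.
apply: eq_bigr => b _; rewrite mxE scaler_suml; apply: eq_bigr => i _.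
by rewrite scalerA !mxE.
Qed.

End LinearAlgebra.

(** * Almost Hermitian geometry in a coordinate domain

  g and J are the component matrices, as functions of the coordinates. *)

Section Local.
Variables (R : realType) (n : nat).
Local Notation m := (2 * n)%N.
Local Notation V := 'cV[R]_m.
Variables g J : V -> 'M[R]_m.

(* [christoffel x i] k j is the Christoffel symbol Gamma^k_{ij} of the
   Levi-Civita connection, so that nabla_{d_i} d_j = \sum_k Gamma^k_{ij} d_k *)
Definition christoffel (x : V) (i : 'I_m) : 'M[R]_m :=
  \matrix_(k, j) (2^-1 * \sum_l invmx (g x) k l *
    (partial i g x j l + partial j g x i l - partial l g x i j)).

Definition nabla_endo (A : V -> 'M[R]_m) (x : V) (i : 'I_m) : 'M[R]_m :=
  partial i A x + christoffel x i *m A x - A x *m christoffel x i.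

Definition nabla_bilin (B : V -> 'M[R]_m) (x : V) (i : 'I_m) : 'M[R]_m :=
  partial i B x - (christoffel x i)^T *m B x - B x *m christoffel x i.

(* Torsion-freeness and metricity, where g is symmetric and invertible. *)
Lemma christoffel_torsion_free (x : V) (i j k : 'I_m) :
  (forall l, (partial l g x)^T = partial l g x) ->
  christoffel x i k j = christoffel x j k i.
Proof.
move=> dgT; rewrite !mxE; congr (_ * _); apply: eq_bigr => l _.
rewrite -[in X in _ = _ * (_ - X)](dgT l) [in X in _ = _ * (_ - X)]mxE.
by rewrite [partial i g x j l + _]addrC.
Qed.

Lemma christoffel_metric (x : V) (i : 'I_m) :
  (g x)^T = g x -> g x \in unitmx ->
  (forall l, (partial l g x)^T = partial l g x) -> nabla_bilin g x i = 0.
Proof.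
move=> gT gu dgT.
pose K : 'M[R]_m := \matrix_(l, j)
  (partial i g x j l + partial j g x i l - partial l g x i j).
have GE : christoffel x i = 2^-1 *: (invmx (g x) *m K).
  apply/matrixP => k j; rewrite !mxE; congr (_ * _).
  by apply: eq_bigr => l _; rewrite !mxE.
have gG : g x *m christoffel x i = 2^-1 *: K.
  by rewrite GE -scalemxAr mulKVmx.
have Gg : (christoffel x i)^T *m g x = 2^-1 *: K^T.
  by rewrite -[in LHS]gT -trmx_mul gG linearZ.
rewrite /nabla_bilin Gg gG; apply/matrixP => a b; rewrite !mxE.
have E : partial i g x b a = partial i g x a b.
  by rewrite -[in LHS](dgT i) mxE.
by rewrite E; field.
Qed.

Definition intrinsic_torsion (x : V) : tensor12 R m :=
  [ffun i => - 2^-1 *: (J x *m nabla_endo J x i)].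

Definition torsion_component (a : nat) (x : V) : tensor12 R m :=
  gh_component (g x) (J x) (intrinsic_torsion x) a.

(* omega(X, Y) = <X, J Y> *)
Definition kahler (x : V) : 'M[R]_m := g x *m J x.

(* (d^* B)(Y) = - \sum_i (nabla_{e_i} B)(e_i, Y) *)
Definition codiff (B : V -> 'M[R]_m) (x : V) : 'rV[R]_m :=
  - \row_j mtrace (W := R^o) (g x) (fun X Y =>
      bilin (\sum_i X i 0 *: nabla_bilin B x i) Y (basis_vec R j)).

Definition lee_form (x : V) : 'rV[R]_m :=
  - (n%:R - 1)^-1 *: form_J (J x) (codiff kahler x).

(* (d a)(X, Y) = X (a Y) - Y (a X) - a [X, Y] *)
Definition ext_deriv1 (a : V -> 'rV[R]_m) (x : V) : 'M[R]_m :=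
  \matrix_(i, j) (partial i a x 0 j - partial j a x 0 i).

Definition lambda11_0 (x : V) (al : 'M[R]_m) : 'M[R]_m :=
  2^-1 *: (al + (J x)^T *m al *m J x)
  - (n%:R^-1 * form2_inner (g x) al (kahler x)) *: kahler x.

End Local.

(** * Almost Hermitian manifolds

  A tensor field is given by its components in all charts, subject to the
  tensor transformation law. *)

Section Global.
Variables (R : realType) (n : nat) (M : topologicalType).
Local Notation m := (2 * n)%N.
Local Notation V := 'cV[R]_m.
Variable X : smooth_manifold R m M.
Local Notation field := (chart R m M -> V -> 'M[R]_m).

(* (J, g) is an almost Hermitian structure on the open subset A of M. *)
Record almost_hermitian (A : set M) (g J : field) : Prop := AlmostHermitian {
  metric_smooth : forall c, atlas X c -> smooth_on (patch c A) (g c);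
  acs_smooth : forall c, atlas X c -> smooth_on (patch c A) (J c);
  metric_sym : forall c x, atlas X c -> patch c A x -> (g c x)^T = g c x;
  metric_pos : forall c x, atlas X c -> patch c A x ->
    forall v : V, v != 0 -> 0 < bilin (g c x) v v;
  acs_sqr : forall c x, atlas X c -> patch c A x -> J c x *m J c x = - 1%:M;
  acs_isometry : forall c x, atlas X c -> patch c A x -> forall v w : V,
    bilin (g c x) (J c x *m v) (J c x *m w) = bilin (g c x) v w;
  metric_transform : forall c c' p, atlas X c -> atlas X c' ->
    dom c p -> dom c' p -> A p ->
    let D := Jac (coord c' \o point c) (coord c p) in
    g c (coord c p) = D^T *m g c' (coord c' p) *m D;
  acs_transform : forall c c' p, atlas X c -> atlas X c' ->
    dom c p -> dom c' p -> A p ->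
    let D := Jac (coord c' \o point c) (coord c p) in
    D *m J c (coord c p) = J c' (coord c' p) *m D }.

Variables g J : field.

Definition component_vanishes_at (a : nat) (p : M) : Prop :=
  forall c, atlas X c -> dom c p ->
    torsion_component (g c) (J c) a (coord c p) = 0.

(* On A, the structure is of type W_a + W_b + ... with a, b, ... listed in s. *)
Definition of_type (A : set M) (s : seq nat) : Prop :=
  forall (a : nat) (p : M), a \in [:: 1; 2; 3; 4]%N -> a \notin s ->
    A p -> component_vanishes_at a p.

Definition lee_closed : Prop :=
  forall c x, atlas X c -> chart_img c x ->
    ext_deriv1 (lee_form (g c) (J c)) x = 0.

Definition lee_lambda11_0_vanishes : Prop :=
  forall c x, atlas X c -> chart_img c x ->
    lambda11_0 (g c) (J c) x (ext_deriv1 (lee_form (g c) (J c)) x) = 0.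

(* On A, the Lee form is d (ln (1 / ||xi_(1)||^2)). *)
Definition lee_is_dlog_xi1 (A : set M) : Prop :=
  forall c x, atlas X c -> patch c A x -> forall v : V,
    is_derive x v
      (fun y => ln (tensor_sqnorm (g c y)
                      (torsion_component (g c) (J c) 1 y))^-1)
      (app_form (lee_form (g c) (J c) x) v).

(* (g', J') has the same J, and g' = e^{2f} g, on A. *)
Definition globally_conformal (A : set M) (g' J' : field) : Prop :=
  exists2 f : M -> R, smooth_fun X A f &
    forall c x, atlas X c -> patch c A x ->
      J' c x = J c x /\ g' c x = expR (2 * f (point c x)) *: g c x.

End Global.

(* Main.v *)
(* Let xi be the intrinsic torsion, omega the Kahler form, theta the Lee form.  The
   connection nabla + xi preserves g and J, and its torsion is algebraic in xi.

   For type W_2 + W_4 one finds d omega = theta /\ omega, hence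
   d theta /\ omega = 0, and wedging two-forms with omega is injective for n > 2.

   For type W_1 + W_4 one finds d omega = theta /\ omega + Psi, where
   Psi = 6 <xi_(1) (J ., .), .> is of type (3,0) + (0,3), hence
   d Psi = theta /\ Psi - d theta /\ omega.  Computing d Psi with nabla + xi shows
   that d Psi - theta /\ Psi has no part of type (2,2), which kills the part of type
   (1,1) of d theta.

   Let n = 3 and u = ||xi_(1)||^2.  Where u > 0, (nabla + xi) xi_(1) is a complex
   multiple of xi_(1), and the first Bianchi identity of nabla + xi determines the
   multiplier well enough to give beta /\ Psi + d theta /\ omega = 0 with
   beta = d ln u + theta.  The exterior derivative of this relation is
   2 d theta /\ Psi = 0, and linear algebra yields beta = 0 and d theta = 0.  Thus
   du = - u theta everywhere, so that the zero set of u is open and closed, and on its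
   complement the conformal metric u g has intrinsic torsion xi_(1). *)

Require Import Defs.
Import Order.TTheory GRing.Theory Num.Theory.
From mathcomp Require Import ring lra.
Local Open Scope classical_set_scope.
Local Open Scope ring_scope.
Set Implicit Arguments.
Unset Strict Implicit.
Unset Printing Implicit Defensive.

(** * Smooth functions on open sets *)

(** Complex forms are handled through real parts: a form of type (3,0) + (0,3) is a real three-form
    t with t(JX, Y, Z) = t(X, JY, Z), and multiplication by i is the twist t(J., ., .). Complex
    dimension three enters through one fact: a four-form with the same compatibility vanishes. In
    dimension six the derivative of xi_(1) along A is therefore a(A) t + b(A) t(J., ., .). The norm
    sees only a, since du = 2 a u, while d Psi sees a and b. The curvature commutes with J, hence
    does not contribute to the part of type (4,0) + (0,4) of the Bianchi identity, which reads a(W)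
    + b(JW) = - theta(W) and eliminates b.

    The obstacle is the zero set of u, of unknown shape, where ln u has no meaning. The equation du
    = - u theta extends to it because the derivative of a squared norm is linear in the tensor
    itself, and as a linear equation along segments it makes the zero set open. The open set where d
    theta is nonzero lies in it, so there the structure has type W_4 and case (i) applies. *)

Section DifferentiabilityIsLocal.
Variables (R : realType) (V W : normedModType R).
Implicit Types f g : V -> W.

(** A first-order expansion depends only on the germ at x, so the expansion of [f] is one of [g],
    and uniqueness of the differential identifies the linear parts. *)
Lemma near_eq_differentiable f g x :
  (\forall y \near x, f y = g y) -> differentiable f x -> differentiable g x.
Proof.
move=> fg df; have [dfc dfE] := (diff_locallyP x f).1 df.
have fgx : f x = g x := nbhs_singleton fg.
have gE : g \o shift x = cst (g x) + 'd f x +o_ 0 id.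
  apply/eqaddoP => e e0; have /eqaddoP/(_ e e0) := dfE.
  have : \forall h \near 0, f (h + x) = g (h + x).
    by have := fg; rewrite [X in X -> _](near_shift 0 x) subr0.
  by apply: filterS2 => h fgh; rewrite /= !fctE /= fgh fgx.
apply/diff_locallyP; split; first by rewrite (diff_unique _ gE).
by rewrite (diff_unique _ gE).
Qed.

End DifferentiabilityIsLocal.

(** * Rules for directional derivatives *)

Section DirectionalDerivatives.
Variables (R : realType) (V : normedModType R).
Implicit Types (f g : V -> R) (x v : V).

Lemma derive_addf (W : normedModType R) (f g : V -> W) x v :
  differentiable f x -> differentiable g x ->
  'D_v (fun y => f y + g y) x = 'D_v f x + 'D_v g x.
Proof. by move=> /diff_derivable df /diff_derivable dg; exact: deriveD. Qed.

Lemma derive_oppf (W : normedModType R) (f : V -> W) x v :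
  differentiable f x -> 'D_v (fun y => - f y) x = - 'D_v f x.
Proof. by move=> /diff_derivable df; exact: deriveN. Qed.

Lemma derive_mulf f g x v :
  differentiable f x -> differentiable g x ->
  'D_v (fun y => f y * g y) x = 'D_v f x * g x + f x * 'D_v g x.
Proof.
move=> /diff_derivable df /diff_derivable dg.
by rewrite (deriveM (df v) (dg v)) addrC [_ *: _]mulrC.
Qed.

Lemma differentiable_mulf f g x :
  differentiable f x -> differentiable g x ->
  differentiable (fun y => f y * g y) x.
Proof. exact: differentiableM. Qed.

Lemma derive_linearE (W : normedModType R) (f : V -> W) x :
  differentiable f x -> linear (fun v => 'D_v f x).
Proof. by move=> df a u v; rewrite !(deriveE _ df) linearP. Qed.

Lemma derive_compE (U W : normedModType R) (f : V -> U) (h : U -> W) x v :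
  differentiable f x -> differentiable h (f x) ->
  'D_v (h \o f) x = 'D_('D_v f x) h (f x).
Proof.
move=> df dh; rewrite (deriveE _ (differentiable_comp df dh)).
by rewrite (deriveE _ dh) (deriveE _ df) diff_comp.
Qed.

Lemma derive_comp_real f (h : R -> R) (dh : R) x v :
  differentiable f x -> is_derive (f x) 1 h dh ->
  differentiable (h \o f) x /\ 'D_v (h \o f) x = dh * 'D_v f x.
Proof.
move=> df [dvh <-].
have dh' : differentiable h (f x) by apply/derivable1_diffP.
split; first exact: differentiable_comp.
rewrite (derive_compE _ df dh') (deriveE _ dh') (deriveE (1 : R) dh').
by rewrite -[X in 'd h _ X]mulr1 [LHS]linearZ mulrC.
Qed.

Lemma derive_invf f x v : differentiable f x -> f x != 0 ->
  'D_v (fun y => (f y)^-1) x = - ((f x)^-1 * ((f x)^-1 * 'D_v f x)).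
Proof.
move=> /diff_derivable df fx0; rewrite (deriveV fx0 (df v)) scaleNr.
by rewrite -exprVn expr2 -scalerA.
Qed.

Lemma derive_lnf f x v : differentiable f x -> 0 < f x ->
  differentiable (fun y => ln (f y)) x /\
  'D_v (fun y => ln (f y)) x = (f x)^-1 * 'D_v f x.
Proof. by move=> df fx; apply: derive_comp_real => //; exact: is_derive1_ln. Qed.

End DirectionalDerivatives.

(** * Closure properties of smooth functions *)

Section SmoothCalculus.
Variables (R : realType) (m : nat).
Local Notation V := 'cV[R]_m.

Section Generic.
Variable W : normedModType R.
Implicit Types (O : set V) (f g : V -> W).

(** Recursion on the order instead of the list of directions in [smooth_on]: the derivative of a
    product or a quotient is a combination of other functions, of class one lower, so the closure
    proofs need an induction in which the functions vary. *)
Fixpoint Ck (k : nat) O f : Prop :=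
  (forall x, O x -> differentiable f x) /\
  (if k is k'.+1 then forall v, Ck k' O ('D_v f) else True).

Lemma Ck_differentiable k O f x : Ck k O f -> O x -> differentiable f x.
Proof. by case: k => [|k] [df _]; exact: df. Qed.

Lemma smooth_on_derive O f v : smooth_on O f -> smooth_on O ('D_v f).
Proof. by move=> sf s; exact: sf (v :: s). Qed.

Lemma smooth_on_differentiable O f x :
  smooth_on O f -> O x -> differentiable f x.
Proof. by move=> sf Ox; exact: sf [::] x Ox. Qed.

Lemma smooth_onP O f : smooth_on O f <-> forall k, Ck k O f.
Proof.
split=> [sf k|Cf s].
  elim: k f sf => [|k IH] f sf; first by split=> // x; exact: (sf [::]).
  by split=> [x|v]; [exact: (sf [::])|exact/IH/smooth_on_derive].
elim: s f Cf => [|v s IH] f Cf x Ox /=.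
  by have [df _] := Cf 0%N; exact: df.
by apply: IH => // k; have [_] := Cf k.+1; exact.
Qed.

Lemma Ck_derive k O f v : Ck k.+1 O f -> Ck k O ('D_v f).
Proof. by case=> _; exact. Qed.

Lemma CkW k O f : Ck k.+1 O f -> Ck k O f.
Proof.
elim: k f => [|k IH] f [df Df]; split=> // v; exact: IH (Df v).
Qed.

Lemma Ck_eq k O f g : open O -> {in O, f =1 g} -> Ck k O f -> Ck k O g.
Proof.
move=> oO; elim: k f g => [|k IH] f g fg Cf.
  split=> // x Ox; apply: near_eq_differentiable (Ck_differentiable Cf Ox).
  by near=> y; apply/fg/mem_set; near: y; exact: open_nbhs_nbhs.
have nfg x : O x -> \forall y \near x, f y = g y.
  move=> Ox; near=> y; apply/fg/mem_set; near: y; exact: open_nbhs_nbhs.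
split=> [x Ox|v].
  by apply: near_eq_differentiable (Ck_differentiable Cf Ox); exact: nfg.
have [_ Df] := Cf; apply: IH (Df v) => x /set_mem Ox.
exact/near_eq_derive/nfg.
Unshelve. all: by end_near. Qed.

Lemma smooth_on_eq O f g :
  open O -> {in O, f =1 g} -> smooth_on O f -> smooth_on O g.
Proof.
move=> oO fg /smooth_onP Cf; apply/smooth_onP => k; exact: Ck_eq (Cf k).
Qed.

Lemma smooth_on_sub O O' f : O' `<=` O -> smooth_on O f -> smooth_on O' f.
Proof. by move=> OO' sf s x /OO'; exact: sf. Qed.

Lemma Ck_cst k O (w : W) : Ck k O (fun=> w).
Proof.
elim: k w => [|k IH] w; split=> //.
by move=> v; rewrite (_ : 'D_v _ = fun=> 0)//; apply/funext => x; exact: derive_cst.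
Qed.

Lemma smooth_on_cst O (w : W) : smooth_on O (fun=> w).
Proof. by apply/smooth_onP => k; exact: Ck_cst. Qed.

Lemma CkD k O f g : open O -> Ck k O f -> Ck k O g -> Ck k O (fun x => f x + g x).
Proof.
move=> oO; elim: k f g => [|k IH] f g Cf Cg;
    have df x : O x -> differentiable f x by exact: Ck_differentiable Cf.
  split=> // x Ox; apply: differentiableD; first exact: df.
  exact: Ck_differentiable Cg _.
have dg x : O x -> differentiable g x by exact: Ck_differentiable Cg.
split=> [x Ox|v]; first by apply: differentiableD; [exact: df|exact: dg].
apply: (@Ck_eq _ _ (fun x => 'D_v f x + 'D_v g x)) => //.
  by move=> x /set_mem Ox; rewrite derive_addf//; [exact: df|exact: dg].
by apply: IH; exact: Ck_derive.
Qed.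

Lemma smooth_onD O f g : open O ->
  smooth_on O f -> smooth_on O g -> smooth_on O (fun x => f x + g x).
Proof.
by move=> oO /smooth_onP Cf /smooth_onP Cg; apply/smooth_onP => k; exact: CkD.
Qed.

Lemma smooth_on_sum O (I : Type) (r : seq I) (P : pred I) (F : I -> V -> W) :
  open O -> (forall i, P i -> smooth_on O (F i)) ->
  smooth_on O (fun x => \sum_(i <- r | P i) F i x).
Proof.
move=> oO sF; elim: r => [|i r IH].
  under eq_fun do rewrite big_nil; exact: smooth_on_cst.
case Pi: (P i); under eq_fun do rewrite big_cons Pi; last exact: IH.
by apply: smooth_onD => //; exact: sF.
Qed.

End Generic.

Section Scalar.
Implicit Types (O : set V) (f g : V -> R).

Lemma CkM k O f g : open O -> Ck k O f -> Ck k O g -> Ck k O (fun x => f x * g x).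
Proof.
move=> oO; elim: k f g => [|k IH] f g Cf Cg;
    have df x : O x -> differentiable f x by exact: Ck_differentiable Cf.
  split=> // x Ox; apply: differentiable_mulf; first exact: df.
  exact: Ck_differentiable Cg _.
have dg x : O x -> differentiable g x by exact: Ck_differentiable Cg.
split=> [x Ox|v]; first by apply: differentiable_mulf; [exact: df|exact: dg].
apply: (@Ck_eq _ _ _ (fun x => 'D_v f x * g x + f x * 'D_v g x)) => //.
  by move=> x /set_mem Ox; rewrite derive_mulf//; [exact: df|exact: dg].
apply: CkD => //; apply: IH; by [exact: Ck_derive|exact: CkW].
Qed.

Lemma smooth_onM O f g : open O ->
  smooth_on O f -> smooth_on O g -> smooth_on O (fun x => f x * g x).
Proof.
by move=> oO /smooth_onP Cf /smooth_onP Cg; apply/smooth_onP => k; exact: CkM.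
Qed.

Lemma smooth_onN O f : open O -> smooth_on O f -> smooth_on O (fun x => - f x).
Proof.
move=> oO sf; under eq_fun do rewrite -mulN1r.
by apply: smooth_onM => //; exact: smooth_on_cst.
Qed.

Lemma smooth_onB O f g : open O ->
  smooth_on O f -> smooth_on O g -> smooth_on O (fun x => f x - g x).
Proof. by move=> oO sf sg; apply: smooth_onD => //; exact: smooth_onN. Qed.

Lemma smooth_on_prod O (I : Type) (r : seq I) (P : pred I) (F : I -> V -> R) :
  open O -> (forall i, P i -> smooth_on O (F i)) ->
  smooth_on O (fun x => \prod_(i <- r | P i) F i x).
Proof.
move=> oO sF; elim: r => [|i r IH].
  under eq_fun do rewrite big_nil; exact: smooth_on_cst.
case Pi: (P i); under eq_fun do rewrite big_cons Pi; last exact: IH.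
by apply: smooth_onM => //; exact: sF.
Qed.

(** The derivative - (1/f)^2 Df involves 1/f itself, which has class k by induction, and Df, which
    loses one order. *)
Lemma CkV k O f : open O -> (forall x, O x -> f x != 0) ->
  Ck k O f -> Ck k O (fun x => (f x)^-1).
Proof.
move=> oO f0; elim: k => [|k IH] Cf.
  by split=> // x Ox; apply: differentiableV; [exact: Ck_differentiable Cf _|exact: f0].
split=> [x Ox|v].
  by apply: differentiableV; [exact: Ck_differentiable Cf _|exact: f0].
apply: (@Ck_eq _ _ _ (fun x => (-1) * ((f x)^-1 * ((f x)^-1 * 'D_v f x)))) => //.
  move=> x /set_mem Ox.
  by rewrite derive_invf ?mulN1r//; [exact: Ck_differentiable Cf _|exact: f0].
apply: CkM => //; first exact: Ck_cst.
apply: CkM; rewrite //; first exact: IH (CkW Cf).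
by apply: CkM => //; [exact: IH (CkW Cf)|exact: Ck_derive].
Qed.

Lemma smooth_onV O f : open O -> (forall x, O x -> f x != 0) ->
  smooth_on O f -> smooth_on O (fun x => (f x)^-1).
Proof. by move=> oO f0 /smooth_onP Cf; apply/smooth_onP => k; exact: CkV. Qed.

Lemma smooth_on_ln O f : open O -> (forall x, O x -> 0 < f x) ->
  smooth_on O f -> smooth_on O (fun x => ln (f x)).
Proof.
move=> oO f0 sf; have df x (Ox : O x) := smooth_on_differentiable sf Ox.
have dl x : O x -> differentiable (fun y => ln (f y)) x.
  by move=> Ox; have [] := derive_lnf 0 (df x Ox) (f0 x Ox).
apply/smooth_onP => -[|k]; split=> // v.
apply: (@Ck_eq _ _ _ (fun x => (f x)^-1 * 'D_v f x)) => //.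
  move=> x /set_mem Ox.
  by have [_ ->] := derive_lnf v (df x Ox) (f0 x Ox).
move: k; apply/smooth_onP; apply: smooth_onM => //; last exact: smooth_on_derive.
by apply: smooth_onV => // x Ox; rewrite gt_eqF// f0.
Qed.

End Scalar.

Section Matrices.
Variables (p q : nat).
Implicit Types (O : set V) (f : V -> 'M[R]_(p, q)).

Lemma derive_mxE f x v i j : differentiable f x ->
  'D_v f x i j = 'D_v (fun y => f y i j) x.
Proof. by move=> df; rewrite derive_mx ?mxE//; exact: diff_derivable. Qed.

Lemma differentiable_mxP f x :
  differentiable f x <-> forall i j, differentiable (fun y => f y i j) x.
Proof.
split=> [df i j|df].
  exact: (differentiable_comp (g := fun N : 'M[R]_(p, q) => N i j : R) df
           (differentiable_coord _ _ _)).
rewrite (_ : f = \sum_(i < p) \sum_(j < q)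
    (fun y => f y i j *: (delta_mx i j : 'M[R]_(p, q)))); last first.
  apply/funext => y; rewrite {1}[f y]matrix_sum_delta fct_sumE.
  by apply: eq_bigr => i _; rewrite fct_sumE.
apply: differentiable_sum => i; apply: differentiable_sum => j.
exact: differentiableZl.
Qed.

Lemma Ck_mxP k O f : open O ->
  Ck k O f <-> forall i j, Ck k O (fun y => f y i j).
Proof.
move=> oO; elim: k f => [|k IH] f; split=> [Cf i j|Cf].
- by split=> // x Ox; move: i j; apply/differentiable_mxP; exact: Ck_differentiable Cf _.
- by split=> // x Ox; apply/differentiable_mxP => i j; exact: Ck_differentiable (Cf i j) _.
- have df x : O x -> differentiable f x by move=> Ox; exact: Ck_differentiable Cf _.
  split=> [x Ox|v]; first by move: i j; apply/differentiable_mxP; exact: df.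
  have [_ /(_ v)/(IH _).1/(_ i j)] := Cf.
  by apply: Ck_eq => // x /set_mem Ox; rewrite derive_mxE//; exact: df.
- have df x : O x -> differentiable f x.
    by move=> Ox; apply/differentiable_mxP => i j; exact: Ck_differentiable (Cf i j) _.
  split=> // v; apply/IH => i j; have [_ /(_ v)] := Cf i j.
  by apply: Ck_eq => // x /set_mem Ox; rewrite derive_mxE//; exact: df.
Qed.

Lemma smooth_on_mxP O f : open O ->
  smooth_on O f <-> forall i j, smooth_on O (fun y => f y i j).
Proof.
move=> oO; split=> [/smooth_onP Cf i j|Cf]; apply/smooth_onP => k.
  by move: i j; apply/Ck_mxP.
by apply/Ck_mxP => // i j; move: k; exact/smooth_onP.
Qed.

End Matrices.

Lemma smooth_on_mulmx p q r O (f : V -> 'M[R]_(p, q)) (h : V -> 'M[R]_(q, r)) :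
  open O -> smooth_on O f -> smooth_on O h -> smooth_on O (fun x => f x *m h x).
Proof.
move=> oO /smooth_on_mxP-/(_ oO) sf /smooth_on_mxP-/(_ oO) sh.
apply/smooth_on_mxP => // i j; under eq_fun do rewrite mxE.
by apply: smooth_on_sum => // k _; apply: smooth_onM.
Qed.

Lemma smooth_on_det p O (f : V -> 'M[R]_p) :
  open O -> smooth_on O f -> smooth_on O (fun x => \det (f x)).
Proof.
move=> oO /smooth_on_mxP-/(_ oO) sf; apply: smooth_on_sum => // s _.
apply: smooth_onM => //; first exact: smooth_on_cst.
by apply: smooth_on_prod => // i _; exact: sf.
Qed.

Lemma smooth_on_invmx p O (f : V -> 'M[R]_p) :
  open O -> (forall x, O x -> f x \in unitmx) ->
  smooth_on O f -> smooth_on O (fun x => invmx (f x)).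
Proof.
move=> oO fu sf; have sf' := sf; move/smooth_on_mxP: sf' => /(_ oO) sf'.
apply: (@smooth_on_eq _ _ (fun x => (\det (f x))^-1 *: \adj (f x))) => //.
  by move=> x /set_mem Ox; rewrite /invmx fu.
apply/smooth_on_mxP => // i j; under eq_fun do rewrite mxE.
apply: smooth_onM => //.
  apply: smooth_onV => //; last exact: smooth_on_det.
  by move=> x Ox; have := fu x Ox; rewrite unitmxE unitfE.
under eq_fun do rewrite mxE.
apply: smooth_onM => //; first exact: smooth_on_cst.
apply: smooth_on_det => //; apply/smooth_on_mxP => // k l.
by under eq_fun do rewrite !mxE; exact: sf'.
Qed.

End SmoothCalculus.

(** * Symmetry of second derivatives *)

Section Schwarz.
Variables (R : realType) (V : normedModType R).
Implicit Types (f : V -> R) (p x a b : V).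

Lemma is_derive_line f p a (s : R) : differentiable f (p + s *: a) ->
  is_derive s 1 (fun r => f (p + r *: a)) ('D_a f (p + s *: a)).
Proof.
move=> df; pose l (r : R) := p + r *: a.
have [dl Dl] : differentiable l s /\ 'D_1 l s = a.
  have dl : is_derive s 1 l a.
    have dZ : is_derive s 1 (fun r : R => r *: a) a.
      have [dsc dscE] := is_diff_scalel s a.
      apply: DeriveDef; first exact: diff_derivable.
      by rewrite deriveE// dscE scale1r.
    by rewrite -[X in is_derive _ _ _ X]add0r; exact: is_deriveD.
  by split; [apply/derivable1_diffP|rewrite derive_val].
apply: DeriveDef.
  by apply: diff_derivable; exact: (differentiable_comp dl df).
by rewrite (derive_compE (1 : R) dl df) Dl.
Qed.

(** The mean value theorem for s |-> f(x + h b + s a) - f(x + s a) turns the second difference into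
    h times a difference of two values of ['D_a f] near x, and the first-order expansion of ['D_a f]
    at x evaluates that difference up to o(h). *)
Lemma second_difference f (O : set V) x a b (e : R) :
  open O -> O x -> (forall y, O y -> differentiable f y) ->
  differentiable ('D_a f) x -> 0 < e ->
  \forall h \near 0^'+, `|f (x + h *: a + h *: b) - f (x + h *: a)
      - f (x + h *: b) + f x - h ^+ 2 * 'D_b ('D_a f) x| <= e * h ^+ 2.
Proof.
move=> oO Ox df dDf e0.
(* Both increments met below, c a and h b + c a with 0 <= c <= h, have norm at most h k. The
   precision e / (2 k) makes each of the two errors at most (e / 2) h. *)
pose k := `|a| + `|b| + 1.
have k0 : 0 < k by rewrite ltr_wpDl// addr_ge0.
have e'0 : 0 < e / (2 * k) by rewrite divr_gt0// mulr_gt0.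
have [d d0 dP] : exists2 d, 0 < d & forall w, `|w| < d -> O (w + x) /\
    `|'D_a f (w + x) - 'D_a f x - 'd ('D_a f) x w| <= e / (2 * k) * `|w|.
  have /eqaddoP/(_ _ e'0) := diff_locally dDf.
  have : \forall w \near 0, O (w + x).
    by have := open_nbhs_nbhs (conj oO Ox); rewrite [X in X -> _](near_shift 0 x) subr0.
  move=> nO nD; have /nbhs_normP[d /= d0 dP] : nbhs (0 : V) [set w | O (w + x) /\
    `|('D_a f \o shift x - (cst ('D_a f x) + 'd ('D_a f) x)) w| <= e / (2 * k) * `|w|].
    by apply: filterI nO nD.
  exists d => // w wd; have [|Ow] := dP w; first by rewrite /= sub0r normrN.
  by rewrite /= !fctE /= opprD addrA; split.
near=> h.
have h0 : 0 < h by near: h; exact: nbhs_right_gt.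
have hd : h * k < d.
  by rewrite -ltr_pdivlMr//; near: h; apply: nbhs_right_lt; rewrite divr_gt0.
have small s u : 0 <= s <= h -> (u == 0) || (u == h) -> `|u *: b + s *: a| <= h * k.
  move=> /andP[s0 sh] uh; rewrite (le_trans (ler_normD _ _))// !normrZ (ger0_norm s0).
  have un : `|u| <= h by case/orP: uh => /eqP ->; rewrite ?normr0 ?(ltW h0)// gtr0_norm.
  have := ler_wpM2r (normr_ge0 a) sh; have := ler_wpM2r (normr_ge0 b) un.
  by rewrite /k; lra.
pose phi s := f (x + h *: b + s *: a) - f (x + s *: a).
pose dphi s := 'D_a f (x + h *: b + s *: a) - 'D_a f (x + s *: a).
have Oin s u : 0 <= s <= h -> (u == 0) || (u == h) -> O (x + u *: b + s *: a).
  move=> sh uh; have [|Ow _] := dP (u *: b + s *: a); last by rewrite -addrA addrC.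
  by rewrite (le_lt_trans (small _ _ sh uh)).
have Oin0 s : 0 <= s <= h -> O (x + s *: a).
  by move=> sh; have := Oin s 0 sh; rewrite eqxx scale0r addr0; exact.
have Oinh s : 0 <= s <= h -> O (x + h *: b + s *: a).
  by move=> sh; apply: Oin => //; rewrite eqxx orbT.
have dphiP s : 0 <= s <= h -> is_derive s 1 phi (dphi s).
  by move=> sh; apply: is_deriveB; apply: is_derive_line; apply: df; [exact: Oinh|exact: Oin0].
have [||c] := @MVT_segment R phi dphi 0 h (ltW h0).
- by move=> s; rewrite in_itv /= => /andP[s0 sh]; apply: dphiP; rewrite !ltW.
- apply: derivable_within_continuous => s; rewrite in_itv /= => sh.
  by have [] := dphiP s sh.
rewrite in_itv /= subr0 => ch phiE.
have -> : f (x + h *: a + h *: b) - f (x + h *: a) - f (x + h *: b) + f x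
    = dphi c * h.
  by rewrite -phiE /phi !scale0r !addr0 opprB addrA [x + _ + h *: a]addrAC addrAC.
have Dab : 'D_b ('D_a f) x = 'd ('D_a f) x b by rewrite deriveE.
(* Expansions at h b + c a and at c a; their linear parts differ by h times ['D_b ('D_a f) x],
   whatever the intermediate point c is. *)
have -> : dphi c * h - h ^+ 2 * 'D_b ('D_a f) x = h *
    (('D_a f (h *: b + c *: a + x) - 'D_a f x - 'd ('D_a f) x (h *: b + c *: a))
    - ('D_a f (0 *: b + c *: a + x) - 'D_a f x - 'd ('D_a f) x (0 *: b + c *: a))).
  have -> : 'd ('D_a f) x (h *: b + c *: a) =
    h * 'd ('D_a f) x b + 'd ('D_a f) x (c *: a) by rewrite linearP.
  rewrite scale0r add0r Dab /dphi.
  rewrite [h *: b + _ + x]addrC addrA [c *: a + x]addrC; ring.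
have -> : e * h ^+ 2 = h * (e * h) by ring.
rewrite normrM [X in X * _ <= _]gtr0_norm// ler_pM2l//.
rewrite (le_trans (ler_normB _ _))//.
have bnd u : (u == 0) || (u == h) -> `|'D_a f (u *: b + c *: a + x) - 'D_a f x -
    'd ('D_a f) x (u *: b + c *: a)| <= e / 2 * h.
  move=> uh; have sm := small c u ch uh.
  have [_ /le_trans] := dP _ (le_lt_trans sm hd); apply.
  have -> : e / 2 * h = e / (2 * k) * (h * k) by field; lra.
  by rewrite ler_wpM2l// ltW.
have -> : e * h = e / 2 * h + e / 2 * h by field.
by rewrite lerD ?bnd ?eqxx ?orbT.
Unshelve. all: by end_near. Qed.

(** The second difference is symmetric in a and b, so a single small h puts both mixed derivatives
    within e / 2 of its quotient by h^2. *)
Lemma derive_comm f (O : set V) x a b :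
  open O -> O x -> (forall y, O y -> differentiable f y) ->
  differentiable ('D_a f) x -> differentiable ('D_b f) x ->
  'D_b ('D_a f) x = 'D_a ('D_b f) x.
Proof.
move=> oO Ox df dDa dDb; apply/eqP; rewrite -subr_eq0 -normr_le0.
apply/ler_addgt0Pr => e e0; rewrite add0r.
have e20 : 0 < e / 2 by rewrite divr_gt0.
have nA := second_difference b oO Ox df dDa e20.
have nB := second_difference a oO Ox df dDb e20.
have [h [[Ha Hb] h0]] := filter_ex (filterI (filterI nA nB) (nbhs_right_gt (0 : R))).
move: Ha Hb; rewrite [x + h *: b + h *: a]addrAC.
have h20 := exprn_gt0 2 h0; move: h20.
move: (h ^+ 2) (f _) (f (x + h *: a)) (f _) (f x) => r C B A D r0.
move: ('D_b ('D_a f) x) ('D_a ('D_b f) x) => Dba Dab Ha Hb.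
rewrite -(ler_pM2r r0) -[X in X <= _](ger0_norm (mulr_ge0 (normr_ge0 _) (ltW r0))).
rewrite normrM normr_id -normrM.
have -> : (Dba - Dab) * r =
  (A - C - B + D - r * Dab) - (A - B - C + D - r * Dba) by ring.
apply: (le_trans (ler_normB _ _)).
have -> : e * r = e / 2 * r + e / 2 * r by field.
by apply: lerD; [exact: Hb|exact: Ha].
Qed.

End Schwarz.

(** * Hermitian linear algebra *)

Section HermitianAlgebra.
Variables (R : realType) (V : lmodType R) (h : V -> V -> R) (J : V -> V).

Record hermitian : Prop := Hermitian {
  herm_linear : forall a X X' Y, h (a *: X + X') Y = a * h X Y + h X' Y;
  herm_sym : forall X Y, h X Y = h Y X;
  herm_pos : forall X, X != 0 -> 0 < h X X;
  herm_acs_linear : forall a X X', J (a *: X + X') = a *: J X + J X';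
  herm_acs_sqr : forall X, J (J X) = - X;
  herm_acs_isom : forall X Y, h (J X) (J Y) = h X Y }.

Record skew3 (t : V -> V -> V -> R) : Prop := Skew3 {
  skew3_linear : forall a X X' Y Z, t (a *: X + X') Y Z = a * t X Y Z + t X' Y Z;
  skew3_swap12 : forall X Y Z, t X Y Z = - t Y X Z;
  skew3_swap23 : forall X Y Z, t X Y Z = - t X Z Y }.

(** Real parts of complex trilinear alternating forms. By skew-symmetry the condition on the first
    two slots lets J move between any two slots. *)
Record form30 (t : V -> V -> V -> R) : Prop := Form30 {
  form30_skew :> skew3 t;
  form30_acs : forall X Y Z, t (J X) Y Z = t X (J Y) Z }.

Record skew4 (phi : V -> V -> V -> V -> R) : Prop := Skew4 {
  skew4_linear : forall a X X' Y Z W,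
    phi (a *: X + X') Y Z W = a * phi X Y Z W + phi X' Y Z W;
  skew4_swap12 : forall X Y Z W, phi X Y Z W = - phi Y X Z W;
  skew4_swap23 : forall X Y Z W, phi X Y Z W = - phi X Z Y W;
  skew4_swap34 : forall X Y Z W, phi X Y Z W = - phi X Y W Z }.

Section Rules.
Hypothesis H : hermitian.

Lemma hermDl X X' Y : h (X + X') Y = h X Y + h X' Y.
Proof. by have := herm_linear H 1 X X' Y; rewrite scale1r mul1r. Qed.
Lemma herm0l Y : h 0 Y = 0.
Proof. by have := hermDl 0 0 Y; rewrite addr0; lra. Qed.
Lemma hermZl a X Y : h (a *: X) Y = a * h X Y.
Proof. by rewrite -[a *: X]addr0 (herm_linear H) herm0l addr0. Qed.
Lemma hermNl X Y : h (- X) Y = - h X Y.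
Proof. by rewrite -scaleN1r hermZl mulN1r. Qed.
Lemma hermDr X Y Y' : h X (Y + Y') = h X Y + h X Y'.
Proof. by rewrite ![h X _](herm_sym H) hermDl. Qed.
Lemma hermZr a X Y : h X (a *: Y) = a * h X Y.
Proof. by rewrite ![h X _](herm_sym H) hermZl. Qed.
Lemma hermNr X Y : h X (- Y) = - h X Y.
Proof. by rewrite ![h X _](herm_sym H) hermNl. Qed.
Lemma herm0r X : h X 0 = 0.
Proof. by rewrite (herm_sym H) herm0l. Qed.
Lemma acsD X Y : J (X + Y) = J X + J Y.
Proof. by have := herm_acs_linear H 1 X Y; rewrite !scale1r. Qed.
Lemma acs0 : J 0 = 0.
Proof. by apply: (addIr (J 0)); rewrite -acsD !add0r. Qed.
Lemma acsZ a X : J (a *: X) = a *: J X.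
Proof. by rewrite -[a *: X]addr0 (herm_acs_linear H) acs0 addr0. Qed.
Lemma acsN X : J (- X) = - J X.
Proof. by rewrite -scaleN1r acsZ scaleN1r. Qed.
Lemma herm_acsl X Y : h (J X) Y = - h X (J Y).
Proof. by rewrite -(herm_acs_isom H) (herm_acs_sqr H) hermNl. Qed.
Lemma herm_acsC X Y : h X (J Y) = - h Y (J X).
Proof. by rewrite (herm_sym H) herm_acsl. Qed.
Lemma herm_acs0 X : h X (J X) = 0.
Proof. by have := herm_acsC X X; lra. Qed.

End Rules.

Section Skew3Rules.
Variable t : V -> V -> V -> R.
Hypothesis st : skew3 t.

Lemma skew3Dl X X' Y Z : t (X + X') Y Z = t X Y Z + t X' Y Z.
Proof. by have := skew3_linear st 1 X X' Y Z; rewrite scale1r mul1r. Qed.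
Lemma skew30l Y Z : t 0 Y Z = 0.
Proof. by have := skew3Dl 0 0 Y Z; rewrite addr0; lra. Qed.
Lemma skew3Zl a X Y Z : t (a *: X) Y Z = a * t X Y Z.
Proof. by rewrite -[a *: X]addr0 (skew3_linear st) skew30l addr0. Qed.
Lemma skew3Nl X Y Z : t (- X) Y Z = - t X Y Z.
Proof. by rewrite -scaleN1r skew3Zl mulN1r. Qed.
Lemma skew3_linear2 a X X' Y Z : t Y (a *: X + X') Z = a * t Y X Z + t Y X' Z.
Proof.
by rewrite (skew3_swap12 st) (skew3_linear st) opprD -mulrN -!(skew3_swap12 st Y).
Qed.
Lemma skew3_linear3 a X X' Y Z : t Y Z (a *: X + X') = a * t Y Z X + t Y Z X'.
Proof.
by rewrite (skew3_swap23 st) skew3_linear2 opprD -mulrN -!(skew3_swap23 st Y).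
Qed.
Lemma skew3N2 X Y Z : t X (- Y) Z = - t X Y Z.
Proof. by rewrite (skew3_swap12 st) skew3Nl (skew3_swap12 st X Y). Qed.
Lemma skew3N3 X Y Z : t X Y (- Z) = - t X Y Z.
Proof. by rewrite (skew3_swap23 st) skew3N2 (skew3_swap23 st X Y). Qed.
Lemma skew3_12 X Z : t X X Z = 0.
Proof. by have := skew3_swap12 st X X Z; lra. Qed.
Lemma skew3_23 X Z : t Z X X = 0.
Proof. by have := skew3_swap23 st Z X X; lra. Qed.
Lemma skew3_13 X Z : t X Z X = 0.
Proof. by rewrite (skew3_swap12 st) skew3_23 oppr0. Qed.

End Skew3Rules.


(** A rewriting table that brings every value of [t] on three of four given vectors to a fixed order
    of arguments, after which identities between four-forms become polynomial. *)
Lemma skew3_order4 (t : V -> V -> V -> R) (st : skew3 t) (A B C E : V) :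
  [/\ (t B A C = - t A B C) * (t A C B = - t A B C) * (t C A B = t A B C)
     * (t B C A = t A B C) * (t C B A = - t A B C),
   (t B A E = - t A B E) * (t A E B = - t A B E) * (t E A B = t A B E)
     * (t B E A = t A B E) * (t E B A = - t A B E),
   (t C A E = - t A C E) * (t A E C = - t A C E) * (t E A C = t A C E)
     * (t C E A = t A C E) * (t E C A = - t A C E) &
   (t C B E = - t B C E) * (t B E C = - t B C E) * (t E B C = t B C E)
     * (t C E B = t B C E) * (t E C B = - t B C E)].
Proof.
have s1 X Y Z : t Y X Z = - t X Y Z by exact: (skew3_swap12 st).
have s2 X Y Z : t X Z Y = - t X Y Z by exact: (skew3_swap23 st).
have s3 X Y Z : t Z X Y = t X Y Z by rewrite s1 s2 opprK.
have s4 X Y Z : t Y Z X = t X Y Z by rewrite s2 s1 opprK.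
have s5 X Y Z : t Z Y X = - t X Y Z by rewrite s1 s4 // s1.
by split; do ?split.
Qed.

Section Skew4Rules.
Variable phi : V -> V -> V -> V -> R.
Hypothesis sp : skew4 phi.

Lemma skew4Dl X X' Y Z W : phi (X + X') Y Z W = phi X Y Z W + phi X' Y Z W.
Proof. by have := skew4_linear sp 1 X X' Y Z W; rewrite scale1r mul1r. Qed.
Lemma skew40l Y Z W : phi 0 Y Z W = 0.
Proof. by have := skew4Dl 0 0 Y Z W; rewrite addr0; lra. Qed.
Lemma skew4Zl a X Y Z W : phi (a *: X) Y Z W = a * phi X Y Z W.
Proof. by rewrite -[a *: X]addr0 (skew4_linear sp) skew40l addr0. Qed.
Lemma skew4Nl X Y Z W : phi (- X) Y Z W = - phi X Y Z W.
Proof. by rewrite -scaleN1r skew4Zl mulN1r. Qed.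
Lemma skew4_12 X Z W : phi X X Z W = 0.
Proof. by have := skew4_swap12 sp X X Z W; lra. Qed.
Lemma skew4_13 X Z W : phi X Z X W = 0.
Proof. by rewrite (skew4_swap23 sp) skew4_12 oppr0. Qed.
Lemma skew4_14 X Z W : phi X Z W X = 0.
Proof. by rewrite (skew4_swap34 sp) skew4_13 oppr0. Qed.

End Skew4Rules.

(* Any four vectors satisfy a nontrivial complex linear relation, i.e. the
   complex dimension is at most three. *)
Definition cdim_le3 : Prop := forall v : 'I_4 -> V, exists a b : 'I_4 -> R,
  (exists i, (a i != 0) || (b i != 0)) /\
  \sum_i (a i *: v i + b i *: J (v i)) = 0.

(** Here [phi] is the real part of a (4,0)-form. In a complex relation between the four vectors some
    coefficient a + i b is nonzero; inserting the relation and its image under J in the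
    corresponding slot leaves (a^2 + b^2) phi(X, Y, Z, W) = 0. *)
Lemma skew4_cdim3 (phi : V -> V -> V -> V -> R) :
  hermitian -> cdim_le3 -> skew4 phi ->
  (forall X Y Z W, phi (J X) Y Z W = phi X (J Y) Z W) ->
  forall X Y Z W, phi X Y Z W = 0.
Proof.
move=> H dep sp pJ.
have pJ3 X Y Z W : phi (J X) Y Z W = phi X Y (J Z) W.
  by rewrite (skew4_swap23 sp) pJ (skew4_swap23 sp) opprK.
have pJ4 X Y Z W : phi (J X) Y Z W = phi X Y Z (J W).
  by rewrite (skew4_swap34 sp) pJ3 (skew4_swap34 sp) opprK.
have p12 X Z W : phi (J X) X Z W = 0.
  by have := pJ X X Z W; rewrite (skew4_swap12 sp X); lra.
have p13 X Z W : phi (J X) Z X W = 0.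
  by rewrite (skew4_swap23 sp) p12 oppr0.
have p14 X Z W : phi (J X) Z W X = 0.
  by rewrite (skew4_swap34 sp) p13 oppr0.
(* The nonzero coefficient is assumed in the first slot; skew-symmetry brings the other three
   positions to this one. *)
have key X Y Z W (a0 b0 a1 b1 a2 b2 a3 b3 : R) : (a0 != 0) || (b0 != 0) ->
    (a0 *: X + b0 *: J X) + ((a1 *: Y + b1 *: J Y) + ((a2 *: Z + b2 *: J Z)
      + (a3 *: W + b3 *: J W))) = 0 -> phi X Y Z W = 0.
  move=> ab rel.
  have E1 : phi ((a0 *: X + b0 *: J X) + ((a1 *: Y + b1 *: J Y)
      + ((a2 *: Z + b2 *: J Z) + (a3 *: W + b3 *: J W)))) Y Z W = 0.
    by rewrite rel (skew40l sp).
  have E2 : phi (J ((a0 *: X + b0 *: J X) + ((a1 *: Y + b1 *: J Y)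
      + ((a2 *: Z + b2 *: J Z) + (a3 *: W + b3 *: J W))))) Y Z W = 0.
    by rewrite rel (acs0 H) (skew40l sp).
  move: E1 E2; rewrite !(acsD H) !(acsZ H) !(herm_acs_sqr H).
  rewrite !(skew4Dl sp) !(skew4Zl sp) !(skew4Nl sp) !(skew4_12 sp) !(skew4_13 sp).
  rewrite !(skew4_14 sp) !p12 !p13 !p14 => E1 E2.
  have E3 : (a0 ^+ 2 + b0 ^+ 2) * phi X Y Z W = 0.
    have := congr1 ( *%R a0) E1; have := congr1 ( *%R b0) E2; rewrite !mulr0; lra.
  move/eqP: E3; rewrite mulf_eq0 => /orP[|/eqP//].
  rewrite paddr_eq0 ?sqr_ge0// !sqrf_eq0 => /andP[/eqP a00 /eqP b00].
  by move: ab; rewrite a00 b00 eqxx.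
move=> X Y Z W.
have [a [b [[i abi]]]] := dep (fun i => nth 0 [:: X; Y; Z; W] i).
rewrite !big_ord_recl big_ord0 /= addr0.
set i1 := lift _ _; set i2 := lift _ _; set i3 := lift _ _ => rel.
have [j0|[j1|[j2|j3]]] : i = ord0 \/ i = i1 \/ i = i2 \/ i = i3.
  case: (i) => -[|[|[|[|//]]]] ltk; [left|right;left|do 2!right;left|do 3!right];
  exact: val_inj.
- rewrite j0 in abi.
  exact: (key X Y Z W (a ord0) (b ord0) (a i1) (b i1) (a i2) (b i2) (a i3) (b i3)).
- rewrite j1 in abi; rewrite (skew4_swap12 sp) (key Y X Z W (a i1) (b i1) (a ord0) (b ord0) (a i2) (b i2)
    (a i3) (b i3)) ?oppr0 // -rel; exact: addrCA.
- rewrite j2 in abi; rewrite (skew4_swap23 sp) (skew4_swap12 sp).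
  rewrite (key Z X Y W (a i2) (b i2) (a ord0) (b ord0) (a i1) (b i1)
    (a i3) (b i3)) ?oppr0 // -rel.
  by rewrite [LHS]addrCA; congr (_ + _); exact: addrCA.
- rewrite j3 in abi; rewrite (skew4_swap34 sp) (skew4_swap23 sp) (skew4_swap12 sp).
  rewrite (key W X Y Z (a i3) (b i3) (a ord0) (b ord0) (a i1) (b i1)
    (a i2) (b i2)) ?oppr0 // -rel.
  by rewrite [LHS]addrCA; congr (_ + _); rewrite [LHS]addrCA; congr (_ + _); exact: addrC.
Qed.

(** Polarizing phi(X, JX, Y, Z) = 0 in X gives exactly the compatibility with J required by
    [skew4_cdim3]. Identities between four-forms in dimension six thus need checking on (X, JX, Y,
    Z) only, where terms of type (4,0) are invisible. *)
Lemma skew4_polarized (phi : V -> V -> V -> V -> R) :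
  hermitian -> cdim_le3 -> skew4 phi ->
  (forall X Y Z, phi X (J X) Y Z = 0) -> forall X Y Z W, phi X Y Z W = 0.
Proof.
move=> H dep sp p0; apply: (skew4_cdim3 H dep sp) => X Y Z W.
have := p0 (X + Y) Z W; rewrite (acsD H) !(skew4Dl sp).
rewrite (skew4_swap12 sp X) (skew4_swap12 sp Y) !(skew4Dl sp).
have := p0 X Z W; have := p0 Y Z W.
rewrite (skew4_swap12 sp X (J X)) (skew4_swap12 sp Y (J Y)) (skew4_swap12 sp X (J Y)).
lra.
Qed.

End HermitianAlgebra.

(** * Pointwise algebra of the torsion for type W_1 + W_4 *)

Section TorsionAlgebra.
Variables (R : realType) (V : lmodType R) (h : V -> V -> R) (J : V -> V).
Hypothesis H : hermitian h J.

Lemma form30_twist (t : V -> V -> V -> R) :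
  form30 J t -> form30 J (fun X Y Z => t (J X) Y Z).
Proof.
move=> Ft; split; first split.
- by move=> a X X' Y Z; rewrite (herm_acs_linear H) (skew3_linear Ft).
- by move=> X Y Z; rewrite (form30_acs Ft) (skew3_swap12 Ft).
- by move=> X Y Z; rewrite (skew3_swap23 Ft).
- by move=> X Y Z; rewrite !(form30_acs Ft).
Qed.

Lemma form30_acs3 (t : V -> V -> V -> R) X Y Z :
  form30 J t -> t X Y (J Z) = t (J X) Y Z.
Proof.
by move=> Ft; rewrite (skew3_swap23 Ft) -(form30_acs Ft) (skew3_swap23 Ft) opprK.
Qed.

Lemma form30_acs_sqr (t : V -> V -> V -> R) X Y Z :
  form30 J t -> t (J (J X)) Y Z = - t X Y Z.
Proof. by move=> Ft; rewrite (herm_acs_sqr H) (skew3Nl Ft). Qed.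

Lemma form30_acs12 (t : V -> V -> V -> R) X Z : form30 J t -> t (J X) X Z = 0.
Proof.
by move=> Ft; have := form30_acs Ft X X Z; rewrite (skew3_swap12 Ft X); lra.
Qed.

Lemma form30_acs13 (t : V -> V -> V -> R) X Z : form30 J t -> t (J X) Z X = 0.
Proof. by move=> Ft; rewrite (skew3_swap23 Ft) form30_acs12 ?oppr0. Qed.

(* The exterior derivative of a three-form psi, where D is the covariant
   derivative of psi for a connection of torsion T. *)
Definition dform3 (D : V -> V -> V -> V -> R) (T : V -> V -> V)
    (psi : V -> V -> V -> R) (X Y Z W : V) : R :=
  D X Y Z W - D Y X Z W + D Z X Y W - D W X Y Z
  + psi (T X Y) Z W - psi (T X Z) Y W + psi (T X W) Y Z
  + psi (T Y Z) X W - psi (T Y W) X Z + psi (T Z W) X Y.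

Variables (tau : V -> V -> V) (v : V).

(* The torsion of nabla + xi when xi is in W_1 + W_4: tau is xi_(1), v is dual
   to the Lee form. *)
Definition torsion14 (X Y : V) : V :=
  2 *: tau X Y + 4^-1 *: (h v X *: Y - h v Y *: X + h v (J X) *: J Y
    - h v (J Y) *: J X + (2 * h X (J Y)) *: J v).

Variable t : V -> V -> V -> R.
Hypotheses (Ft : form30 J t) (tauE : forall X Y Z, h (tau X Y) Z = t X Y Z).

Lemma tau_nondeg X Y : (forall Z, h X Z = h Y Z) -> X = Y.
Proof.
move=> hXY; apply/eqP; rewrite -subr_eq0; apply/negPn/negP => /(herm_pos H).
by rewrite (hermDl H) (hermNl H) hXY subrr ltxx.
Qed.

Lemma tau_acsl X Y : tau (J X) Y = - J (tau X Y).
Proof.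
apply: tau_nondeg => Z; rewrite (hermNl H) (herm_acsl H) !tauE.
by rewrite (form30_acs3 _ _ _ Ft) opprK.
Qed.

Lemma tau_skew X Y : tau X Y = - tau Y X.
Proof. by apply: tau_nondeg => Z; rewrite (hermNl H) !tauE (skew3_swap12 Ft). Qed.

Lemma tau_acsr X Y : tau X (J Y) = - J (tau X Y).
Proof. by rewrite tau_skew tau_acsl [in RHS]tau_skew (acsN H). Qed.

Let u := fun X Y Z => t (J X) Y Z.
Let Fu : form30 J u. Proof. exact: form30_twist. Qed.

Lemma form30_tau X Y Z W : t (J (tau X Y)) Z W = h (J (tau X Y)) (tau Z W).
Proof.
by rewrite (herm_sym H) tauE [LHS](skew3_swap12 Ft) (skew3_swap23 Ft) opprK.
Qed.

Variable D : V -> V -> V -> V -> R.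
Hypothesis FD : forall A, form30 J (D A).

Let uD X X' Y Z : u (X + X') Y Z = u X Y Z + u X' Y Z := skew3Dl Fu X X' Y Z.
Let uZ a X Y Z : u (a *: X) Y Z = a * u X Y Z := skew3Zl Fu a X Y Z.
Let uN X Y Z : u (- X) Y Z = - u X Y Z := skew3Nl Fu X Y Z.

Lemma twist_torsion14 X Y Z W : u (torsion14 X Y) Z W =
  2 * h (J (tau X Y)) (tau Z W) + 4^-1 * (h v X * u Y Z W - h v Y * u X Z W
  + h v (J X) * u (J Y) Z W - h v (J Y) * u (J X) Z W
  + 2 * h X (J Y) * u (J v) Z W).
Proof.
rewrite /torsion14 !(uD, uZ, uN) -[u (tau X Y) Z W]/(t (J (tau X Y)) Z W).
by rewrite form30_tau.
Qed.

Let uJ1 A B C : u (J A) B C = - t A B C. Proof. by rewrite /u form30_acs_sqr. Qed.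
Let uJ2 A B C : u A (J B) C = - t A B C.
Proof. by rewrite -(form30_acs Fu) uJ1. Qed.
Let uJ3 A B C : u A B (J C) = - t A B C.
Proof. by rewrite (form30_acs3 _ _ _ Fu) uJ1. Qed.
Let tJ1 A B C : t (J A) B C = u A B C. Proof. by []. Qed.
Let tJ2 A B C : t A (J B) C = u A B C. Proof. by rewrite -(form30_acs Ft). Qed.
Let tJ3 A B C : t A B (J C) = u A B C.
Proof. by rewrite (form30_acs3 _ _ _ Ft). Qed.
Let tN A B C : t (- A) B C = - t A B C. Proof. exact: skew3Nl Ft _ _ _. Qed.
Let tau0 A : tau A A = 0.
Proof. by apply: tau_nondeg => B; rewrite tauE (skew3_12 Ft) (herm0l H). Qed.
Let DJ2 A B C E : D A B C (J E) = D A (J B) C E.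
Proof. by rewrite (form30_acs3 _ _ _ (FD A)). Qed.
Let DJ1 A B C E : D A B (J C) E = D A (J B) C E.
Proof. by rewrite (form30_acs (FD A)). Qed.
Let DJJ A B C E : D A (J (J B)) C E = - D A B C E.
Proof. by rewrite (form30_acs_sqr _ _ _ (FD A)). Qed.
Let D0 A B C : D A (J B) B C = 0.
Proof. by have := form30_acs (FD A) B B C; rewrite (skew3_swap12 (FD A) B); lra. Qed.

Let D00 A B C : D A B B C = 0. Proof. exact: skew3_12 (FD A) _ _. Qed.

Let JJ := herm_acs_sqr H.
Let hC := herm_sym H.
Let hrules := (tau_acsl, tau_acsr, tau0, JJ, acsN H, acs0 H, hermNl H, hermNr H,
  herm0l H, herm0r H, herm_acs_isom H, herm_acsl H).
Let trules := (uJ1, uJ2, uJ3, tJ1, tJ2, tJ3, DJ2, DJ1, DJJ, D0, D00, tN, uN, skew3N3 Ft, skew3N3 Fu, skew3N2 Ft,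
  skew3N2 Fu).
Let zrules := (skew3_12 Ft, skew3_13 Ft, skew3_23 Ft,
  skew3_12 Fu, skew3_13 Fu, skew3_23 Fu).
Let order X Y Z := (skew3_swap12 Ft Y X, skew3_swap12 Ft Z X, skew3_swap12 Ft Z Y,
  (fun A => skew3_swap23 Ft A Y X), (fun A => skew3_swap23 Ft A Z X), (fun A => skew3_swap23 Ft A Z Y),
  (skew3_swap12 Fu Y X, skew3_swap12 Fu Z X, skew3_swap12 Fu Z Y,
   (fun A => skew3_swap23 Fu A Y X), (fun A => skew3_swap23 Fu A Z X), (fun A => skew3_swap23 Fu A Z Y)),
  (hC Y X, hC Z X, hC Z Y, herm_acsC H Y X, herm_acsC H Z X, herm_acsC H Z Y)).

(** On (X, JX, ., .) the part of type (4,0) vanishes, the part of type (3,1) leaves a form of type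
    (2,0), which changes sign under (Y, Z) -> (JY, JZ), and the part of type (2,2) leaves an
    invariant one; so the sum detects exactly type (2,2). The terms quadratic in [tau] cancel in
    pairs because <J., .> is skew, and the terms in [D] and in [v] are of types (4,0) and (3,1), up
    to conjugation. *)
Lemma dform3_type22 (X Y Z : V) :
  dform3 D torsion14 u X (J X) Y Z + dform3 D torsion14 u X (J X) (J Y) (J Z) = 0.
Proof.
rewrite /dform3 !twist_torsion14 !hrules !trules !zrules !(order X Y Z).
by rewrite (hC (tau X Z)); field.
Qed.

(** The terms quadratic in [tau] cancel as in [dform3_type22], which leaves an expression linear in
    [D] and in [v]. *)
Lemma dform3_type31 (X Y Z : V) :
  dform3 D torsion14 u X (J X) Y Z = D X (J X) Y Z - D (J X) X Y Z
  + 3 / 2 * (- h v X * t X Y Z - h v (J X) * u X Y Z)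
  - 2^-1 * (- h X X * t v Y Z + h X Y * t v X Z - h X (J Y) * u v X Z
     - h X Z * t v X Y + h X (J Z) * u v X Y).
Proof.
rewrite /dform3 !twist_torsion14 !hrules !trules !zrules !(order X Y Z).
by rewrite (hC (tau X Z)); field.
Qed.

Variables (P : V -> V -> R) (Rm : V -> V -> V -> V).
Hypothesis PN : forall A B, P A (- B) = - P A B.
Hypothesis RmJ : forall A B C, Rm A B (J C) = J (Rm A B C).

(* The covariant derivative of the lowered torsion14, where D and P stand for
   the derivatives of t and of the Lee form. *)
Definition Dtorsion14 (A B C W : V) : R := 2 * D A B C W
  + 4^-1 * (P A B * h C W - P A C * h B W + P A (J B) * h (J C) W
    - P A (J C) * h (J B) W - 2 * h B (J C) * P A (J W)).

(** Cyclic sum of (D_X T)(Y, Z) + T(T(X, Y), Z), lowered: the torsion side of the first Bianchi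
    identity of a connection with torsion T. *)
Definition bianchi_rhs (X Y Z W : V) : R :=
  Dtorsion14 X Y Z W + h (torsion14 (torsion14 X Y) Z) W
  + (Dtorsion14 Y Z X W + h (torsion14 (torsion14 Y Z) X) W)
  + (Dtorsion14 Z X Y W + h (torsion14 (torsion14 Z X) Y) W).

Lemma herm_torsion14 X Y Z : h (torsion14 X Y) Z = 2 * t X Y Z
  + 4^-1 * (h v X * h Y Z - h v Y * h X Z + h v (J X) * h (J Y) Z
    - h v (J Y) * h (J X) Z + 2 * h X (J Y) * h (J v) Z).
Proof.
by rewrite /torsion14 !(hermDl H, hermZl H, hermNl H) tauE.
Qed.

Lemma torsion14_linear_l a X X' Y :
  torsion14 (a *: X + X') Y = a *: torsion14 X Y + torsion14 X' Y.
Proof.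
apply: tau_nondeg => Z; rewrite (herm_linear H) !herm_torsion14.
rewrite !(acsD H, acsZ H, hermDl H, hermZl H, hermDr H, hermZr H).
by rewrite (skew3_linear Ft); field.
Qed.

(* Up to a factor, the part of f of type (4,0) + (0,4), when its arguments are
   viewed as complex linear or antilinear slots. *)
Definition type40 (f : V -> V -> V -> V -> R) X Y Z W : R :=
  f X Y Z W - f (J X) (J Y) Z W - f (J X) Y (J Z) W - f X (J Y) (J Z) W
  - f (J X) Y Z (J W) - f X (J Y) Z (J W) - f X Y (J Z) (J W)
  + f (J X) (J Y) (J Z) (J W).

(** Every term in [P] carries a factor <., .> or <., J.> of two slots, which has type (1,1) in them,
    so it drops out. [D] already has pure type in its last three slots, and only the comparison with
    the direction of derivation remains. *)
Lemma type40_Dtorsion14 X Y Z W :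
  type40 Dtorsion14 X Y Z W = 8 * (D X Y Z W - D (J X) (J Y) Z W).
Proof.
rewrite /type40 /Dtorsion14 !(hrules, trules, PN).
by rewrite ?(hC W) ?(hC Z) ?(hC Y X); field.
Qed.

Lemma torsion14_tau X Y Z W : t (torsion14 X Y) Z W =
  2 * h (tau X Y) (tau Z W) + 4^-1 * (h v X * t Y Z W - h v Y * t X Z W
  + h v (J X) * u Y Z W - h v (J Y) * u X Z W + 2 * h X (J Y) * u v Z W).
Proof.
rewrite /torsion14 !(skew3Dl Ft, skew3Zl Ft, skew3Nl Ft) -!/(u _ _ _).
have -> : t (tau X Y) Z W = h (tau X Y) (tau Z W).
  by rewrite hC tauE [LHS](skew3_swap12 Ft) (skew3_swap23 Ft) opprK.
by rewrite ?trules.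
Qed.

(** The map [tau] is conjugate linear in each slot, so <tau(X, Y), tau(Z, W)> has type (2,2); the
    terms quadratic in [v] contain a metric factor of type (1,1). Only products of [v] and [t] of
    pure type survive. *)
Lemma type40_torsion14 X Y Z W :
  type40 (fun X Y Z W => h (torsion14 (torsion14 X Y) Z) W) X Y Z W =
  4 * (h v W * t X Y Z - h v (J W) * u X Y Z)
  - 4 * (h v Z * t X Y W - h v (J Z) * u X Y W).
Proof.
pose f X Y Z W := h (torsion14 (torsion14 X Y) Z) W.
have fE A B C E : f A B C E = 2 * t (torsion14 A B) C E
    + 4^-1 * (h (torsion14 A B) v * h C E - h v C * h (torsion14 A B) E
    - h (torsion14 A B) (J v) * h (J C) E + h v (J C) * h (torsion14 A B) (J E)
    + 2 * h (torsion14 A B) (J C) * h (J v) E).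
  rewrite /f herm_torsion14 (hC v (torsion14 A B)) (hC v (J _)) !(herm_acsl H _ v).
  by rewrite !(herm_acsl H (torsion14 A B)); field.
rewrite /type40 -!/(f _ _ _ _) !fE !torsion14_tau !herm_torsion14.
rewrite !(hrules, trules, herm_acs0 H).
rewrite !(hC _ v) !(herm_acsC H X v, herm_acsC H Y v, herm_acsC H Z v, herm_acsC H W v).
by field.
Qed.

Hypothesis bianchi : forall X Y Z W,
  bianchi_rhs X Y Z W = h (Rm X Y Z + Rm Y Z X + Rm Z X Y) W.

(** Because [Rm] commutes with J and J is an isometry, <Rm(X, Y) Z, W> is unchanged under (Z, W) ->
    (JZ, JW), whereas a form of type (4,0) + (0,4) changes sign. The curvature side of the Bianchi
    identity therefore has no such part. *)
Lemma bianchi_type40 X Y Z W :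
  2 * (D X Y Z W - D (J X) (J Y) Z W + D Y Z X W - D (J Y) (J Z) X W
       + D Z X Y W - D (J Z) (J X) Y W)
  - (h v X * t Y Z W - h v (J X) * u Y Z W + h v Y * t Z X W - h v (J Y) * u Z X W
     + h v Z * t X Y W - h v (J Z) * u X Y W)
  + (h v W * t X Y Z - h v (J W) * u X Y Z + h v W * t Y Z X - h v (J W) * u Y Z X
     + h v W * t Z X Y - h v (J W) * u Z X Y) = 0.
Proof.
pose f X Y Z W := Dtorsion14 X Y Z W + h (torsion14 (torsion14 X Y) Z) W.
have fE A B C E : type40 f A B C E = 8 * (D A B C E - D (J A) (J B) C E)
    + (4 * (h v E * t A B C - h v (J E) * u A B C)
       - 4 * (h v C * t A B E - h v (J C) * u A B E)).
  by rewrite -type40_Dtorsion14 -type40_torsion14 /type40 /f; ring.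
have : type40 f X Y Z W + type40 f Y Z X W + type40 f Z X Y W = 0.
  transitivity (type40 bianchi_rhs X Y Z W).
    by rewrite /type40 /bianchi_rhs -!/(f _ _ _ _); ring.
  rewrite /type40 !bianchi !RmJ !(hermDl H) !(herm_acs_isom H) !(herm_acsl H).
  by move: (fun A B C E => h (Rm A B C) E) => r; ring.
rewrite !fE => E.
apply: (@mulfI _ 4); first by rewrite pnatr_eq0.
by rewrite mulr0 -[RHS]E; ring.
Qed.

End TorsionAlgebra.

(** * Forms of type (3,0) in complex dimension three *)

Section ComplexDimensionThree.
Variables (R : realType) (V : lmodType R) (h : V -> V -> R) (J : V -> V).
Hypotheses (H : hermitian h J) (dim3 : cdim_le3 J).

(** The two equations are the real and imaginary parts of (l + i m)(x + i y) = 0. *)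
Lemma complex_solve (l m x y : R) :
  l * x - m * y = 0 -> l * y + m * x = 0 -> (l != 0) || (m != 0) -> x = 0 /\ y = 0.
Proof.
move=> E1 E2 lm.
have N0 : l ^+ 2 + m ^+ 2 != 0.
  by rewrite paddr_eq0 ?sqr_ge0// !sqrf_eq0 negb_and.
have Ex : (l ^+ 2 + m ^+ 2) * x = l * (l * x - m * y) + m * (l * y + m * x) by ring.
have Ey : (l ^+ 2 + m ^+ 2) * y = l * (l * y + m * x) - m * (l * x - m * y) by ring.
by split; apply: (mulfI N0); rewrite mulr0 ?Ex ?Ey E1 E2; ring.
Qed.

(* The wedge product of a (1,0)-form and a (3,0)-form vanishes. *)
Lemma wedge_form10_form30 (f : V -> R) (t : V -> V -> V -> R) X Y Z W :
  (forall a X X', f (a *: X + X') = a * f X + f X') -> form30 J t ->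
  f W * t X Y Z - f (J W) * t (J X) Y Z =
    f X * t Y Z W - f (J X) * t (J Y) Z W + (f Y * t Z X W - f (J Y) * t (J Z) X W)
    + (f Z * t X Y W - f (J Z) * t (J X) Y W).
Proof.
move=> fl Ft; pose u X Y Z := t (J X) Y Z; have Fu : form30 J u := form30_twist H Ft.
have f0 : f 0 = 0 by have := fl 1 0 0; rewrite scale1r addr0; lra.
have fN A : f (- A) = - f A by rewrite -[- A]addr0 -scaleN1r fl f0; ring.
(* Up to sign, the real part of the wedge product of the complex linear forms f - i f(J.) and t - i
   u. *)
pose phi X Y Z W := (f W * t X Y Z - f (J W) * u X Y Z)
  - (f X * t Y Z W - f (J X) * u Y Z W) - (f Y * t Z X W - f (J Y) * u Z X W)
  - (f Z * t X Y W - f (J Z) * u X Y W).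
suff : phi X Y Z W = 0 by rewrite /phi /u; lra.
have ot := skew3_order4 Ft; have ou := skew3_order4 Fu.
apply: (skew4_cdim3 H dim3); first split.
- move=> a A A' B C E; rewrite /phi (herm_acs_linear H) !fl.
  rewrite !(skew3_linear Ft, skew3_linear2 Ft, skew3_linear3 Ft).
  by rewrite !(skew3_linear Fu, skew3_linear2 Fu, skew3_linear3 Fu); ring.
- move=> A B C E; rewrite /phi.
  have [a1 a2 a3 a4] := ot A B C E; have [b1 b2 b3 b4] := ou A B C E.
  by rewrite !(a1, a2, a3, a4) !(b1, b2, b3, b4); ring.
- move=> A B C E; rewrite /phi.
  have [a1 a2 a3 a4] := ot A B C E; have [b1 b2 b3 b4] := ou A B C E.
  by rewrite !(a1, a2, a3, a4) !(b1, b2, b3, b4); ring.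
- move=> A B C E; rewrite /phi.
  have [a1 a2 a3 a4] := ot A B C E; have [b1 b2 b3 b4] := ou A B C E.
  by rewrite !(a1, a2, a3, a4) !(b1, b2, b3, b4); ring.
move=> A B C E; rewrite /phi !(herm_acs_sqr H) !fN.
have tJ2 X' Y' Z' : t X' (J Y') Z' = u X' Y' Z' by rewrite -(form30_acs Ft).
have tJ3 X' Y' Z' : t X' Y' (J Z') = u X' Y' Z' by rewrite (form30_acs3 _ _ _ Ft).
have uJ1 X' Y' Z' : u (J X') Y' Z' = - t X' Y' Z' by rewrite /u (form30_acs_sqr H _ _ _ Ft).
have uJ2 X' Y' Z' : u X' (J Y') Z' = - t X' Y' Z' by rewrite -(form30_acs Fu) uJ1.
have uJ3 X' Y' Z' : u X' Y' (J Z') = - t X' Y' Z'.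
  by rewrite (form30_acs3 _ _ _ Fu) uJ1.
by rewrite !(uJ1, uJ2, uJ3, tJ2, tJ3) -!/(u _ _ _); ring.
Qed.

(** P, Q, S play the role of a complex basis. Instead of expanding in it, the wedge identity is
    applied to [r] and the one-form t(., B, C), which is nonzero at A and vanishes at B and C; each
    of the three steps frees one more argument of [r]. *)
Lemma form30_eq0 (r t : V -> V -> V -> R) P Q S : form30 J r -> form30 J t ->
  (t P Q S != 0) || (t (J P) Q S != 0) -> r P Q S = 0 -> r (J P) Q S = 0 ->
  forall X Y Z, r X Y Z = 0.
Proof.
move=> Fr Ft t0 r1 r2; pose q X Y Z := r (J X) Y Z.
have Fq : form30 J q := form30_twist H Fr.
have lin A B a X X' : t (a *: X + X') A B = a * t X A B + t X' A B.
  exact: skew3_linear Ft _ _ _ _ _.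
have Jr X Y Z : r X Y (J Z) = q X Y Z by rewrite (form30_acs3 _ _ _ Fr).
have Jq X Y Z : q X Y (J Z) = - r X Y Z.
  by rewrite (form30_acs3 _ _ _ Fq) /q (form30_acs_sqr H _ _ _ Fr).
have rq X Y : (forall Z, r X Y Z = 0) -> forall Z, q X Y Z = 0.
  by move=> r0 Z; rewrite -Jr r0.
have fin A B C X Y : (t A B C != 0) || (t (J A) B C != 0) ->
    (forall W, t A B C * r X Y W - t (J A) B C * q X Y W = 0) ->
    forall W, r X Y W = 0.
  move=> tABC E W; have E1 := E W; have := E (J W); rewrite Jr Jq mulrN opprK => E2.
  by have [] := complex_solve E1 E2 tABC.
have wedge X Y Z W B C := wedge_form10_form30 X Y Z W (lin B C) Fr.
have step1 A B C : (t A B C != 0) || (t (J A) B C != 0) ->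
    r A B C = 0 -> r (J A) B C = 0 -> forall W, r B C W = 0.
  move=> tABC r0 q0; apply: (fin A B C) => // W; have := wedge A B C W B C.
  rewrite r0 q0 (skew3_12 Ft) (skew3_13 Ft).
  by rewrite (form30_acs12 _ _ Ft) (form30_acs13 _ _ Ft) /q; lra.
have step2 A B C : (t A B C != 0) || (t (J A) B C != 0) ->
    (forall W, r A B W = 0) -> forall Y W, r B Y W = 0.
  move=> tABC r0 Y; apply: (fin A B C) => // W; have := wedge A B Y W B C.
  have q0 Z : r (J A) B Z = 0 := rq _ _ r0 Z.
  by rewrite !r0 !q0 (skew3_12 Ft) (form30_acs12 _ _ Ft) /q; lra.
have step3 A B C : (t A B C != 0) || (t (J A) B C != 0) ->
    (forall Y W, r A Y W = 0) -> forall X Y W, r X Y W = 0.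
  move=> tABC r0 X Y; apply: (fin A B C) => // W; have := wedge A X Y W B C.
  have s1 Z Z' : r Z A Z' = 0 by rewrite (skew3_swap12 Fr) r0 oppr0.
  have s2 Z Z' : r (J A) Z Z' = 0 by rewrite (form30_acs Fr) r0.
  by rewrite !s1 !s2 !r0 /q; lra.
have tQ : (t Q S P != 0) || (t (J Q) S P != 0).
  rewrite (_ : t Q S P = t P Q S); last first.
    by rewrite (skew3_swap23 Ft) (skew3_swap12 Ft) opprK.
  rewrite (_ : t (J Q) S P = t (J P) Q S)//.
  by rewrite (form30_acs Ft P) (skew3_swap12 Ft P) (skew3_swap23 Ft _ P) opprK.
have tP : (t S P Q != 0) || (t (J S) P Q != 0).
  rewrite (_ : t S P Q = t P Q S); last first.
    by rewrite (skew3_swap12 Ft) (skew3_swap23 Ft) opprK.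
  rewrite (_ : t (J S) P Q = t (J P) Q S)//.
  by rewrite -(form30_acs3 P Q S Ft) (skew3_swap23 Ft P) (skew3_swap12 Ft P) opprK.
have r3 : forall W, r Q S W = 0 by exact: (step1 P).
have r4 : forall Y W, r S Y W = 0 by exact: (step2 Q S P).
exact: (step3 S P Q).
Qed.

Lemma form30_colinear (s t : V -> V -> V -> R) P Q S : form30 J s -> form30 J t ->
  (t P Q S != 0) || (t (J P) Q S != 0) ->
  exists a b, forall X Y Z, s X Y Z = a * t X Y Z + b * t (J X) Y Z.
Proof.
move=> Fs Ft t0; set l := t P Q S; set m := t (J P) Q S.
have N0 : l ^+ 2 + m ^+ 2 != 0.
  by rewrite paddr_eq0 ?sqr_ge0// !sqrf_eq0 negb_and.
(* The solution of s(P, Q, S) = a l + b m and s(JP, Q, S) = a m - b l, a quotient of complex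
   numbers; the minus sign comes from J^2 = -1. *)
pose a := (l * s P Q S + m * s (J P) Q S) / (l ^+ 2 + m ^+ 2).
pose b := (m * s P Q S - l * s (J P) Q S) / (l ^+ 2 + m ^+ 2).
exists a, b; pose r X Y Z := s X Y Z - a * t X Y Z - b * t (J X) Y Z.
have Fu := form30_twist H Ft.
have Fr : form30 J r.
  split; first split.
  - move=> c X X' Y Z; rewrite /r (skew3_linear Fs) (skew3_linear Ft).
    by rewrite (skew3_linear Fu c); ring.
  - move=> X Y Z; rewrite /r (skew3_swap12 Fs) (skew3_swap12 Ft).
    by rewrite (skew3_swap12 Fu X); ring.
  - move=> X Y Z; rewrite /r (skew3_swap23 Fs) (skew3_swap23 Ft X).
    by rewrite (skew3_swap23 Fu X); ring.
  - by move=> X Y Z; rewrite /r (form30_acs Fs) (form30_acs Ft) (form30_acs Fu).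
move=> X Y Z; suff : r X Y Z = 0 by rewrite /r; lra.
apply: (form30_eq0 Fr Ft t0).
- by rewrite /r -/l -/m /a /b; field.
- by rewrite /r (form30_acs_sqr H _ _ _ Ft) -/l -/m /a /b; field.
Qed.

End ComplexDimensionThree.

Section Wedge.
Variables (R : realType) (V : Type).

(** In this and the next definitions wedge products are signed sums over shuffles, without
    normalizing factor; the digits are the degrees of the factors. *)
Definition wedge12 (be : V -> R) (om : V -> V -> R) X Y Z :=
  be X * om Y Z - be Y * om X Z + be Z * om X Y.

Definition wedge13 (be : V -> R) (psi : V -> V -> V -> R) X Y Z W :=
  be X * psi Y Z W - be Y * psi X Z W + be Z * psi X Y W - be W * psi X Y Z.

Definition wedge22 (al om : V -> V -> R) X Y Z W :=
  al X Y * om Z W - al X Z * om Y W + al X W * om Y Z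
  + al Y Z * om X W - al Y W * om X Z + al Z W * om X Y.

Definition wedge23 (al : V -> V -> R) (psi : V -> V -> V -> R) X Y Z W U :=
  al X Y * psi Z W U - al X Z * psi Y W U + al X W * psi Y Z U - al X U * psi Y Z W
  + al Y Z * psi X W U - al Y W * psi X Z U + al Y U * psi X Z W
  + al Z W * psi X Y U - al Z U * psi X Y W + al W U * psi X Y Z.

End Wedge.

(** * The multiplier of the parallel derivative in complex dimension three *)

Section TorsionDimensionThree.
Variables (R : realType) (V : lmodType R) (h : V -> V -> R) (J : V -> V).
Hypotheses (H : hermitian h J) (dim3 : cdim_le3 J).
Variables (tau : V -> V -> V) (v : V) (t : V -> V -> V -> R).
Hypotheses (Ft : form30 J t) (tauE : forall X Y Z, h (tau X Y) Z = t X Y Z).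
Variables (D : V -> V -> V -> V -> R) (P : V -> V -> R) (Rm : V -> V -> V -> V).
Hypotheses (FD : forall A, form30 J (D A))
  (Dlin : forall k A A' X Y Z, D (k *: A + A') X Y Z = k * D A X Y Z + D A' X Y Z)
  (PN : forall A B, P A (- B) = - P A B)
  (RmJ : forall A B C, Rm A B (J C) = J (Rm A B C))
  (bianchi : forall X Y Z W, bianchi_rhs h J tau v D P X Y Z W =
     h (Rm X Y Z + Rm Y Z X + Rm Z X Y) W).
Variables (a b : V -> R) (E1 E2 E3 : V).
Hypotheses (t0 : (t E1 E2 E3 != 0) || (t (J E1) E2 E3 != 0))
  (DE : forall A X Y Z, D A X Y Z = a A * t X Y Z + b A * t (J X) Y Z).

Let u X Y Z := t (J X) Y Z.
Let Fu : form30 J u. Proof. exact: (form30_twist H Ft). Qed.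

Let coef0 x y : (forall X Y Z, x * t X Y Z + y * u X Y Z = 0) -> x = 0 /\ y = 0.
Proof.
move=> xy; have := xy E1 E2 E3; have := xy (J E1) E2 E3.
rewrite /u (form30_acs_sqr H _ _ _ Ft) => e2 e1.
have [|||x0 y0] := @complex_solve _ (t E1 E2 E3) (t (J E1) E2 E3) x (- y).
- by rewrite -e1; ring.
- by rewrite -e2; ring.
- by [].
by split=> //; lra.
Qed.

Lemma coef_linear k A A' : a (k *: A + A') = k * a A + a A' /\
  b (k *: A + A') = k * b A + b A'.
Proof.
have [|xa xb] := @coef0 (a (k *: A + A') - k * a A - a A')
  (b (k *: A + A') - k * b A - b A').
  move=> X Y Z; have := Dlin k A A' X Y Z; rewrite !DE /u; lra.
by split; lra.
Qed.

(** The wedge identities for the one-forms a + b(J.) and <v, .> collapse both cyclic sums of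
    [bianchi_type40] to multiples of t(X, Y, Z) and t(JX, Y, Z), and these two are independent
    because t is nonzero. *)
Lemma coef_bianchi W : a W + b (J W) = - h v W.
Proof.
have al k A A' := (coef_linear k A A').1; have bl k A A' := (coef_linear k A A').2.
(* D_X t(Y, Z, W) - D_JX t(JY, Z, W) = f(X) t(Y, Z, W) - f(JX) t(JY, Z, W), so the multipliers enter
   only through this combination. *)
pose f X := a X + b (J X).
have fl k A A' : f (k *: A + A') = k * f A + f A'.
  by rewrite /f (herm_acs_linear H) al bl; ring.
have b0 : b 0 = 0 by have := bl 1 0 0; rewrite scale1r addr0; lra.
have fJ X : f (J X) = a (J X) - b X.
  by rewrite /f (herm_acs_sqr H) -[- X]addr0 -scaleN1r bl b0; ring.
have hl k A A' : h v (k *: A + A') = k * h v A + h v A'.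
  by rewrite (hermDr H) (hermZr H).
have key X Y Z : (f W + h v W) * t X Y Z - (f (J W) + h v (J W)) * u X Y Z = 0.
  have := bianchi_type40 H Ft tauE FD PN RmJ bianchi X Y Z W.
  have w1 := wedge_form10_form30 H dim3 X Y Z W fl Ft.
  have w2 := wedge_form10_form30 H dim3 X Y Z W hl Ft.
  rewrite !DE; move: w1 w2; rewrite !fJ !(form30_acs_sqr H _ _ _ Ft) /f /u.
  rewrite (skew3_swap23 Ft Y Z X) (skew3_swap12 Ft Y X Z).
  rewrite (skew3_swap12 Ft Z X Y) (skew3_swap23 Ft X Z Y).
  rewrite -(form30_acs3 Y Z X Ft) (skew3_swap23 Ft Y Z (J X)) (skew3_swap12 Ft Y (J X) Z).
  rewrite (form30_acs Ft Z X Y) (skew3_swap12 Ft Z (J X) Y) (skew3_swap23 Ft (J X) Z Y).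
  lra.
have [|x0 _] := @coef0 (f W + h v W) (- (f (J W) + h v (J W))).
  by move=> X Y Z; rewrite -(key X Y Z); ring.
by move: x0; rewrite /f; lra.
Qed.

(** The relation of [coef_bianchi] removes b, and the wedge identity for <X, .> and t at (v, Y, Z,
    X) turns the terms with v inside t into multiples of t(X, Y, Z) and t(JX, Y, Z). *)
Lemma dform3_coef X Y Z :
  dform3 (fun A X Y Z => D A (J X) Y Z) (torsion14 h J tau v) u X (J X) Y Z =
  - (2 * a X + 2 * h v X) * t X Y Z - (2 * a (J X) + 2 * h v (J X)) * u X Y Z.
Proof.
have bl k A A' := (coef_linear k A A').2.
have b0 : b 0 = 0 by have := bl 1 0 0; rewrite scale1r addr0; lra.
have bX : b X = a (J X) + h v (J X).
  have := coef_bianchi (J X); rewrite (herm_acs_sqr H) -[- X]addr0 -scaleN1r bl b0.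
  lra.
have bJ := coef_bianchi X.
have FuD A : form30 J (fun X Y Z => D A (J X) Y Z) by exact: (form30_twist H (FD A)).
rewrite (dform3_type31 H v Ft tauE FuD) !DE.
have hl k A A' : h X (k *: A + A') = k * h X A + h X A'.
  by rewrite (hermDr H) (hermZr H).
have w := wedge_form10_form30 H dim3 v Y Z X hl Ft.
move: w; rewrite (herm_acs0 H) (herm_sym H X v) (herm_acsC H X v).
rewrite !(form30_acs_sqr H _ _ _ Ft) /u.
rewrite (skew3_swap23 Ft Y Z X) (skew3_swap12 Ft Y X Z).
rewrite (skew3_swap12 Ft Z v X) (skew3_swap23 Ft v Z X).
rewrite (skew3_swap23 Ft v Y X) (skew3_swap23 Ft (J v) Y X).
rewrite -(form30_acs3 Y Z X Ft) (skew3_swap23 Ft Y Z (J X)) (skew3_swap12 Ft Y (J X) Z).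
rewrite (form30_acs Ft Z v X) (skew3_swap12 Ft Z (J v) X) (skew3_swap23 Ft (J v) Z X).
rewrite bX.
have -> : b (J X) = - h v X - a X by lra.
lra.
Qed.

End TorsionDimensionThree.

(** * Contractions with the Kahler form *)

Section OrthonormalContraction.
Variables (R : realType) (V : lmodType R) (h : V -> V -> R) (J : V -> V).
Hypothesis H : hermitian h J.
Variables (m : nat) (e : 'I_m -> V).
Hypotheses (eE : forall X, X = \sum_i h X (e i) *: e i)
  (e1 : forall i, h (e i) (e i) = 1).
Let om X Y := h X (J Y).

Lemma frame_expand (f : V -> R) X :
  (forall k A A', f (k *: A + A') = k * f A + f A') ->
  \sum_i h X (e i) * f (e i) = f X.
Proof.
move=> fl; have f0 : f 0 = 0 by have := fl 1 0 0; rewrite scale1r addr0; lra.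
rewrite {2}[X]eE; elim/big_rec2: _ => [|i x y _ ->]; first by rewrite f0.
by rewrite fl.
Qed.

Lemma kahler_trace : \sum_i om (e i) (J (e i)) = - m%:R.
Proof.
under eq_bigr do rewrite /om (herm_acs_sqr H) (hermNr H) e1.
by rewrite sumr_const card_ord mulNrn.
Qed.

Variable al : V -> V -> R.
Hypotheses (al_linear : forall k A A' B, al (k *: A + A') B = k * al A B + al A' B)
  (al_skew : forall A B, al A B = - al B A).

Let kappa := \sum_i al (e i) (J (e i)).

(** Contraction of alpha /\ omega: alpha on the pair gives [kappa], omega on the pair gives -1 for
    each of the m frame vectors, and each of the four mixed terms reproduces alpha. *)
Lemma wedge22_kahler_trace Y Z :
  \sum_i wedge22 al om (e i) (J (e i)) Y Z = kappa * om Y Z + (4 - m%:R) * al Y Z.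
Proof.
have fr A B : \sum_i h A (e i) * al (e i) B = al A B.
  by apply: (@frame_expand (al^~ B)) => k C C'; rewrite al_linear.
have alJ A B : \sum_i h A (J (e i)) * al (J (e i)) B = al A B.
  rewrite -[in RHS](opprK A) -(herm_acs_sqr H A) -(acsN H).
  rewrite -(@frame_expand (fun X => al (J X) B)); last first.
    by move=> k C C'; rewrite (herm_acs_linear H) al_linear.
  by apply: eq_bigr => i _; rewrite (hermNl H) (herm_acsl H) opprK.
have E i : wedge22 al om (e i) (J (e i)) Y Z = al (e i) (J (e i)) * om Y Z
    - h Z (e i) * al (e i) Y + h Y (e i) * al (e i) Z
    - h Z (J (e i)) * al (J (e i)) Y + h Y (J (e i)) * al (J (e i)) Z - al Y Z.
  rewrite /wedge22 /om !(herm_acs_isom H) (herm_acs_sqr H) (hermNr H) e1.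
  rewrite !(herm_sym H (e i) Y) !(herm_sym H (e i) Z).
  by rewrite (herm_acsC H (e i) Z) (herm_acsC H (e i) Y); ring.
under eq_bigr do rewrite E.
rewrite !big_split /= !sumrN !fr !alJ -mulr_suml -/kappa sumr_const card_ord.
by rewrite (al_skew Z) -mulr_natl; ring.
Qed.

(** One contraction gives kappa omega + (4 - 2n) alpha = 0, a second one (4 - 4n) kappa = 0, and
    neither constant vanishes for n > 2. *)
Lemma wedge22_kahler_inj (n : nat) : m = (2 * n)%N -> (2 < n)%N ->
  (forall X Y Z, wedge22 al om X (J X) Y Z = 0) -> forall Y Z, al Y Z = 0.
Proof.
move=> mn n2 w0.
have n3 : (3 : R) <= n%:R by rewrite ler_nat.
have E Y Z : kappa * om Y Z + (4 - 2 * n%:R) * al Y Z = 0.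
  rewrite -natrM -mn -wedge22_kahler_trace big1// => i _; exact: w0.
have k0 : kappa = 0.
  have : \sum_i (kappa * om (e i) (J (e i)) + (4 - 2 * n%:R) * al (e i) (J (e i))) = 0.
    by rewrite big1.
  rewrite big_split /= -!mulr_sumr -/kappa kahler_trace mn natrM => K.
  have : (4 - 4 * n%:R) * kappa = 0 by rewrite -K; ring.
  by move/eqP; rewrite mulf_eq0 => /orP[/eqP|/eqP //]; lra.
move=> Y Z; have := E Y Z; rewrite k0 mul0r add0r => /eqP.
by rewrite mulf_eq0 => /orP[/eqP|/eqP //]; lra.
Qed.

Variables (t : V -> V -> V -> R) (w : V).
Hypotheses (Ft : form30 J t) (dim3 : cdim_le3 J) (m6 : m = 6%N).
Variables (E1 E2 E3 : V).
Hypothesis t0 : (t E1 E2 E3 != 0) || (t (J E1) E2 E3 != 0).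

(** Contracting the first relation yields al = t(Jw, ., .). Then al /\ t = 0, evaluated at suitable
    vectors, is a sum of two squares and gives t(w, ., .) = 0. If w were nonzero, the wedge identity
    for <w, .> and t would reduce to <w, w> t = 0. *)
Lemma lee_rigidity :
  (forall X Y Z W, wedge13 (h w) t X Y Z W + wedge22 al om X Y Z W = 0) ->
  (forall X Y Z W U, wedge23 al t X Y Z W U = 0) ->
  w = 0 /\ forall X Y, al X Y = 0.
Proof.
move=> H0 W0; have m6R : m%:R = 6 :> R by rewrite m6.
have fr A B C : \sum_i h A (e i) * t (e i) B C = t A B C.
  by apply: (@frame_expand (fun X => t X B C)) => k D D'; rewrite (skew3_linear Ft).
have tr Y Z : \sum_i wedge13 (h w) t (e i) (J (e i)) Y Z = 2 * t (J w) Y Z.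
  have E i : wedge13 (h w) t (e i) (J (e i)) Y Z =
      h w (e i) * t (e i) (J Y) Z + h (J w) (e i) * t (e i) Y Z.
    rewrite /wedge13 -(form30_acs Ft (e i) (e i) Z) -(form30_acs Ft (e i) (e i) Y).
    rewrite !(form30_acs12 _ _ Ft) (form30_acs Ft (e i) Y Z) (herm_acsl H w); ring.
  under eq_bigr do rewrite E.
  by rewrite big_split /= !fr -(form30_acs Ft); ring.
have E Y Z : kappa * om Y Z - 2 * al Y Z + 2 * t (J w) Y Z = 0.
  have := wedge22_kahler_trace Y Z; rewrite m6R => wt.
  have : \sum_i (wedge13 (h w) t (e i) (J (e i)) Y Z
    + wedge22 al om (e i) (J (e i)) Y Z) = 0 by rewrite big1.
  by rewrite big_split /= tr wt; lra.
have k0 : kappa = 0.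
  have : \sum_i (kappa * om (e i) (J (e i)) + (- 2 * al (e i) (J (e i)))) = 0.
    rewrite big1// => i _; have := E (e i) (J (e i)).
    by rewrite (form30_acs3 _ _ _ Ft) (skew3_23 Ft); lra.
  rewrite big_split /= -!mulr_sumr -/kappa kahler_trace m6R; lra.
have alE Y Z : al Y Z = t (J w) Y Z by have := E Y Z; rewrite k0; lra.
have t1 X Y : t w X Y = 0.
  (* All terms with [al] at Jw vanish since al = t(Jw, ., .), and moving J between slots turns the
     others into multiples of the squares of t(w, X, Y) and t(Jw, X, Y). *)
  have := W0 (J w) X Y (J X) (J Y); rewrite /wedge23 !alE.
  rewrite !(form30_acs3 _ _ _ Ft) -!(form30_acs Ft) !(herm_acs_sqr H).
  rewrite !(acsN H) !(skew3Nl Ft).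
  rewrite !(skew3_12 Ft) !(skew3_23 Ft) !(form30_acs12 _ _ Ft) (skew3_swap23 Ft w Y X) => E'.
  have : t w X Y ^+ 2 + t (J w) X Y ^+ 2 = 0 by lra.
  by move/eqP; rewrite paddr_eq0 ?sqr_ge0// !sqrf_eq0 => /andP[/eqP].
have w0 : w = 0.
  apply/eqP/negP => /negP w0; have hw := herm_pos H w0.
  have hl k A A' : h w (k *: A + A') = k * h w A + h w A'.
    by rewrite (hermDr H) (hermZr H).
  have z X Y Z : t X Y Z = 0.
    have := wedge_form10_form30 H dim3 X Y Z w hl Ft.
    rewrite (herm_acs0 H) !(skew3_swap23 Ft _ _ w) !(skew3_swap12 Ft _ w) !t1.
    move=> E'.
    by apply: (mulfI (lt0r_neq0 hw)); lra.
  by move: t0; rewrite !z eqxx.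
split=> // X Y; rewrite alE w0 (acs0 H); exact: skew30l Ft _ _.
Qed.

End OrthonormalContraction.

(** * The Gray-Hervella decomposition *)

Section GramMatrix.
Variable R : realType.

Lemma bilinE m (B : 'M[R]_m) (X Y : 'cV[R]_m) :
  bilin B X Y = \sum_i \sum_j X i 0 * B i j * Y j 0.
Proof.
rewrite /bilin mxE exchange_big; apply: eq_bigr => j _.
by rewrite mxE mulr_suml; apply: eq_bigr => i _; rewrite mxE.
Qed.

Lemma bilin_basis m (B : 'M[R]_m) i j : bilin B (basis_vec R i) (basis_vec R j) = B i j.
Proof. by rewrite /bilin /basis_vec trmx_delta -rowE -colE !mxE. Qed.

Lemma bilin_linear_l m (B : 'M[R]_m) a X X' Y :
  bilin B (a *: X + X') Y = a * bilin B X Y + bilin B X' Y.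
Proof. by rewrite /bilin linearP /= !mulmxDl -!scalemxAl !mxE. Qed.

Lemma bilin_linear_r m (B : 'M[R]_m) a X Y Y' :
  bilin B X (a *: Y + Y') = a * bilin B X Y + bilin B X Y'.
Proof. by rewrite /bilin mulmxDr -scalemxAr !mxE. Qed.

Lemma bilin_sym m (B : 'M[R]_m) X Y : B^T = B -> bilin B X Y = bilin B Y X.
Proof.
move=> BT; rewrite /bilin; transitivity ((X^T *m B *m Y)^T 0 0); first by rewrite [RHS]mxE.
by rewrite !trmx_mul BT trmxK mulmxA.
Qed.

Lemma bilin_trmx m (B : 'M[R]_m) X Y : bilin B^T X Y = bilin B Y X.
Proof.
rewrite /bilin; transitivity ((X^T *m B^T *m Y)^T 0 0); first by rewrite [RHS]mxE.
by rewrite !trmx_mul !trmxK mulmxA.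
Qed.

Lemma bilin_mulmx m (B A C : 'M[R]_m) X Y :
  bilin B (A *m X) (C *m Y) = bilin (A^T *m B *m C) X Y.
Proof. by rewrite /bilin trmx_mul !mulmxA. Qed.

Lemma bilin_mulmxr m (B C : 'M[R]_m) X Y : bilin B X (C *m Y) = bilin (B *m C) X Y.
Proof. by rewrite /bilin !mulmxA. Qed.

Lemma bilin_mulmxl m (B A : 'M[R]_m) X Y : bilin B (A *m X) Y = bilin (A^T *m B) X Y.
Proof. by rewrite /bilin trmx_mul !mulmxA. Qed.

Lemma bilinP m (B C : 'M[R]_m) : (forall X Y, bilin B X Y = bilin C X Y) -> B = C.
Proof. by move=> BC; apply/matrixP => i j; rewrite -!bilin_basis BC. Qed.

Lemma bilinN m (B : 'M[R]_m) X Y : bilin (- B) X Y = - bilin B X Y.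
Proof. by rewrite /bilin mulmxN mulNmx [in LHS]mxE. Qed.

Lemma bilinDm m (B C : 'M[R]_m) X Y : bilin (B + C) X Y = bilin B X Y + bilin C X Y.
Proof. by rewrite /bilin mulmxDr mulmxDl [in LHS]mxE. Qed.

Definition posdef m (G : 'M[R]_m) := forall v : 'cV[R]_m, v != 0 -> 0 < bilin G v v.

Lemma posdef_unitmx m (G : 'M[R]_m) : posdef G -> G \in unitmx.
Proof.
move=> Gp; rewrite -row_free_unit -kermx_eq0; apply/negPn/negP.
case/rowV0Pn => v /sub_kermxP vG v0.
have := Gp v^T; rewrite trmx_eq0 => /(_ v0).
by rewrite /bilin trmxK vG mul0mx mxE ltxx.
Qed.

(** Gram-Schmidt without projections: as long as there are k < m orthonormal columns E, a rank count
    provides a nonzero row w with w G E = 0, and its normalization is the next column. *)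
Lemma posdef_gram m (G : 'M[R]_m) : G^T = G -> posdef G ->
  exists E : 'M[R]_m, E^T *m G *m E = 1%:M.
Proof.
move=> GT Gp; suff main k : (k <= m)%N ->
    exists E : 'M[R]_(m, k), E^T *m G *m E = 1%:M by exact: main.
elim: k => [_|k IH km].
  by exists 0; apply/matrixP => -[].
have [E EG] := IH (ltnW km).
have : kermx (G *m E) != 0.
  rewrite kermx_eq0 /row_free neq_ltn; apply/orP; left.
  by rewrite (leq_ltn_trans (rank_leq_col _)).
case/rowV0Pn => w /sub_kermxP wGE w0.
have gw := Gp w^T; rewrite trmx_eq0 in gw; have {gw}gw := gw w0.
rewrite /bilin trmxK in gw; set s := (w *m G *m w^T) 0 0 in gw.
have sE : w *m G *m w^T = s%:M by rewrite [LHS]mx11_scalar.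
have s2 : (Num.sqrt s)^-1 * ((Num.sqrt s)^-1 * s) = 1.
  have s0 : Num.sqrt s != 0 by rewrite gt_eqF// sqrtr_gt0.
  by rewrite -{3}(sqr_sqrtr (ltW gw)); field.
pose v := (Num.sqrt s)^-1 *: w^T.
rewrite -addn1; exists (row_mx E v).
rewrite tr_row_mx mul_col_mx mul_col_row EG [RHS]scalar_mx_block.
have vT : v^T = (Num.sqrt s)^-1 *: w by rewrite /v linearZ /= trmxK.
congr block_mx.
- rewrite /v -scalemxAr -[E^T *m G]trmxK trmx_mul trmxK GT -trmx_mul.
  by rewrite wGE trmx0 scaler0.
- by rewrite vT -!scalemxAl -mulmxA wGE scaler0.
- by rewrite vT -!scalemxAl /v -scalemxAr sE !scale_scalar_mx s2.
Qed.

End GramMatrix.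

Section GrayHervella.
Variables (R : realType) (n : nat).
Local Notation m := (2 * n)%N.
Local Notation V := 'cV[R]_m.
Local Notation d := (@basis_vec R m).
Variables G J : 'M[R]_m.

Record compatible : Prop := Compatible {
  comp_sym : G^T = G;
  comp_pos : posdef G;
  comp_sqr : J *m J = - 1%:M;
  comp_isom : forall v w : V, bilin G (J *m v) (J *m w) = bilin G v w }.

Hypothesis HC : compatible.
Local Notation h := (bilin G).

Lemma compatible_hermitian : hermitian h (mulmx J : V -> V).
Proof.
split.
- exact: bilin_linear_l.
- by move=> X Y; exact: bilin_sym (comp_sym HC).
- exact: (comp_pos HC).
- by move=> a X X'; rewrite mulmxDr -scalemxAr.
- by move=> X; rewrite mulmxA (comp_sqr HC) mulNmx mul1mx.
- exact: (comp_isom HC).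
Qed.
Let H := compatible_hermitian.

Lemma vec_expand (X : V) : X = \sum_a X a 0 *: d a.
Proof. by rewrite {1}(matrix_sum_delta X); apply: eq_bigr => i _; rewrite big_ord1. Qed.

Lemma herm_inj (X Y : V) : (forall Z, h X Z = h Y Z) -> X = Y.
Proof.
move=> hXY; apply/eqP; rewrite -subr_eq0; apply/negPn/negP => /(herm_pos H).
by rewrite (hermDl H) (hermNl H) hXY subrr ltxx.
Qed.

Lemma tens_linear (xi : tensor12 R m) a X X' :
  tens xi (a *: X + X') = a *: tens xi X + tens xi X'.
Proof.
rewrite /tens scaler_sumr -big_split /=; apply: eq_bigr => i _.
by rewrite !mxE scalerDl scalerA.
Qed.

Lemma tens_basis (xi : tensor12 R m) i : tens xi (d i) = xi i.
Proof.
rewrite /tens (bigD1 i)//= big1 ?addr0 => [|j ji]; rewrite /basis_vec mxE.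
  by rewrite !eqxx scale1r.
by rewrite (negPf ji) scale0r.
Qed.

Lemma tens_sum (I : Type) (r : seq I) (F : I -> tensor12 R m) X :
  tens (\sum_(i <- r) F i) X = \sum_(i <- r) tens (F i) X.
Proof.
rewrite /tens exchange_big /=; apply: eq_bigr => j _.
by rewrite -scaler_sumr sum_ffunE.
Qed.

Lemma tens0 X : tens (0 : tensor12 R m) X = 0.
Proof. by rewrite /tens big1// => i _; rewrite ffunE scaler0. Qed.

Definition lower (xi : tensor12 R m) (X Y Z : V) : R := h (tens xi X *m Y) Z.

Lemma lower_linear1 xi a X X' Y Z :
  lower xi (a *: X + X') Y Z = a * lower xi X Y Z + lower xi X' Y Z.
Proof.
by rewrite /lower tens_linear mulmxDl -scalemxAl (herm_linear H).
Qed.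

Lemma lower_linear2 xi a X Y Y' Z :
  lower xi X (a *: Y + Y') Z = a * lower xi X Y Z + lower xi X Y' Z.
Proof. by rewrite /lower mulmxDr -scalemxAr (herm_linear H). Qed.

Lemma lower_linear3 xi a X Y Z Z' :
  lower xi X Y (a *: Z + Z') = a * lower xi X Y Z + lower xi X Y Z'.
Proof. exact: bilin_linear_r. Qed.

Lemma lower_inj xi eta : (forall X Y Z, lower xi X Y Z = lower eta X Y Z) -> xi = eta.
Proof.
move=> E; apply/ffunP => i; rewrite -!tens_basis.
have K (Y : V) : tens xi (d i) *m Y = tens eta (d i) *m Y by apply: herm_inj => Z; exact: E.
by apply/matrixP => k j; have := K (d j); rewrite -!colE => /colP/(_ k); rewrite !mxE.
Qed.

Record trilinear (s : V -> V -> V -> R) : Prop := Trilinear {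
  tri1 : forall a X X' Y Z, s (a *: X + X') Y Z = a * s X Y Z + s X' Y Z;
  tri2 : forall a X Y Y' Z, s X (a *: Y + Y') Z = a * s X Y Z + s X Y' Z;
  tri3 : forall a X Y Z Z', s X Y (a *: Z + Z') = a * s X Y Z + s X Y Z' }.

Lemma trilinear_lower xi : trilinear (lower xi).
Proof.
by split=> *; [exact: lower_linear1|exact: lower_linear2|exact: lower_linear3].
Qed.

Lemma linear_ext (f f' : V -> R) :
  (forall a X X', f (a *: X + X') = a * f X + f X') ->
  (forall a X X', f' (a *: X + X') = a * f' X + f' X') ->
  (forall i, f (d i) = f' (d i)) -> forall X, f X = f' X.
Proof.
move=> fl fl' E X.
have z (k : V -> R) : (forall a X X', k (a *: X + X') = a * k X + k X') -> k 0 = 0.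
  by move=> kl; have := kl 1 0 0; rewrite scale1r addr0; lra.
rewrite (vec_expand X); elim/big_rec: _ => [|i x _ IH]; first by rewrite !z.
by rewrite fl fl' IH E.
Qed.

Lemma trilinear_ext s s' : trilinear s -> trilinear s' ->
  (forall i j k, s (d i) (d j) (d k) = s' (d i) (d j) (d k)) ->
  forall X Y Z, s X Y Z = s' X Y Z.
Proof.
move=> [a1 a2 a3] [b1 b2 b3] E X Y Z; move: X.
apply: linear_ext => // i; move: Y; apply: linear_ext => // j; move: Z.
exact: linear_ext.
Qed.

Definition raise (s : V -> V -> V -> R) : tensor12 R m :=
  [ffun i => invmx G *m \matrix_(k, j) s (d i) (d j) (d k)].

Lemma lower_raise s : trilinear s -> forall X Y Z, lower (raise s) X Y Z = s X Y Z.
Proof.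
move=> ts; apply: trilinear_ext => //; first exact: trilinear_lower.
move=> i j k; rewrite /lower tens_basis ffunE -mulmxA (herm_sym H) bilin_mulmxr.
rewrite mulmxV ?posdef_unitmx//; last exact: comp_pos HC.
by rewrite bilin_mulmxr mul1mx bilin_basis mxE.
Qed.

Lemma space_WP xi : space_W G J xi <->
  (forall X Y Z, lower xi X Y Z = - lower xi X Z Y) /\
  (forall X Y Z, lower xi X (J *m Y) Z = lower xi X Y (J *m Z)).
Proof.
split=> [[sk ac]|[sk ac]]; split.
- by move=> X Y Z; rewrite /lower sk (herm_sym H).
- move=> X Y Z; rewrite /lower mulmxA -[tens xi X *m J](addKr (J *m tens xi X)) ac addr0.
  by rewrite mulNmx (hermNl H) -mulmxA (herm_acsl H) opprK.
- by move=> X Y Z; have := sk X Y Z; rewrite /lower (herm_sym H Y).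
- move=> X; have K (Y : V) : (J *m tens xi X + tens xi X *m J) *m Y = 0.
    apply: herm_inj => Z; rewrite mulmxDl -!mulmxA (hermDl H) (herm_acsl H) (herm0l H).
    by have := ac X Y Z; rewrite /lower => ->; rewrite addNr.
  by apply/matrixP => k j; have := K (d j); rewrite -colE => /colP/(_ k); rewrite !mxE.
Qed.

Lemma exists_frame : exists e : 'I_m -> V, [/\ orthonormal G e,
  forall X, X = \sum_i h X (e i) *: e i & forall i, h (e i) (e i) = 1].
Proof.
have [E EG] := posdef_gram (comp_sym HC) (comp_pos HC).
have oE : orthonormal G (fun i => col i E).
  move=> i j; rewrite !colE bilin_mulmx EG bilin_basis.
  by rewrite mxE.
exists (fun i => col i E); split=> // [X|i]; last by rewrite oE eqxx.
have EE : E *m (E^T *m G) = 1%:M by apply: mulmx1C.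
have hE (i : 'I_m) : h X (col i E) = (E^T *m G *m X) i 0.
  by rewrite (herm_sym H) /bilin tr_col -!row_mul mxE.
rewrite -[LHS]mul1mx -EE -mulmxA; apply/matrixP => k j; rewrite ord1 mxE summxE.
by apply: eq_bigr => i _; rewrite [RHS]mxE hE [col i E k 0]mxE mulrC.
Qed.

Definition trace12 (xi : tensor12 R m) : V := mtrace G (fun X Y => tens xi X *m Y).

Lemma trace12_frame xi (e : 'I_m -> V) Z : orthonormal G e ->
  h (trace12 xi) Z = \sum_i lower xi (e i) (e i) Z.
Proof.
move=> oe; rewrite /trace12 -(mtrace_frame (e := e))//.
- by elim/big_rec2: _ => [|i x y _ <-]; rewrite ?(herm0l H)// (hermDl H).
- by move=> Y a X X'; rewrite tens_linear mulmxDl -scalemxAl.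
- by move=> X a Y Y'; rewrite mulmxDr -scalemxAr.
Qed.

(** The tensor of W_4 attached to a one-form, with last slot lowered and the one-form replaced by
    its dual vector v. *)
Definition w4form (v X Y Z : V) : R := 4^-1 * (h X Y * h v Z - h v Y * h X Z
  - h (J *m X) Y * h (J *m v) Z - h v (J *m Y) * h (J *m X) Z).

Lemma sharpE (th : 'rV[R]_m) Y : h (sharp G th) Y = app_form th Y.
Proof.
rewrite /sharp /app_form /bilin trmx_mul trmxK trmx_inv (comp_sym HC).
by rewrite mulmxKV ?posdef_unitmx//; exact: comp_pos HC.
Qed.

Lemma flat_exists (v : V) : exists th : 'rV[R]_m, v = sharp G th.
Proof.
exists (G *m v)^T; rewrite /sharp trmxK mulKmx// posdef_unitmx//; exact: comp_pos HC.
Qed.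

Lemma space_W4P xi : space_W4 G J xi <->
  space_W G J xi /\ exists v, forall X Y Z, lower xi X Y Z = w4form v X Y Z.
Proof.
have E th X Y Z : h (bilin G X Y *: sharp G th - app_form th Y *: X
      - bilin G (J *m X) Y *: (J *m sharp G th)
      + app_form (form_J J th) Y *: (J *m X)) Z = 4 * w4form (sharp G th) X Y Z.
  rewrite !(hermDl H, hermNl H, hermZl H) /w4form !sharpE.
  have -> : app_form (form_J J th) Y = - app_form th (J *m Y).
    by rewrite /app_form /form_J mulNmx mulmxA !mxE.
  by field.
split=> [[Wxi [th thE]]|[Wxi [v vE]]]; split=> //.
  exists (sharp G th) => X Y Z; have := congr1 (h^~ Z) (thE X Y).
  by rewrite /= E (hermZl H) /lower => /mulfI; apply; rewrite pnatr_eq0.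
have [th vth] := flat_exists v; exists th => X Y; apply: herm_inj => Z.
by rewrite E (hermZl H) -vth -vE.
Qed.

Lemma w4form_trilinear v : trilinear (w4form v).
Proof.
split=> *; rewrite /w4form ?mulmxDr -?scalemxAr
  ?(herm_linear H) ?bilin_linear_r; ring.
Qed.

Lemma acs_sqrm (X : V) : J *m (J *m X) = - X. Proof. exact: herm_acs_sqr H X. Qed.

Lemma space_W_w4form v : space_W G J (raise (w4form v)).
Proof.
have E := lower_raise (w4form_trilinear v).
apply/space_WP; split=> X Y Z; rewrite !E /w4form.
  rewrite (herm_acsl H X) (herm_acsl H v) (herm_acsl H X) (herm_acsl H v); ring.
rewrite !acs_sqrm !(hermNr H) !(herm_acsl H) !acs_sqrm !(hermNr H).
ring.
Qed.

(** The factor is (2n - 1 - 1) / 4: the trace of the metric gives 2n, and the terms in v and in Jv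
    subtract one copy of <v, Z> each. *)
Lemma w4form_trace v (e : 'I_m -> V) Z : orthonormal G e ->
  (forall X, X = \sum_i h X (e i) *: e i) ->
  \sum_i w4form v (e i) (e i) Z = (n%:R - 1) / 2 * h v Z.
Proof.
move=> oe eE.
have fr X Y : \sum_i h X (e i) * h (e i) Y = h X Y.
  rewrite {2}[X]eE; elim/big_rec2: _ => [|i x y _ ->]; first by rewrite (herm0l H).
  by rewrite (herm_linear H).
have E i : w4form v (e i) (e i) Z = 4^-1 * (h v Z - h v (e i) * h (e i) Z
    - h (J *m v) (e i) * h (e i) (J *m Z)).
  have e1 : h (e i) (e i) = 1 by rewrite oe eqxx.
  rewrite /w4form e1 (herm_sym H (J *m e i)) (herm_acs0 H) !(herm_acsl H).
  by field.
under eq_bigr do rewrite E.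
rewrite -mulr_sumr !big_split /= !sumrN !fr (herm_acs_isom H) sumr_const card_ord.
by rewrite -[h v Z *+ _]mulr_natl natrM; field.
Qed.

End GrayHervella.

Lemma sum_1_4 (U : nmodType) (F : nat -> U) :
  \sum_(1 <= a < 5) F a = F 1%N + (F 2%N + (F 3%N + F 4%N)).
Proof. by rewrite unlock /= addr0. Qed.

(** * Explicit projections onto W_1, W_2, W_3, W_4 *)

Section Decomposition.
Variables (R : realType) (n : nat).
Local Notation m := (2 * n)%N.
Local Notation V := 'cV[R]_m.
Variables G J : 'M[R]_m.
Hypothesis HC : compatible G J.
Local Notation h := (bilin G).
Let H := compatible_hermitian HC.

(** The substitution (X, Y) -> (JX, JY) is -1 on W_1 + W_2 and +1 on W_3 + W_4; this is the
    projection onto the first eigenspace. *)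
Definition part12 (s : V -> V -> V -> R) X Y Z : R :=
  2^-1 * (s X Y Z - s (J *m X) (J *m Y) Z).

(** Total alternation: the (1,2)-part is already skew in its last two slots, so the cyclic mean
    suffices. *)
Definition w1form (s : V -> V -> V -> R) X Y Z : R :=
  3^-1 * (part12 s X Y Z + part12 s Y Z X + part12 s Z X Y).

Definition lee_vector (xi : tensor12 R m) : V := (2 / (n%:R - 1)) *: trace12 G xi.

(** The anti-invariant part is split into its alternation and the rest, the invariant part into the
    W_4 tensor with the same trace and the rest. The factor 2 / (n - 1) in [lee_vector] inverts the
    constant of [w4form_trace]; other indices give zero, in accordance with [gh_space]. *)
Definition gh_form (xi : tensor12 R m) (a : nat) : V -> V -> V -> R :=
  let s := lower G xi in let w4 := w4form G J (lee_vector xi) in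
  match a with
  | 1 => w1form s
  | 2 => fun X Y Z => part12 s X Y Z - w1form s X Y Z
  | 3 => fun X Y Z => s X Y Z - part12 s X Y Z - w4 X Y Z
  | 4 => w4
  | _ => fun _ _ _ => 0
  end.

Let JJ (X : V) : J *m (J *m X) = - X. Proof. exact: herm_acs_sqr H X. Qed.

Section Forms.
Variable s : V -> V -> V -> R.
Hypotheses (ts : trilinear s) (s23 : forall X Y Z, s X Y Z = - s X Z Y)
  (sJ : forall X Y Z, s X (J *m Y) Z = s X Y (J *m Z)).

Lemma tri0 Y Z : s 0 Y Z = 0.
Proof. by have := tri1 ts 1 0 0 Y Z; rewrite scale1r addr0; lra. Qed.
Lemma triN1 X Y Z : s (- X) Y Z = - s X Y Z.
Proof. by rewrite -[- X]addr0 -scaleN1r (tri1 ts) tri0; ring. Qed.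
Lemma triN3 X Y Z : s X Y (- Z) = - s X Y Z.
Proof.
have s0 : s X Y 0 = 0 by have := tri3 ts 1 X Y 0 0; rewrite scale1r addr0; lra.
by rewrite -[- Z]addr0 -scaleN1r (tri3 ts) s0; ring.
Qed.
Lemma triN2 X Y Z : s X (- Y) Z = - s X Y Z.
Proof. by rewrite s23 triN3 (s23 X Y). Qed.

Lemma part12_skew X Y Z : part12 s X Y Z = - part12 s X Z Y.
Proof.
rewrite /part12 (s23 X Y); have -> : s (J *m X) (J *m Y) Z = - s (J *m X) (J *m Z) Y.
  by rewrite sJ s23.
by ring.
Qed.

Lemma part12_acs23 X Y Z : part12 s X (J *m Y) Z = part12 s X Y (J *m Z).
Proof. by rewrite /part12 !sJ !JJ triN3. Qed.

Lemma part12_acs12 X Y Z : part12 s (J *m X) Y Z = part12 s X (J *m Y) Z.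
Proof. by rewrite /part12 !JJ triN1 triN2; ring. Qed.

Lemma part12_trilinear : trilinear (part12 s).
Proof.
case: ts => t1 t2 t3; split=> *.
- by rewrite /part12 mulmxDr -scalemxAr !t1; ring.
- by rewrite /part12 mulmxDr -scalemxAr !t2; ring.
- by rewrite /part12 !t3; ring.
Qed.

Lemma w1form_trilinear : trilinear (w1form s).
Proof.
case: part12_trilinear => t1 t2 t3.
by split=> *; rewrite /w1form !(t1, t2, t3); ring.
Qed.

Lemma w1form_swap12 X Y Z : w1form s X Y Z = - w1form s Y X Z.
Proof.
rewrite /w1form (part12_skew X) (part12_skew Y Z) (part12_skew Z); ring.
Qed.

Lemma w1form_swap23 X Y Z : w1form s X Y Z = - w1form s X Z Y.
Proof.
rewrite /w1form (part12_skew X) (part12_skew Y Z) (part12_skew Z); ring.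
Qed.

Lemma w1form_acs12 X Y Z : w1form s (J *m X) Y Z = w1form s X (J *m Y) Z.
Proof.
by rewrite /w1form (part12_acs12 X) -(part12_acs23 Y Z) -(part12_acs12 Y)
  (part12_acs23 Z X).
Qed.

Lemma w1form_acs23 X Y Z : w1form s X (J *m Y) Z = w1form s X Y (J *m Z).
Proof.
have cyc A B C : w1form s A B C = w1form s C A B by rewrite /w1form; ring.
by rewrite [RHS]cyc w1form_acs12 [RHS]cyc [RHS]cyc -w1form_acs12 cyc.
Qed.

End Forms.

Lemma lower_raise_W s : trilinear s -> (forall X Y Z, s X Y Z = - s X Z Y) ->
  (forall X Y Z, s X (J *m Y) Z = s X Y (J *m Z)) -> space_W G J (raise G s).
Proof.
move=> ts s23 sJ; apply/(space_WP HC); split=> X Y Z; rewrite !(lower_raise HC ts).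
  exact: s23.
exact: sJ.
Qed.

Lemma space_W1P xi : space_W1 G J xi <->
  space_W G J xi /\ forall X Z, lower G xi X X Z = 0.
Proof.
split=> -[Wxi x0]; split=> // X.
  by move=> Z; rewrite /lower x0 (herm0l H).
by apply: (herm_inj HC) => Z; rewrite (herm0l H); exact: x0.
Qed.

Lemma space_W2P xi : space_W2 G J xi <-> space_W G J xi /\ forall X Y Z,
  lower G xi X Y (J *m Z) + lower G xi Y Z (J *m X) + lower G xi Z X (J *m Y) = 0.
Proof. by []. Qed.

Lemma space_W3P xi (e : 'I_m -> V) : orthonormal G e -> space_W3 G J xi <->
  [/\ space_W G J xi, forall X Y Z, lower G xi (J *m X) (J *m Y) Z = lower G xi X Y Z &
    forall Z, \sum_i lower G xi (e i) (e i) Z = 0].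
Proof.
move=> oe; split=> [[Wxi [xJ x0]]|[Wxi xJ x0]].
  split=> // [X Y Z|Z]; first by rewrite /lower xJ.
  by rewrite -(trace12_frame HC _ _ oe) /trace12 x0 (herm0l H).
split=> //; split=> [X Y|]; first by apply: (herm_inj HC) => Z; exact: xJ.
by apply: (herm_inj HC) => Z; rewrite (herm0l H) -(x0 Z) -(trace12_frame HC _ _ oe).
Qed.

Section Components.
Variable xi : tensor12 R m.
Hypothesis Wxi : space_W G J xi.
Let s := lower G xi.
Let ts : trilinear s. Proof. exact: (trilinear_lower HC). Qed.
Let s23 X Y Z : s X Y Z = - s X Z Y. Proof. by have [+ _] := (space_WP HC xi).1 Wxi. Qed.
Let sJ X Y Z : s X (J *m Y) Z = s X Y (J *m Z).
Proof. by have [_ +] := (space_WP HC xi).1 Wxi. Qed.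

(** The vectors J e_i form a frame as good as the e_i. As a consequence tensors anti-invariant under
    (X, Y) -> (JX, JY) are trace-free. *)
Lemma frame_acs (e : 'I_m -> V) Z : (forall X, X = \sum_i h X (e i) *: e i) ->
  \sum_i s (J *m e i) (J *m e i) Z = \sum_i s (e i) (e i) Z.
Proof.
move=> eE.
have fr (f : V -> R) X : (forall a A B, f (a *: A + B) = a * f A + f B) ->
    f X = \sum_i h X (e i) * f (e i).
  move=> fl; have f0 : f 0 = 0 by have := fl 1 0 0; rewrite scale1r addr0; lra.
  rewrite {1}[X]eE; elim/big_rec2: _ => [|i x y _ <-] //.
have E1 i : s (J *m e i) (J *m e i) Z =
    \sum_j h (J *m e i) (e j) * s (e j) (J *m e i) Z.
  by rewrite -(fr (fun X => s X (J *m e i) Z))// => a A B; exact: tri1.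
under eq_bigr do rewrite E1.
rewrite exchange_big /=; apply: eq_bigr => j _.
have := fr (fun X => - s (e j) (J *m X) Z) (J *m e j).
rewrite JJ (triN2 ts s23) opprK => ->; last first.
  by move=> a A B; rewrite mulmxDr -scalemxAr (tri2 ts); ring.
by apply: eq_bigr => i _; rewrite (herm_acsl H) (herm_sym H (e i)); ring.
Qed.

Lemma w4form_acs v X Y Z : w4form G J v (J *m X) (J *m Y) Z = w4form G J v X Y Z.
Proof.
rewrite /w4form !JJ !(hermNl H, hermNr H) !(herm_acsl H) !JJ.
by rewrite !(hermNr H); ring.
Qed.

Lemma lee_vector_trace (e : 'I_m -> V) Z : (1 < n)%N -> orthonormal G e ->
  \sum_i s (e i) (e i) Z = (n%:R - 1) / 2 * h (lee_vector xi) Z.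
Proof.
move=> n1 oe; rewrite /lee_vector (hermZl H) (trace12_frame HC _ _ oe).
have n10 : n%:R - 1 != 0 :> R by rewrite subr_eq0 (eqr_nat _ n 1) gtn_eqF.
by field.
Qed.

Lemma lower_sum (I : Type) (r : seq I) (F : I -> tensor12 R m) X Y Z :
  lower G (\sum_(i <- r) F i) X Y Z = \sum_(i <- r) lower G (F i) X Y Z.
Proof.
rewrite /lower tens_sum mulmx_suml.
by elim/big_rec2: _ => [|i x y _ <-]; rewrite ?(herm0l H)// (hermDl H).
Qed.

Lemma gh_form_trilinear a : trilinear (gh_form xi a).
Proof.
have tp := part12_trilinear ts; have tw := w1form_trilinear ts.
have t4 := w4form_trilinear HC (lee_vector xi).
case: a => [|[|[|[|[|a]]]]]; rewrite /gh_form -/s //; try by split=> *; ring.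
  by split=> *; rewrite !(tri1 tp, tri2 tp, tri3 tp, tri1 tw, tri2 tw, tri3 tw); ring.
split=> *; rewrite !(tri1 tp, tri2 tp, tri3 tp, tri1 ts, tri2 ts, tri3 ts).
- by rewrite (tri1 t4); ring.
- by rewrite (tri2 t4); ring.
- by rewrite (tri3 t4); ring.
Qed.

Lemma gh_decomposition_exists : (1 < n)%N ->
  gh_decomposition G J xi (fun a => raise G (gh_form xi a)).
Proof.
move=> n1; have lr a := lower_raise HC (gh_form_trilinear a).
have [e [oe eE e1]] := exists_frame HC.
have pS := part12_skew s23 sJ; have pJ := part12_acs23 ts sJ.
have pJ' := part12_acs12 ts s23; have wS := w1form_swap23 s23 sJ.
have wS' := w1form_swap12 s23 sJ; have wJ := w1form_acs23 ts s23 sJ.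
have wJ' := w1form_acs12 ts s23 sJ.
have w0 X Z : w1form s X X Z = 0 by have := wS' X X Z; lra.
have [w4S w4J] := (space_WP HC _).1 (space_W_w4form HC (lee_vector xi)).
have w4E := lower_raise HC (w4form_trilinear HC (lee_vector xi)).
split=> [a|]; last first.
  apply: (lower_inj HC) => X Y Z; rewrite lower_sum sum_1_4 !lr.
  by rewrite /gh_form -/s; ring.
case: a => [|[|[|[|[|a]]]]].
- by apply: (lower_inj HC) => X Y Z; rewrite lr /lower tens0 mul0mx (herm0l H).
- apply/space_W1P; split; last by move=> X Z; rewrite lr; exact: w0.
  exact: lower_raise_W (gh_form_trilinear 1) _ _.
- apply/space_W2P; split; last first.
    move=> X Y Z; rewrite !lr /gh_form -/s /=.
    have -> : part12 s Z X (J *m Y) = 3 * w1form s X Y (J *m Z)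
        - part12 s X Y (J *m Z) - part12 s Y Z (J *m X).
      by rewrite /w1form -!pJ -!pJ'; field.
    have cyc A B C : w1form s A B C = w1form s C A B by rewrite /w1form; ring.
    by rewrite (cyc Y Z) (cyc Z X) (cyc (J *m Y)) -!wJ -!wJ'; ring.
  apply: lower_raise_W (gh_form_trilinear 2) _ _ => X Y Z; rewrite /gh_form -/s /=.
    by rewrite pS wS; ring.
  by rewrite pJ wJ.
- apply/(space_W3P _ oe); split=> [|X Y Z|Z].
  + apply: lower_raise_W (gh_form_trilinear 3) _ _ => X Y Z; rewrite /gh_form -/s /= -!w4E.
      by rewrite s23 pS w4S; ring.
    by rewrite sJ pJ w4J.
  + rewrite !lr /gh_form -/s /= w4form_acs /part12 !JJ (triN1 ts) (triN2 ts s23).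
    by field.
  + under eq_bigr do rewrite lr /gh_form -/s /=.
    rewrite !big_split /= !sumrN (w4form_trace HC _ _ oe eE).
    rewrite -(lee_vector_trace _ n1 oe) /part12 -mulr_sumr big_split /= sumrN.
    by rewrite (frame_acs _ eE); move: (\sum_i _) => S; field.
- by apply: (space_W4P HC _).2; split; [exact: space_W_w4form|exists (lee_vector xi) => X Y Z; rewrite lr].
- by apply: (lower_inj HC) => X Y Z; rewrite lr /lower tens0 mul0mx (herm0l H).
Qed.

End Components.

Lemma lower_W1_skew xi X Y Z : space_W1 G J xi -> lower G xi X Y Z = - lower G xi Y X Z.
Proof.
case/space_W1P => Wxi s0; have ts := trilinear_lower HC xi.
have D1 A B C E : lower G xi (A + B) C E = lower G xi A C E + lower G xi B C E.
  by have := tri1 ts 1 A B C E; rewrite scale1r mul1r.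
have D2 A B C E : lower G xi C (A + B) E = lower G xi C A E + lower G xi C B E.
  by have := tri2 ts 1 C A B E; rewrite scale1r mul1r.
have := s0 (X + Y) Z; rewrite D1 !D2 !s0; lra.
Qed.

Lemma lower_W1_acs xi X Y Z :
  space_W1 G J xi -> lower G xi (J *m X) (J *m Y) Z = - lower G xi X Y Z.
Proof.
move=> W1; have [Wxi _] := W1; have [s23 sJ] := (space_WP HC xi).1 Wxi.
rewrite (lower_W1_skew _ _ _ W1) sJ (lower_W1_skew _ _ _ W1) opprK sJ JJ.
exact: triN3 (trilinear_lower HC xi) _ _ _.
Qed.

(** The cyclic condition, taken at four triples with J inserted in an even number of slots, combines
    linearly to move J from the first slot to the last. *)
Lemma lower_W2_acs xi X Y Z :
  space_W2 G J xi -> lower G xi (J *m X) (J *m Y) Z = - lower G xi X Y Z.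
Proof.
case/space_W2P => Wxi c; have [s23 sJ] := (space_WP HC xi).1 Wxi.
have N3 := triN3 (trilinear_lower HC xi).
have aE A B C : lower G xi (J *m A) B C = lower G xi A B (J *m C).
  have := c A B C; have := c (J *m A) (J *m B) C.
  have := c A (J *m B) (J *m C); have := c (J *m A) B (J *m C).
  by rewrite !sJ !(JJ, mulmxN, N3); lra.
by rewrite aE sJ JJ N3.
Qed.

Lemma lower_W2_cyclic xi X Y Z : space_W2 G J xi ->
  lower G xi X Y Z + lower G xi Y Z X + lower G xi Z X Y = 0.
Proof.
move=> W2; have a := lower_W2_acs _ _ _ W2.
case/space_W2P: W2 => Wxi c; have [s23 sJ] := (space_WP HC xi).1 Wxi.
have N3 := triN3 (trilinear_lower HC xi).
have := c X Y (J *m Z).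
rewrite JJ N3 (sJ Y Z) JJ N3 -(sJ (J *m Z) X) a; lra.
Qed.

(** Behaviour under (X, Y) -> (JX, JY) separates W_1 + W_2 from W_3 + W_4; the trace sees only W_4
    and determines its vector; the cyclic sum kills W_2 and reproduces W_1. So each term is the
    explicit form computed from xi. *)
Lemma gh_decomposition_unique xi eta : (1 < n)%N -> gh_decomposition G J xi eta ->
  eta = fun a => raise G (gh_form xi a).
Proof.
move=> n1 [Weta xiE]; have W1 := Weta 1%N; have W2 := Weta 2%N.
have [W3 W4] := (Weta 3%N, Weta 4%N); have [e [oe eE e1]] := exists_frame HC.
have n10 : (n%:R - 1) / 2 != 0 :> R.
  by rewrite mulf_neq0 ?invr_neq0 ?pnatr_eq0// subr_eq0 (eqr_nat _ n 1) gtn_eqF.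
have sE X Y Z : lower G xi X Y Z = lower G (eta 1%N) X Y Z + (lower G (eta 2%N) X Y Z
    + (lower G (eta 3%N) X Y Z + lower G (eta 4%N) X Y Z)).
  by rewrite {1}xiE lower_sum sum_1_4.
have [Wxi1 _] := (space_W1P _).1 W1; have [Wxi2 _] := (space_W2P _).1 W2.
have [Wxi3 a3 tr3] := (space_W3P _ oe).1 W3.
have [Wxi4 [v vE]] := (space_W4P HC _).1 W4.
have Wxi : space_W G J xi.
  apply/(space_WP HC); split=> X Y Z; rewrite !sE.
    have [k1 _] := (space_WP HC _).1 Wxi1; have [k2 _] := (space_WP HC _).1 Wxi2.
    have [k3 _] := (space_WP HC _).1 Wxi3; have [k4 _] := (space_WP HC _).1 Wxi4.
    by rewrite k1 k2 k3 k4; ring.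
  have [_ k1] := (space_WP HC _).1 Wxi1; have [_ k2] := (space_WP HC _).1 Wxi2.
  have [_ k3] := (space_WP HC _).1 Wxi3; have [_ k4] := (space_WP HC _).1 Wxi4.
  by rewrite k1 k2 k3 k4.
have a1 X Y Z := lower_W1_acs X Y Z W1; have a2 X Y Z := lower_W2_acs X Y Z W2.
have tr0 (zt : tensor12 R m) Z : space_W G J zt ->
    (forall X Y Z, lower G zt (J *m X) (J *m Y) Z = - lower G zt X Y Z) ->
    \sum_i lower G zt (e i) (e i) Z = 0.
  move=> Wz az; have := frame_acs Wz Z eE.
  under eq_bigr do rewrite az.
  by rewrite sumrN; lra.
have lee : lee_vector xi = v.
  apply: (herm_inj HC) => Z; apply: (mulfI n10).
  rewrite -(lee_vector_trace _ _ n1 oe) -(w4form_trace HC _ _ oe eE).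
  under eq_bigr do rewrite sE.
  rewrite !big_split /= tr3 (tr0 _ _ Wxi1 a1) (tr0 _ _ Wxi2 a2) !add0r.
  by apply: eq_bigr => i _; exact: vE.
have pE X Y Z : part12 (lower G xi) X Y Z = lower G (eta 1%N) X Y Z + lower G (eta 2%N) X Y Z.
  by rewrite /part12 !sE a1 a2 a3 !vE w4form_acs; field.
have wE X Y Z : w1form (lower G xi) X Y Z = lower G (eta 1%N) X Y Z.
  have := lower_W2_cyclic X Y Z W2; have [s23 _] := (space_WP HC _).1 Wxi1.
  rewrite /w1form !pE.
  rewrite (lower_W1_skew Y Z X W1) (s23 Z Y X) (lower_W1_skew Z X Y W1) (s23 X Z Y).
  by rewrite opprK; lra.
apply/funext => a; apply: (lower_inj HC) => X Y Z.
rewrite (lower_raise HC (gh_form_trilinear xi a)).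
case: a => [|[|[|[|[|a]]]]]; rewrite /gh_form.
- have /= -> : eta 0%N = 0 by exact: (Weta 0%N).
  by rewrite /lower tens0 mul0mx (herm0l H).
- by rewrite wE.
- by rewrite pE wE; ring.
- by rewrite pE lee -vE sE; ring.
- by rewrite lee -vE.
- have -> : eta a.+4.+1 = 0 by exact: (Weta a.+4.+1).
  by rewrite /lower tens0 mul0mx (herm0l H).
Qed.

(** Existence ensures that [xget] returns an actual decomposition rather than its default, and
    uniqueness identifies which one. *)
Lemma gh_componentE xi : (1 < n)%N -> space_W G J xi ->
  gh_component G J xi = fun a => raise G (gh_form xi a).
Proof.
move=> n1 Wxi; rewrite /gh_component; case: xgetP => [eta _ eta_dec|no].
  exact: gh_decomposition_unique n1 eta_dec.
by have := no _ (gh_decomposition_exists Wxi n1).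
Qed.

Lemma gh_componentP xi : (1 < n)%N -> space_W G J xi ->
  gh_decomposition G J xi (gh_component G J xi).
Proof. by move=> n1 Wxi; rewrite gh_componentE//; exact: gh_decomposition_exists. Qed.

Lemma gh_component_unique xi eta : (1 < n)%N -> gh_decomposition G J xi eta ->
  gh_component G J xi = eta.
Proof.
move=> n1 dec; rewrite /gh_component; case: xgetP => [zt _ zt_dec|/(_ _ dec)//].
by rewrite (gh_decomposition_unique n1 zt_dec) (gh_decomposition_unique n1 dec).
Qed.

Lemma lower_component4 xi X Y Z : (1 < n)%N -> space_W G J xi ->
  lower G (gh_component G J xi 4) X Y Z = w4form G J (lee_vector xi) X Y Z.
Proof.
move=> n1 Wxi; rewrite gh_componentE// (lower_raise HC)//.
exact: (gh_form_trilinear xi 4).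
Qed.

End Decomposition.

(** * The Levi-Civita connection and the intrinsic torsion in a chart *)

Section MatrixDerivatives.
Variables (R : realType) (m : nat).
Local Notation V := 'cV[R]_m.

Lemma near_open (O : set V) (P : V -> Prop) x : open O -> O x ->
  (forall y, O y -> P y) -> \forall y \near x, P y.
Proof. by move=> oO Ox OP; apply: filterS OP _; exact: open_nbhs_nbhs. Qed.

Lemma derive_bigsum (W : normedModType R) (I : Type) (r : seq I) (F : I -> V -> W) x v :
  (forall i, differentiable (F i) x) ->
  differentiable (fun y => \sum_(i <- r) F i y) x /\
  'D_v (fun y => \sum_(i <- r) F i y) x = \sum_(i <- r) 'D_v (F i) x.
Proof.
move=> dF; elim: r => [|i r [IH1 IH2]].
  under eq_fun do rewrite big_nil; rewrite big_nil; split; first exact: differentiable_cst.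
  exact: derive_cst.
rewrite big_cons -IH2; under eq_fun do rewrite big_cons; split.
  exact: differentiableD.
by rewrite derive_addf.
Qed.

Lemma derive_mulmx p q r (A : V -> 'M[R]_(p, q)) (B : V -> 'M[R]_(q, r)) x v :
  differentiable A x -> differentiable B x ->
  differentiable (fun y => A y *m B y) x /\
  'D_v (fun y => A y *m B y) x = 'D_v A x *m B x + A x *m 'D_v B x.
Proof.
move=> dA dB; have dA' := (differentiable_mxP A x).1 dA.
have dB' := (differentiable_mxP B x).1 dB.
have dAB i j : differentiable (fun y => (A y *m B y) i j) x /\
    'D_v (fun y => (A y *m B y) i j) x =
    \sum_k ('D_v A x i k * B x k j + A x i k * 'D_v B x k j).
  under eq_fun do rewrite mxE.
  have [|d1 ->] := @derive_bigsum R _ (index_enum 'I_q) (fun k y => A y i k * B y k j) x v.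
    by move=> k; exact: differentiable_mulf.
  split=> //; apply: eq_bigr => k _; rewrite derive_mulf// -!derive_mxE//.
have dm : differentiable (fun y => A y *m B y) x.
  by apply/differentiable_mxP => i j; have [] := dAB i j.
split=> //; apply/matrixP => i j; rewrite derive_mxE//; have [_ ->] := dAB i j.
by rewrite big_split /= !mxE.
Qed.

Lemma derive_trmx p q (A : V -> 'M[R]_(p, q)) x v : differentiable A x ->
  'D_v (fun y => (A y)^T) x = ('D_v A x)^T.
Proof.
move=> dA; have dA' := (differentiable_mxP A x).1 dA.
have dT : differentiable (fun y => (A y)^T) x.
  by apply/differentiable_mxP => i j; under eq_fun do rewrite mxE; exact: dA'.
apply/matrixP => i j; rewrite (derive_mxE _ _ _ dT) mxE (derive_mxE _ _ _ dA).
by congr ('D_v _ x); apply/funext => y; rewrite mxE.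
Qed.

Lemma smooth_on_trmx p q O (A : V -> 'M[R]_(p, q)) : open O ->
  smooth_on O A -> smooth_on O (fun y => (A y)^T).
Proof.
move=> oO /smooth_on_mxP-/(_ oO) sA; apply/smooth_on_mxP => // i j.
by under eq_fun do rewrite mxE; exact: sA.
Qed.

(** A product rule for a tensor applied to a moving vector such as J(y) X, obtained by expanding the
    vector in the coordinate basis. *)
Lemma derive_contract (F : V -> V -> R) (W : V -> V) x v :
  (forall y a X X', F y (a *: X + X') = a * F y X + F y X') ->
  (forall X, differentiable (F^~ X) x) -> differentiable W x ->
  differentiable (fun y => F y (W y)) x /\
  'D_v (fun y => F y (W y)) x = 'D_v (F^~ (W x)) x + F x ('D_v W x).
Proof.
move=> Fl dF dW; have dW' := (differentiable_mxP W x).1 dW.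
have F0 y : F y 0 = 0 by have := Fl y 1 0 0; rewrite scale1r addr0; lra.
have FE y X : F y X = \sum_k X k 0 * F y (basis_vec R k).
  have {1}-> : X = \sum_k X k 0 *: basis_vec R k.
    by rewrite {1}(matrix_sum_delta X); apply: eq_bigr => i _; rewrite big_ord1.
  by elim/big_rec2: _ => [|i a b _ <-]; rewrite ?F0.
have := @derive_bigsum R _ (index_enum 'I_m)
  (fun k y => W y k 0 * F y (basis_vec R k)) x v.
case=> [k|d1 D1]; first exact: differentiable_mulf.
under eq_fun do rewrite FE; split=> //; rewrite D1.
under eq_bigr => k _ do rewrite derive_mulf// -derive_mxE//.
rewrite big_split /= -FE addrC; congr (_ + _).
under [in RHS]eq_fun do rewrite FE.
have [k|_ ->] := @derive_bigsum R _ (index_enum 'I_m)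
  (fun k y => W x k 0 * F y (basis_vec R k)) x v.
  by apply: differentiable_mulf => //; exact: differentiable_cst.
apply: eq_bigr => k _; have dc : differentiable (fun _ : V => W x k 0) x.
  exact: differentiable_cst.
by rewrite (derive_mulf v dc (dF _)) derive_cst mul0r add0r.
Qed.

Lemma smooth_on_derive_comm (f : V -> R) (O : set V) x a b :
  open O -> smooth_on O f -> O x -> 'D_b ('D_a f) x = 'D_a ('D_b f) x.
Proof.
move=> oO sf Ox; apply: (@derive_comm _ _ f O) => //.
- by move=> y Oy; exact: smooth_on_differentiable sf Oy.
- exact: smooth_on_differentiable (smooth_on_derive a sf) Ox.
- exact: smooth_on_differentiable (smooth_on_derive b sf) Ox.
Qed.

Lemma smooth_on_derive_mx_comm p q (f : V -> 'M[R]_(p, q)) (O : set V) x a b :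
  open O -> smooth_on O f -> O x -> 'D_b ('D_a f) x = 'D_a ('D_b f) x.
Proof.
move=> oO sf Ox; have sf' := (smooth_on_mxP f oO).1 sf.
have E v w i j : 'D_v ('D_w f) x i j = 'D_v ('D_w (fun y => f y i j)) x.
  rewrite derive_mxE; last exact: smooth_on_differentiable (smooth_on_derive _ sf) Ox.
  apply: near_eq_derive; apply: (near_open oO Ox) => y Oy.
  exact: derive_mxE (smooth_on_differentiable sf Oy).
apply/matrixP => i j.
apply: (etrans (E b a i j)); apply: (etrans _ (esym (E a b i j))).
exact: smooth_on_derive_comm oO (sf' i j) Ox.
Qed.

End MatrixDerivatives.

(** * The connections nabla and nabla + xi *)

Section Connection.
Variables (R : realType) (n : nat).
Local Notation m := (2 * n)%N.
Local Notation V := 'cV[R]_m.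
Local Notation d := (@basis_vec R m).
Variables (O : set V) (g J : V -> 'M[R]_m).

Record local_structure : Prop := LocalStructure {
  loc_open : open O;
  loc_metric : smooth_on O g;
  loc_acs : smooth_on O J;
  loc_compatible : forall x, O x -> compatible (g x) (J x) }.

Hypothesis HL : local_structure.
Let oO := loc_open HL.
Let HC := loc_compatible HL.

Lemma dg x : O x -> differentiable g x.
Proof. exact: smooth_on_differentiable (loc_metric HL). Qed.
Lemma dJ x : O x -> differentiable J x.
Proof. exact: smooth_on_differentiable (loc_acs HL). Qed.

Definition conn (x : V) (A : V) : 'M[R]_m := \sum_i A i 0 *: christoffel g x i.

Lemma sum_linear (U : lmodType R) (F : 'I_m -> U) a (A A' : V) :
  \sum_i (a *: A + A') i 0 *: F i = a *: \sum_i A i 0 *: F i + \sum_i A' i 0 *: F i.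
Proof.
rewrite scaler_sumr -big_split /=; apply: eq_bigr => i _.
by rewrite !mxE scalerDl scalerA.
Qed.

Lemma conn_linear x a A A' : conn x (a *: A + A') = a *: conn x A + conn x A'.
Proof. exact: sum_linear. Qed.

Lemma derive_expand (W : normedModType R) (f : V -> W) x A : differentiable f x ->
  'D_A f x = \sum_i A i 0 *: partial i f x.
Proof.
move=> df; have fl := derive_linearE df.
have f0 : 'D_(0 : V) f x = 0 by exact: derive0.
rewrite {1}(vec_expand A); elim/big_rec2: _ => [|i w u _ <-] //.
exact: fl.
Qed.

Lemma metric_derive_sym x A : O x -> ('D_A g x)^T = 'D_A g x.
Proof.
move=> Ox; rewrite -derive_trmx; last exact: dg.
apply: near_eq_derive; apply: (near_open oO Ox) => y Oy; exact: comp_sym (HC Oy).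
Qed.

Lemma derive_metric x A : O x -> 'D_A g x = (conn x A)^T *m g x + g x *m conn x A.
Proof.
move=> Ox; rewrite derive_expand; last exact: dg.
have E i : partial i g x = (christoffel g x i)^T *m g x + g x *m christoffel g x i.
  have := christoffel_metric i (comp_sym (HC Ox)) (posdef_unitmx (comp_pos (HC Ox)))
    (fun l => metric_derive_sym (d l) Ox).
  by rewrite /nabla_bilin -addrA -opprD => /eqP; rewrite subr_eq0 => /eqP.
under eq_bigr do rewrite E scalerDr.
rewrite big_split /= /conn linear_sum /= mulmx_suml mulmx_sumr; congr (_ + _).
  by apply: eq_bigr => i _; rewrite linearZ /= -scalemxAl.
by apply: eq_bigr => i _; rewrite -scalemxAr.
Qed.

Lemma conn_torsion_free x (A B : V) : O x -> conn x A *m B = conn x B *m A.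
Proof.
move=> Ox; have tf i j k := christoffel_torsion_free i j k
  (fun l => metric_derive_sym (d l) Ox).
apply/matrixP => k o; rewrite ord1 /conn !mulmx_suml !summxE.
transitivity (\sum_i \sum_j A i 0 * B j 0 * christoffel g x i k j).
  apply: eq_bigr => i _; rewrite -scalemxAl mxE mxE mulr_sumr.
  by apply: eq_bigr => j _; rewrite mulrAC mulrA mulrC mulrA.
rewrite exchange_big; apply: eq_bigr => j _; rewrite -scalemxAl mxE mxE mulr_sumr.
by apply: eq_bigr => i _; rewrite tf mulrCA [RHS]mulrCA mulrA [in RHS]mulrC mulrA.
Qed.

Definition nablaJ x A : 'M[R]_m := 'D_A J x + conn x A *m J x - J x *m conn x A.

Lemma nablaJ_expand x A : O x -> nablaJ x A = \sum_i A i 0 *: nabla_endo g J x i.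
Proof.
move=> Ox; rewrite /nablaJ derive_expand; last exact: dJ.
rewrite /conn mulmx_suml mulmx_sumr -sumrN -!big_split /=; apply: eq_bigr => i _.
by rewrite /nabla_endo !scalerDr -scalemxAl -scalemxAr scalerN.
Qed.

Lemma tens_intrinsic x A : O x ->
  tens (intrinsic_torsion g J x) A = - 2^-1 *: (J x *m nablaJ x A).
Proof.
move=> Ox; rewrite /tens nablaJ_expand// mulmx_sumr scaler_sumr.
by apply: eq_bigr => i _; rewrite ffunE scalerA mulrC -scalerA scalemxAr.
Qed.

Lemma derive_acs_sqr x A : O x -> 'D_A J x *m J x + J x *m 'D_A J x = 0.
Proof.
move=> Ox; have dJx := dJ Ox; have [_ <-] := derive_mulmx A dJx dJx.
rewrite -(derive_cst (- 1%:M : 'M[R]_m) x A); apply: near_eq_derive.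
by apply: (near_open oO Ox) => y Oy; exact: comp_sqr (HC Oy).
Qed.

Lemma nablaJ_anti x A : O x -> nablaJ x A *m J x + J x *m nablaJ x A = 0.
Proof.
move=> Ox; have := derive_acs_sqr A Ox; have JJ := comp_sqr (HC Ox).
rewrite /nablaJ !(mulmxBl, mulmxDl, mulmxBr, mulmxDr) -[conn x A *m J x *m J x]mulmxA.
rewrite [J x *m (J x *m _)]mulmxA [J x *m (_ *m J x)]mulmxA JJ mulmxN mulmx1 mulNmx mul1mx.
move: ('D_A J x *m J x) (J x *m 'D_A J x) (J x *m conn x A *m J x) (conn x A).
move=> a b c k /eqP; rewrite addr_eq0 => /eqP ->.
by apply/matrixP => i j; rewrite !mxE; ring.
Qed.

Lemma kahler_anti x : O x -> (kahler g J x)^T = - kahler g J x.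
Proof.
move=> Ox; apply: bilinP => X Y; have H := compatible_hermitian (HC Ox).
rewrite /kahler trmx_mul (comp_sym (HC Ox)) -bilin_mulmxl (herm_acsl H) bilin_mulmxr.
by rewrite bilinN.
Qed.

Lemma derive_kahler_anti x A : O x -> ('D_A (kahler g J) x)^T = - 'D_A (kahler g J) x.
Proof.
move=> Ox; have [dk _] := derive_mulmx A (dg Ox) (dJ Ox).
rewrite -(derive_trmx _ dk) -derive_oppf//; apply: near_eq_derive.
by apply: (near_open oO Ox) => y Oy; exact: kahler_anti.
Qed.

Lemma nabla_kahlerE x A : O x -> g x *m nablaJ x A =
  'D_A (kahler g J) x - (conn x A)^T *m kahler g J x - kahler g J x *m conn x A.
Proof.
move=> Ox; have [_ ->] := derive_mulmx A (dg Ox) (dJ Ox).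
rewrite derive_metric// /nablaJ /kahler !(mulmxBr, mulmxDr, mulmxDl) !mulmxA.
move: (_ *m g x *m J x) (g x *m 'D_A J x) (g x *m conn x A *m J x) (g x *m J x *m _).
by move=> a b c e; apply/matrixP => i j; rewrite !mxE; ring.
Qed.

Lemma nabla_kahler_anti x A : O x -> (g x *m nablaJ x A)^T = - (g x *m nablaJ x A).
Proof.
move=> Ox; rewrite nabla_kahlerE//.
move: (kahler_anti Ox) (derive_kahler_anti A Ox).
move: (kahler g J x) ('D_A (kahler g J) x) (conn x A) => W DW C WT DT.
rewrite !linearB /= !trmx_mul trmxK DT WT mulNmx mulmxN.
move: (C^T *m W) (W *m C) => b c.
by apply/matrixP => i j; rewrite !mxE; ring.
Qed.

Local Notation xi := (intrinsic_torsion g J).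

Lemma space_W_intrinsic x : O x -> space_W (g x) (J x) (xi x).
Proof.
move=> Ox; have H := compatible_hermitian (HC Ox).
have JJ (X : V) : J x *m (J x *m X) = - X := herm_acs_sqr H X.
have anti A (Y Z : V) : bilin (g x) (nablaJ x A *m Y) Z = - bilin (g x) Y (nablaJ x A *m Z).
  rewrite bilin_mulmxl bilin_mulmxr -[(nablaJ x A)^T *m g x]trmxK trmx_mul trmxK.
  rewrite (comp_sym (HC Ox)) nabla_kahler_anti//.
  by rewrite bilinN.
have comm A (Y : V) : nablaJ x A *m (J x *m Y) = - (J x *m (nablaJ x A *m Y)).
  have := nablaJ_anti A Ox; move/eqP; rewrite addr_eq0 => /eqP E.
  by rewrite !mulmxA E mulNmx.
apply/(space_WP (HC Ox)); rewrite /lower; split=> X Y Z; rewrite tens_intrinsic//.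
  rewrite -!scalemxAl -!mulmxA !(hermZl H) (herm_acsl H) anti (herm_sym H).
  rewrite comm (hermNl H); ring.
rewrite -!scalemxAl -!mulmxA comm mulmxN JJ opprK !(hermZl H) (herm_acs_isom H).
by [].
Qed.

(* The connection nabla + xi, which preserves both g and J. *)
Definition hconn x A : 'M[R]_m := conn x A + tens (xi x) A.

Lemma hconn_linear x a A A' : hconn x (a *: A + A') = a *: hconn x A + hconn x A'.
Proof. by rewrite /hconn conn_linear tens_linear scalerDr addrACA. Qed.

Lemma derive_metric_h x A : O x -> 'D_A g x = (hconn x A)^T *m g x + g x *m hconn x A.
Proof.
move=> Ox; rewrite derive_metric// /hconn.
have : (tens (xi x) A)^T *m g x + g x *m tens (xi x) A = 0.
  apply: bilinP => X Y; have H := compatible_hermitian (HC Ox).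
  have [sk _] := space_W_intrinsic Ox; have := sk A X Y.
  rewrite bilin_mulmxl bilin_mulmxr bilinDm => ->.
  by rewrite addNr /bilin mulmx0 mul0mx mxE.
rewrite [(_ + _)^T]linearD /= mulmxDl mulmxDr => /eqP; rewrite addr_eq0 => /eqP ->.
move: (_ *m g x) (g x *m conn x A) (g x *m _) => a b c.
by apply/matrixP => i j; rewrite !mxE; ring.
Qed.

(** One has nabla_A J = 2 J xi_A, while the commutator xi_A J - J xi_A equals - 2 J xi_A because
    xi_A anticommutes with J; so adding xi cancels the derivative of J. *)
Lemma derive_acs_h x A : O x -> 'D_A J x = J x *m hconn x A - hconn x A *m J x.
Proof.
move=> Ox; have [_ ac] := space_W_intrinsic Ox; rewrite /hconn mulmxDr mulmxDl.
have -> : 'D_A J x = nablaJ x A - conn x A *m J x + J x *m conn x A.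
  by rewrite /nablaJ; move: ('D_A J x) (_ *m J x) (J x *m _) => a b c;
     apply/matrixP => i j; rewrite !mxE; ring.
have -> : nablaJ x A = 2 *: (J x *m tens (xi x) A).
  rewrite tens_intrinsic// -scalemxAr mulmxA (comp_sqr (HC Ox)) mulNmx mul1mx.
  by move: (nablaJ x A) => N; apply/matrixP => i j; rewrite !mxE; field.
have := ac A; move/eqP; rewrite addrC addr_eq0 => /eqP ->.
move: (J x *m tens (xi x) A) (conn x A *m J x) (J x *m conn x A) => a b c.
by apply/matrixP => i j; rewrite !mxE; ring.
Qed.

Lemma hconn_torsion x (A B : V) : O x ->
  hconn x A *m B - hconn x B *m A = tens (xi x) A *m B - tens (xi x) B *m A.
Proof.
move=> Ox; rewrite /hconn !mulmxDl (conn_torsion_free A B Ox).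
by rewrite opprD addrACA subrr add0r.
Qed.

End Connection.

Section SmoothTensors.
Variables (R : realType) (k : nat).
Local Notation V := 'cV[R]_k.

Lemma smooth_on_scale p q (O : set V) (c : R) (F : V -> 'M[R]_(p, q)) : open O ->
  smooth_on O F -> smooth_on O (fun x => c *: F x).
Proof.
move=> oO /smooth_on_mxP-/(_ oO) sF; apply/smooth_on_mxP => // i j.
under eq_fun do rewrite mxE; apply: smooth_onM => //; exact: smooth_on_cst.
Qed.

Lemma smooth_on_bilin p (O : set V) (B : V -> 'M[R]_p) (P Q : V -> 'cV[R]_p) : open O ->
  smooth_on O B -> smooth_on O P -> smooth_on O Q ->
  smooth_on O (fun x => bilin (B x) (P x) (Q x)).
Proof.
move=> oO sB sP sQ; have sM : smooth_on O (fun x => (P x)^T *m B x *m Q x).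
  by do 2! [apply: smooth_on_mulmx => //]; exact: smooth_on_trmx.
exact: (smooth_on_mxP _ oO).1 sM 0 0.
Qed.

Lemma smooth_on_mulmxr p q (O : set V) (F : V -> 'M[R]_(p, q)) (X : 'cV[R]_q) :
  open O -> smooth_on O F -> smooth_on O (fun x => F x *m X).
Proof.
by move=> oO sF; apply: smooth_on_mulmx => //; exact: smooth_on_cst.
Qed.

Lemma mtrace_linear m (W : lmodType R) (G : 'M[R]_m)
    (T : 'cV[R]_m -> 'cV[R]_m -> W) (f : W -> R) :
  (forall a u v, f (a *: u + v) = a * f u + f v) ->
  f (mtrace G T) = mtrace (W := R^o) G (fun X Y => f (T X Y)).
Proof.
move=> fl; have f0 : f 0 = 0 by have := fl 1 0 0; rewrite scale1r addr0; lra.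
rewrite /mtrace; elim/big_rec2: _ => // i y z _ <-.
rewrite -[X in f (X + _)]scale1r fl mul1r; congr (_ + _).
by elim/big_rec2: _ => // j u w _ <-; exact: fl.
Qed.

Lemma smooth_on_mtrace m (O : set V) (G : V -> 'M[R]_m)
    (T : V -> 'cV[R]_m -> 'cV[R]_m -> R) : open O ->
  smooth_on O G -> (forall x, O x -> G x \in unitmx) ->
  (forall a b, smooth_on O (fun x => T x (basis_vec R a) (basis_vec R b))) ->
  smooth_on O (fun x => mtrace (W := R^o) (G x) (T x)).
Proof.
move=> oO sG uG sT; apply: smooth_on_sum => // a _; apply: smooth_on_sum => // b _.
apply: smooth_onM => //.
exact: (smooth_on_mxP _ oO).1 (smooth_on_invmx oO uG sG) a b.
Qed.

End SmoothTensors.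

(** * The Lee form and smoothness of the basic tensors *)

Section LeeForm.
Variables (R : realType) (n : nat).
Local Notation m := (2 * n)%N.
Local Notation V := 'cV[R]_m.
Local Notation d := (@basis_vec R m).
Variables (O : set V) (g J : V -> 'M[R]_m).
Hypotheses (HL : local_structure O g J) (n1 : (1 < n)%N).
Let oO := loc_open HL.
Let HC := loc_compatible HL.
Local Notation xi := (intrinsic_torsion g J).
Local Notation theta := (lee_form g J).

Lemma app_form_linear (a : 'rV[R]_m) c X Y :
  app_form a (c *: X + Y) = c * app_form a X + app_form a Y.
Proof. by rewrite /app_form mulmxDr -scalemxAr !mxE. Qed.

Lemma app_form_basis (a : 'rV[R]_m) j : app_form a (d j) = a 0 j.
Proof. by rewrite /app_form -colE mxE. Qed.

(** The lowered nabla J is nabla omega, its skew-symmetry absorbs the sign of the codifferential,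
    and the factor 2 comes from nabla J = 2 J xi. *)
Lemma codiff_kahler x Y : O x ->
  app_form (codiff g (kahler g J) x) Y = 2 * bilin (g x) (J x *m trace12 (g x) (xi x)) Y.
Proof.
move=> Ox; have H := compatible_hermitian (HC Ox).
move: Y; apply: linear_ext.
- exact: app_form_linear.
- by move=> a X X'; rewrite bilin_linear_r; ring.
move=> j; rewrite app_form_basis /codiff mxE mxE.
have fl a (u v : V) : 2 * bilin (g x) (J x *m (a *: u + v)) (d j) =
    a * (2 * bilin (g x) (J x *m u) (d j)) + 2 * bilin (g x) (J x *m v) (d j).
  by rewrite mulmxDr -scalemxAr (herm_linear H); ring.
rewrite /trace12 (mtrace_linear _ _ fl) /mtrace -sumrN; apply: eq_bigr => a _.
rewrite -sumrN; apply: eq_bigr => b _; rewrite -scalerN; congr (_ *: _).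
have E : \sum_i d a i 0 *: nabla_bilin g (kahler g J) x i = g x *m nablaJ g J x (d a).
  rewrite (nabla_kahlerE HL _ Ox); have [dk _] := derive_mulmx 0 (dg HL Ox) (dJ HL Ox).
  rewrite (derive_expand (d a) dk) /nabla_bilin.
  under eq_bigr do rewrite !scalerBr.
  rewrite !big_split /= !sumrN /conn; congr (_ - _ - _).
    rewrite linear_sum /= mulmx_suml; apply: eq_bigr => i _.
    by rewrite linearZ /= -scalemxAl.
  by rewrite mulmx_sumr; apply: eq_bigr => i _; rewrite -scalemxAr.
have JT : J x *m tens (xi x) (d a) = 2^-1 *: nablaJ g J x (d a).
  rewrite (tens_intrinsic HL)// -scalemxAr mulmxA (comp_sqr (HC Ox)) mulNmx mul1mx.
  by rewrite scalerN scaleNr opprK.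
rewrite E -bilin_trmx (nabla_kahler_anti HL)// bilinN opprK -bilin_mulmxr.
by rewrite mulmxA JT -scalemxAl (hermZl H) (herm_sym H); field.
Qed.

(** Identifies the Lee form given by the codifferential with the one carried by the W_4 component,
    the only version used from here on. *)
Lemma lee_formE x Y : O x ->
  app_form (theta x) Y = bilin (g x) (lee_vector (g x) (xi x)) Y.
Proof.
move=> Ox; have H := compatible_hermitian (HC Ox).
have n10 : n%:R - 1 != 0 :> R by rewrite subr_eq0 (eqr_nat _ n 1) gtn_eqF.
rewrite /lee_form /lee_vector (hermZl H).
have -> : app_form (- (n%:R - 1)^-1 *: form_J (J x) (codiff g (kahler g J) x)) Y =
    (n%:R - 1)^-1 * app_form (codiff g (kahler g J) x) (J x *m Y).
  by rewrite /app_form /form_J scaleNr scalerN opprK -scalemxAl mulmxA mxE.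
by rewrite codiff_kahler// (herm_acs_isom H); field.
Qed.

Let gu x : O x -> g x \in unitmx.
Proof. by move=> Ox; exact: posdef_unitmx (comp_pos (HC Ox)). Qed.

Lemma smooth_christoffel i : smooth_on O (fun x => christoffel g x i).
Proof.
apply/(smooth_on_mxP _ oO) => a b; under eq_fun do rewrite mxE.
apply: smooth_onM => //; first exact: smooth_on_cst.
have sp c : forall p q, smooth_on O (fun x => partial c g x p q).
  apply: (smooth_on_mxP _ oO).1; exact: smooth_on_derive (loc_metric HL).
apply: smooth_on_sum => // l _; apply: smooth_onM => //.
  exact: (smooth_on_mxP _ oO).1 (smooth_on_invmx oO gu (loc_metric HL)) a l.
by apply: smooth_onB => //; apply: smooth_onD.
Qed.

Lemma smooth_conn A : smooth_on O (fun x => conn g x A).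
Proof.
apply: smooth_on_sum => // i _; apply: smooth_on_scale => //; exact: smooth_christoffel.
Qed.

Lemma smooth_tens A : smooth_on O (fun x => tens (xi x) A).
Proof.
apply: smooth_on_sum => // i _; apply: smooth_on_scale => //.
under eq_fun do rewrite ffunE; apply: smooth_on_scale => //.
apply: smooth_on_mulmx => //; first exact: loc_acs HL.
have sJ := loc_acs HL; have sG := smooth_christoffel i.
apply: smooth_onD => //; first apply: smooth_onD => //.
- exact: smooth_on_derive sJ.
- exact: smooth_on_mulmx.
- under eq_fun do rewrite -scaleN1r; apply: smooth_on_scale => //; exact: smooth_on_mulmx.
Qed.

Lemma smooth_hconn A : smooth_on O (fun x => hconn g J x A).
Proof. by apply: smooth_onD => //; [exact: smooth_conn|exact: smooth_tens]. Qed.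

Lemma smooth_metric X Y : smooth_on O (fun x => bilin (g x) X Y).
Proof.
by apply: smooth_on_bilin => //; [exact: loc_metric HL|exact: smooth_on_cst|exact: smooth_on_cst].
Qed.

Lemma smooth_kahler X Y : smooth_on O (fun x => bilin (g x) X (J x *m Y)).
Proof.
apply: smooth_on_bilin => //; [exact: loc_metric HL|exact: smooth_on_cst|].
by apply: smooth_on_mulmxr => //; exact: loc_acs HL.
Qed.

Lemma smooth_lower X Y Z : smooth_on O (fun x => lower (g x) (xi x) X Y Z).
Proof.
apply: smooth_on_bilin => //; [exact: loc_metric HL| |exact: smooth_on_cst].
by apply: smooth_on_mulmxr => //; exact: smooth_tens.
Qed.

Lemma smooth_lee : smooth_on O theta.
Proof.
apply/(smooth_on_mxP _ oO) => i j; rewrite ord1.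
(* Smoothness is read off from the trace of xi, where no derivative of omega occurs explicitly. *)
apply: (@smooth_on_eq _ _ _ _ (fun x => 2 / (n%:R - 1) *
    mtrace (W := R^o) (g x) (fun X Y => lower (g x) (xi x) X Y (d j)))) => //.
  move=> x /set_mem Ox; rewrite -app_form_basis lee_formE// /lee_vector.
  have H := compatible_hermitian (HC Ox).
  rewrite (hermZl H) /trace12; congr (_ * _); apply/esym.
  by apply: (@mtrace_linear _ _ _ _ _ (fun u => bilin (g x) u (d j))) => a u v; exact: (herm_linear H).
apply: smooth_onM => //; first exact: smooth_on_cst.
by apply: smooth_on_mtrace => //; [exact: loc_metric HL|move=> a b; exact: smooth_lower].
Qed.

Lemma smooth_lee_form X : smooth_on O (fun x => app_form (theta x) X).
Proof.
have sl : smooth_on O (fun x => theta x *m X).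
  by apply: smooth_on_mulmxr => //; exact: smooth_lee.
exact: (smooth_on_mxP _ oO).1 sl 0 0.
Qed.

End LeeForm.

(** * Exterior calculus and structure equations *)

Section ExteriorCalculus.
Variables (R : realType) (m : nat).
Local Notation V := 'cV[R]_m.
Variables (O : set V) (x : V).
Hypotheses (oO : open O) (Ox : O x).

(* Differential forms are families of functions indexed by constant vectors,
   so that no bracket terms appear in the exterior derivative. *)
Definition ext1 (th : V -> V -> R) (X Y y : V) : R := 'D_X (th Y) y - 'D_Y (th X) y.

Definition ext2 (om : V -> V -> V -> R) (X Y Z y : V) : R :=
  'D_X (om Y Z) y - 'D_Y (om X Z) y + 'D_Z (om X Y) y.

Definition ext3 (psi : V -> V -> V -> V -> R) (X Y Z W y : V) : R :=
  'D_X (psi Y Z W) y - 'D_Y (psi X Z W) y + 'D_Z (psi X Y W) y - 'D_W (psi X Y Z) y.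

Definition ext4 (ph : V -> V -> V -> V -> V -> R) (X Y Z W U y : V) : R :=
  'D_X (ph Y Z W U) y - 'D_Y (ph X Z W U) y + 'D_Z (ph X Y W U) y
  - 'D_W (ph X Y Z U) y + 'D_U (ph X Y Z W) y.

Definition wedge14 (be : V -> R) (ph : V -> V -> V -> V -> R) X Y Z W U :=
  be X * ph Y Z W U - be Y * ph X Z W U + be Z * ph X Y W U - be W * ph X Y Z U
  + be U * ph X Y Z W.

Definition wedge32 (ka : V -> V -> V -> R) (om : V -> V -> R) X Y Z W U :=
  ka X Y Z * om W U - ka X Y W * om Z U + ka X Y U * om Z W + ka X Z W * om Y U
  - ka X Z U * om Y W + ka X W U * om Y Z - ka Y Z W * om X U + ka Y Z U * om X W
  - ka Y W U * om X Z + ka Z W U * om X Y.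

Let smd (f : V -> R) : smooth_on O f -> differentiable f x.
Proof. by move=> sf; exact: smooth_on_differentiable sf Ox. Qed.

Let smDd (f : V -> R) v : smooth_on O f -> differentiable ('D_v f) x.
Proof. by move=> sf; apply/smd/smooth_on_derive. Qed.

Let comm (f : V -> R) a b : smooth_on O f -> 'D_b ('D_a f) x = 'D_a ('D_b f) x.
Proof. by move=> sf; exact: smooth_on_derive_comm oO sf Ox. Qed.

Lemma derive_subf (f h : V -> R) v : differentiable f x -> differentiable h x ->
  'D_v (fun y => f y - h y) x = 'D_v f x - 'D_v h x.
Proof.
move=> df dh; have dN : differentiable (fun y => - h y) x by exact: differentiableN.
by rewrite derive_addf// derive_oppf.
Qed.

Lemma differentiable_subf (f h : V -> R) : differentiable f x -> differentiable h x ->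
  differentiable (fun y => f y - h y) x.
Proof. by move=> df dh; exact: differentiableB. Qed.

Lemma differentiable_addf (f h : V -> R) : differentiable f x -> differentiable h x ->
  differentiable (fun y => f y + h y) x.
Proof. by move=> df dh; exact: differentiableD. Qed.

Lemma ext_ext1 (th : V -> V -> R) X Y Z : (forall A, smooth_on O (th A)) ->
  ext2 (ext1 th) X Y Z x = 0.
Proof.
move=> sth; rewrite /ext2 /ext1.
do ?[rewrite derive_subf; [|by apply: smDd|by apply: smDd]].
rewrite (comm X Y (sth Z)) (comm X Z (sth Y)) (comm Y Z (sth X)).
pose a A B C := 'D_A ('D_B (th C)) x; have aE A B C : 'D_A ('D_B (th C)) x = a A B C by [].
by rewrite !aE; clearbody a; ring.
Qed.

Lemma ext_ext2 (om : V -> V -> V -> R) X Y Z W : (forall A B, smooth_on O (om A B)) ->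
  ext3 (ext2 om) X Y Z W x = 0.
Proof.
move=> som; rewrite /ext3 /ext2.
have E A B C F (f1 f2 f3 : V -> R) : smooth_on O f1 -> smooth_on O f2 -> smooth_on O f3 ->
    'D_A (fun y => 'D_B f1 y - 'D_C f2 y + 'D_F f3 y) x =
    'D_A ('D_B f1) x - 'D_A ('D_C f2) x + 'D_A ('D_F f3) x.
  move=> s1 s2 s3; rewrite derive_addf; [|apply: differentiable_subf|]; try exact: smDd.
  by rewrite derive_subf//; exact: smDd.
rewrite !E//.
rewrite (comm X Y (som Z W)) (comm X Z (som Y W)) (comm X W (som Y Z)).
rewrite (comm Y Z (som X W)) (comm Y W (som X Z)) (comm Z W (som X Y)).
pose a A B C F := 'D_A ('D_B (om C F)) x.
have aE A B C F : 'D_A ('D_B (om C F)) x = a A B C F by [].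
by rewrite !aE; clearbody a; ring.
Qed.

Lemma derive_mulf_sm (f h : V -> R) v : smooth_on O f -> smooth_on O h ->
  'D_v (fun y => f y * h y) x = 'D_v f x * h x + f x * 'D_v h x.
Proof. by move=> sf sh; rewrite derive_mulf//; exact: smd. Qed.

Let dM (f h : V -> R) : smooth_on O f -> smooth_on O h ->
  differentiable (fun y => f y * h y) x.
Proof. by move=> sf sh; apply: differentiable_mulf; exact: smd. Qed.

Lemma ext_wedge12 (th : V -> V -> R) (om : V -> V -> V -> R) X Y Z W :
  (forall A, smooth_on O (th A)) -> (forall A B, smooth_on O (om A B)) ->
  ext3 (fun X Y Z y => wedge12 (th^~ y) (fun A B => om A B y) X Y Z) X Y Z W x =
  wedge22 (fun A B => ext1 th A B x) (fun A B => om A B x) X Y Z W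
  - wedge13 (th^~ x) (fun A B C => ext2 om A B C x) X Y Z W.
Proof.
move=> sth som; rewrite /ext3 /wedge12.
have E A B C F : 'D_A (fun y => th B y * om C F y - th C y * om B F y + th F y * om B C y) x
  = 'D_A (th B) x * om C F x + th B x * 'D_A (om C F) x
    - ('D_A (th C) x * om B F x + th C x * 'D_A (om B F) x)
    + ('D_A (th F) x * om B C x + th F x * 'D_A (om B C) x).
  rewrite derive_addf; [|by apply: differentiable_subf; exact: dM|exact: dM].
  by rewrite derive_subf; [rewrite !derive_mulf_sm|exact: dM|exact: dM].
rewrite !E /wedge22 /wedge13 /ext1 /ext2.
pose a A B := 'D_A (th B) x; pose o A B C := 'D_A (om B C) x.
have aE A B : 'D_A (th B) x = a A B by []; have oE A B C : 'D_A (om B C) x = o A B C by [].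
by rewrite !aE !oE; clearbody a o; ring.
Qed.

Lemma ext_wedge13 (be : V -> V -> R) (ps : V -> V -> V -> V -> R) X Y Z W U :
  (forall A, smooth_on O (be A)) -> (forall A B C, smooth_on O (ps A B C)) ->
  ext4 (fun X Y Z W y => wedge13 (be^~ y) (fun A B C => ps A B C y) X Y Z W) X Y Z W U x =
  wedge23 (fun A B => ext1 be A B x) (fun A B C => ps A B C x) X Y Z W U
  - wedge14 (be^~ x) (fun A B C F => ext3 ps A B C F x) X Y Z W U.
Proof.
move=> sbe sps; rewrite /ext4 /wedge13.
have E A B C F G : 'D_A (fun y => be B y * ps C F G y - be C y * ps B F G y
      + be F y * ps B C G y - be G y * ps B C F y) x
  = 'D_A (be B) x * ps C F G x + be B x * 'D_A (ps C F G) x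
    - ('D_A (be C) x * ps B F G x + be C x * 'D_A (ps B F G) x)
    + ('D_A (be F) x * ps B C G x + be F x * 'D_A (ps B C G) x)
    - ('D_A (be G) x * ps B C F x + be G x * 'D_A (ps B C F) x).
  rewrite derive_subf; [|by apply: differentiable_addf; [apply: differentiable_subf|]; exact: dM|exact: dM].
  rewrite derive_addf; [|by apply: differentiable_subf; exact: dM|exact: dM].
  by rewrite derive_subf; [rewrite !derive_mulf_sm|exact: dM|exact: dM].
rewrite !E /wedge23 /wedge14 /ext1 /ext3.
pose a A B := 'D_A (be B) x; pose o A B C F := 'D_A (ps B C F) x.
have aE A B : 'D_A (be B) x = a A B by [].
have oE A B C F : 'D_A (ps B C F) x = o A B C F by [].
by rewrite !aE !oE; clearbody a o; ring.
Qed.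

Lemma ext_wedge22 (al om : V -> V -> V -> R) X Y Z W U :
  (forall A B, smooth_on O (al A B)) -> (forall A B, smooth_on O (om A B)) ->
  ext4 (fun X Y Z W y => wedge22 (fun A B => al A B y) (fun A B => om A B y) X Y Z W)
    X Y Z W U x =
  wedge32 (fun A B C => ext2 al A B C x) (fun A B => om A B x) X Y Z W U
  + wedge23 (fun A B => al A B x) (fun A B C => ext2 om A B C x) X Y Z W U.
Proof.
move=> sal som; rewrite /ext4 /wedge22.
have E A B C F G : 'D_A (fun y => al B C y * om F G y - al B F y * om C G y
      + al B G y * om C F y + al C F y * om B G y - al C G y * om B F y
      + al F G y * om B C y) x
  = 'D_A (al B C) x * om F G x + al B C x * 'D_A (om F G) x
    - ('D_A (al B F) x * om C G x + al B F x * 'D_A (om C G) x)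
    + ('D_A (al B G) x * om C F x + al B G x * 'D_A (om C F) x)
    + ('D_A (al C F) x * om B G x + al C F x * 'D_A (om B G) x)
    - ('D_A (al C G) x * om B F x + al C G x * 'D_A (om B F) x)
    + ('D_A (al F G) x * om B C x + al F G x * 'D_A (om B C) x).
  have d1 : differentiable (fun y => al B C y * om F G y - al B F y * om C G y) x.
    by apply: differentiable_subf; exact: dM.
  have d2 : differentiable (fun y => al B C y * om F G y - al B F y * om C G y
      + al B G y * om C F y) x by apply: differentiable_addf d1 _; exact: dM.
  have d3 : differentiable (fun y => al B C y * om F G y - al B F y * om C G y
      + al B G y * om C F y + al C F y * om B G y) x.
    by apply: differentiable_addf d2 _; exact: dM.
  have d4 : differentiable (fun y => al B C y * om F G y - al B F y * om C G y
      + al B G y * om C F y + al C F y * om B G y - al C G y * om B F y) x.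
    by apply: differentiable_subf d3 _; exact: dM.
  rewrite (derive_addf A d4 (dM (sal _ _) (som _ _))).
  rewrite (derive_subf A d3 (dM (sal _ _) (som _ _))).
  rewrite (derive_addf A d2 (dM (sal _ _) (som _ _))).
  rewrite (derive_addf A d1 (dM (sal _ _) (som _ _))).
  rewrite (derive_subf A (dM (sal _ _) (som _ _)) (dM (sal _ _) (som _ _))).
  by rewrite !derive_mulf_sm.
rewrite !E /wedge32 /wedge23 /ext2.
pose a A B C := 'D_A (al B C) x; pose o A B C := 'D_A (om B C) x.
have aE A B C : 'D_A (al B C) x = a A B C by [].
have oE A B C : 'D_A (om B C) x = o A B C by [].
by rewrite !aE !oE; clearbody a o; ring.
Qed.

End ExteriorCalculus.

(** * Exterior derivatives of omega and Psi *)

Section StructureEquations.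
Variables (R : realType) (n : nat).
Local Notation m := (2 * n)%N.
Local Notation V := 'cV[R]_m.
Local Notation d := (@basis_vec R m).
Variables (O : set V) (g J : V -> 'M[R]_m).
Hypotheses (HL : local_structure O g J) (n1 : (1 < n)%N).
Let oO := loc_open HL.
Let HC := loc_compatible HL.
Local Notation xi := (intrinsic_torsion g J).
Local Notation theta := (lee_form g J).
Local Notation C := (hconn g J).

Definition hmet (A B y : V) : R := bilin (g y) A B.
Definition kahf (A B y : V) : R := bilin (g y) A (J y *m B).
Definition leef (A y : V) : R := app_form (theta y) A.

Lemma derive_bilin_cst (B : V -> 'M[R]_m) x A X Y : differentiable B x ->
  'D_A (fun y => bilin (B y) X Y) x = bilin ('D_A B x) X Y.
Proof.
move=> dB; have dc (Z : V) p (M : 'M[R]_p) : differentiable (fun _ : V => M) x.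
  exact: differentiable_cst.
have [d1 D1] := derive_mulmx A (differentiable_cst (X^T) x) dB.
have [d2 D2] := derive_mulmx A d1 (differentiable_cst Y x).
rewrite /bilin -(derive_mxE A 0 0 d2) D2 D1 !derive_cst.
by rewrite mulmx0 addr0 mul0mx add0r.
Qed.

Lemma derive_hmet x A X Y : O x ->
  'D_A (hmet X Y) x = hmet (C x A *m X) Y x + hmet X (C x A *m Y) x.
Proof.
move=> Ox; rewrite (derive_bilin_cst _ _ _ (dg HL Ox)) (derive_metric_h HL)//.
by rewrite /hmet bilinDm -bilin_mulmxl -bilin_mulmxr.
Qed.

Lemma kahfE A B y : kahf A B y = bilin (kahler g J y) A B.
Proof. by rewrite /kahf bilin_mulmxr. Qed.

Lemma derive_kahf x A X Y : O x ->
  'D_A (kahf X Y) x = kahf (C x A *m X) Y x + kahf X (C x A *m Y) x.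
Proof.
move=> Ox; have [dk Dk] := derive_mulmx A (dg HL Ox) (dJ HL Ox).
rewrite (_ : kahf X Y = fun y => bilin (kahler g J y) X Y); last first.
  by apply/funext => y; exact: kahfE.
rewrite (derive_bilin_cst _ _ _ dk) Dk (derive_metric_h HL)// (derive_acs_h HL)//.
rewrite !kahfE bilin_mulmxl bilin_mulmxr -bilinDm /kahler; congr (bilin _ _ _).
rewrite mulmxDl mulmxBr !mulmxA.
move: (_ *m g x *m J x) (g x *m C x A *m J x) (g x *m J x *m C x A).
by move=> a b c; apply/matrixP => i j; rewrite !mxE; ring.
Qed.

Lemma kahf_skew x A B : O x -> kahf A B x = - kahf B A x.
Proof. by move=> Ox; exact: (herm_acsC (compatible_hermitian (HC Ox))). Qed.

(** Since nabla + xi preserves omega, d omega is the cyclic sum of omega(T(X, Y), Z) with torsion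
    T(X, Y) = xi_X Y - xi_Y X; the symmetries of xi make the two halves of T contribute equally,
    whence the 2. *)
Lemma ext2_kahf x X Y Z : O x -> let s := lower (g x) (xi x) in
  ext2 kahf X Y Z x = 2 * (s X Y (J x *m Z) + s Y Z (J x *m X) + s Z X (J x *m Y)).
Proof.
move=> Ox s; have H := compatible_hermitian (HC Ox).
have [s23 sJ] := (space_WP (HC Ox) _).1 (space_W_intrinsic HL Ox).
have T A B E : kahf (C x A *m B) E x - kahf (C x B *m A) E x =
    s A B (J x *m E) - s B A (J x *m E).
  rewrite /kahf -(hermNl H) -(hermDl H) (hconn_torsion HL)// (hermDl H) (hermNl H).
  by [].
rewrite /ext2 !derive_kahf//.
rewrite (kahf_skew Y (C x X *m Z) Ox) (kahf_skew X (C x Y *m Z) Ox).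
rewrite (kahf_skew X (C x Z *m Y) Ox).
have e A B E : s A B (J x *m E) = - s A E (J x *m B) by rewrite /s s23 sJ.
have := T X Y Z; have := T X Z Y; have := T Y Z X.
rewrite (e Y X Z) (e X Z Y) (e Z Y X); lra.
Qed.

(** Evaluates the contribution of W_4 to the formula of [ext2_kahf], with v dual to the Lee form. *)
Lemma wedge12_w4form x v X Y Z : O x ->
  let s := w4form (g x) (J x) v in
  2 * (s X Y (J x *m Z) + s Y Z (J x *m X) + s Z X (J x *m Y)) =
  wedge12 (fun A => bilin (g x) v A) (fun A B => kahf A B x) X Y Z.
Proof.
move=> Ox; have H := compatible_hermitian (HC Ox).
rewrite /= /w4form /wedge12 /kahf !(herm_acs_isom H) !(herm_acsl H).
rewrite !(herm_sym H Y X) !(herm_sym H Z X) !(herm_sym H Z Y).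
rewrite !(herm_acsC H Y X) !(herm_acsC H Z X) !(herm_acsC H Z Y).
by field.
Qed.

Let smooth_kahf A B : smooth_on O (kahf A B).
Proof. exact: smooth_kahler HL A B. Qed.
Let smooth_leef A : smooth_on O (leef A).
Proof. exact: smooth_lee_form HL n1 A. Qed.

Lemma near_derive_eq (f f' : V -> R) x A : O x -> (forall y, O y -> f y = f' y) ->
  'D_A f x = 'D_A f' x.
Proof. by move=> Ox ff'; apply: near_eq_derive; exact: (near_open oO Ox). Qed.

Lemma ext3_eq (f f' : V -> V -> V -> V -> R) x X Y Z W : O x ->
  (forall y, O y -> forall A B E, f A B E y = f' A B E y) ->
  ext3 f X Y Z W x = ext3 f' X Y Z W x.
Proof.
move=> Ox ff'; rewrite /ext3 (near_derive_eq X Ox (fun y Oy => ff' y Oy Y Z W)).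
rewrite (near_derive_eq Y Ox (fun y Oy => ff' y Oy X Z W)).
rewrite (near_derive_eq Z Ox (fun y Oy => ff' y Oy X Y W)).
by rewrite (near_derive_eq W Ox (fun y Oy => ff' y Oy X Y Z)).
Qed.

Definition leed (A B x : V) : R := bilin (ext_deriv1 theta x) A B.

Lemma leedE A B x : O x -> leed A B x = ext1 leef A B x.
Proof.
move=> Ox; have dt := smooth_on_differentiable (smooth_lee HL n1) Ox.
have D1 (X Y : V) : 'D_X (leef Y) x = \sum_i \sum_j X i 0 * partial i theta x 0 j * Y j 0.
  have [d1 D1] := derive_mulmx X dt (differentiable_cst Y x).
  rewrite /leef /app_form -(derive_mxE X 0 0 d1) D1 derive_cst mulmx0 addr0.
  rewrite (derive_expand X dt) mulmx_suml summxE; apply: eq_bigr => i _.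
  rewrite -scalemxAl mxE mxE mulr_sumr; apply: eq_bigr => j _; exact: mulrA.
rewrite /ext1 !D1 /leed bilinE exchange_big [X in _ - X]exchange_big -sumrB /=.
rewrite exchange_big; apply: eq_bigr => i _; rewrite -sumrB; apply: eq_bigr => j _.
by rewrite !mxE; ring.
Qed.

Lemma leed_linear x a A A' B : leed (a *: A + A') B x = a * leed A B x + leed A' B x.
Proof. exact: bilin_linear_l. Qed.

Lemma leed_skew x A B : leed A B x = - leed B A x.
Proof.
rewrite /leed -bilin_trmx -bilinN; congr (bilin _ _ _).
by apply/matrixP => i j; rewrite !mxE; ring.
Qed.

Lemma leed_eq0 x : (forall A B, leed A B x = 0) -> ext_deriv1 theta x = 0.
Proof. by move=> l0; apply/matrixP => i j; rewrite -bilin_basis [RHS]mxE; exact: l0. Qed.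

Lemma smooth_leed A B : smooth_on O (leed A B).
Proof.
apply: (@smooth_on_eq _ _ _ _ (ext1 leef A B)) => //.
  by move=> x /set_mem Ox; rewrite leedE.
by apply: smooth_onB => //; exact: smooth_on_derive.
Qed.

(** * Type W_2 + W_4 *)

Section TypeW2W4.
Hypothesis H24 : forall x, O x ->
  torsion_component g J 1 x = 0 /\ torsion_component g J 3 x = 0.

(** The cyclic sum in [ext2_kahf] is the one whose vanishing defines W_2. *)
Lemma ext2_kahf24 x X Y Z : O x ->
  ext2 kahf X Y Z x = wedge12 (leef^~ x) (fun A B => kahf A B x) X Y Z.
Proof.
move=> Ox; have [c1 c3] := H24 Ox; have Wx := space_W_intrinsic HL Ox.
have [Wa xiE] := gh_componentP (HC Ox) n1 Wx.
have sE A B E : lower (g x) (xi x) A B E = lower (g x) (torsion_component g J 2 x) A B E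
    + w4form (g x) (J x) (lee_vector (g x) (xi x)) A B E.
  rewrite {1}xiE (lower_sum (HC Ox)) sum_1_4 -/(torsion_component g J 1 x).
  rewrite -/(torsion_component g J 3 x) c1 c3 (lower_component4 (HC Ox))//.
  by rewrite /lower !tens0 !mul0mx !(herm0l (compatible_hermitian (HC Ox))) !add0r.
have [_ cyc] := (space_W2P _ _ _).1 (Wa 2%N).
rewrite ext2_kahf// !sE.
have := cyc X Y Z; have := wedge12_w4form (lee_vector (g x) (xi x)) X Y Z Ox.
rewrite /= /wedge12 -!(lee_formE HL n1)// /leef /torsion_component; lra.
Qed.

Lemma lee_closed24 x : (2 < n)%N -> O x -> ext_deriv1 theta x = 0.
Proof.
move=> n2 Ox; apply: leed_eq0; have [e [oe eE e1]] := exists_frame (HC Ox).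
apply: (wedge22_kahler_inj (compatible_hermitian (HC Ox)) eE e1 (@leed_linear x)
  (@leed_skew x) erefl n2) => X Y Z.
have := ext_ext2 oO Ox X (J x *m X) Y Z smooth_kahf.
rewrite (ext3_eq _ _ _ _ Ox (fun y Oy A B E => ext2_kahf24 A B E Oy)).
rewrite (ext_wedge12 Ox _ _ _ _ smooth_leef smooth_kahf) => E0.
transitivity (wedge22 (fun A B => ext1 leef A B x) (fun A B => kahf A B x)
    X (J x *m X) Y Z).
  by rewrite /wedge22 -!/(leed _ _ x) !leedE.
(* This is theta /\ d omega with d omega = theta /\ omega, so theta occurs twice. *)
have : wedge13 (leef^~ x) (fun A B E => ext2 kahf A B E x) X (J x *m X) Y Z = 0.
  by rewrite /wedge13 !ext2_kahf24// /wedge12; ring.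
lra.
Qed.

End TypeW2W4.

(** * Type W_1 + W_4 *)

Section TypeW1W4.
Hypothesis H14 : forall x, O x ->
  torsion_component g J 2 x = 0 /\ torsion_component g J 3 x = 0.

Definition tform (A B E x : V) : R := lower (g x) (torsion_component g J 1 x) A B E.
Local Notation leev x := (lee_vector (g x) (xi x)).

Lemma lower14 x A B E : O x ->
  lower (g x) (xi x) A B E = tform A B E x + w4form (g x) (J x) (leev x) A B E.
Proof.
move=> Ox; have [c2 c3] := H14 Ox; have Wx := space_W_intrinsic HL Ox.
have [Wa xiE] := gh_componentP (HC Ox) n1 Wx.
rewrite {1}xiE (lower_sum (HC Ox)) sum_1_4 -/(torsion_component g J 1 x).
rewrite -/(torsion_component g J 2 x).
rewrite -/(torsion_component g J 3 x) c2 c3 (lower_component4 (HC Ox))//.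
by rewrite /lower !tens0 !mul0mx !(herm0l (compatible_hermitian (HC Ox))) !add0r.
Qed.

Lemma form30_tform x : O x -> form30 (mulmx (J x)) (fun A B E => tform A B E x).
Proof.
move=> Ox; have Wx := space_W_intrinsic HL Ox.
have [Wa _] := gh_componentP (HC Ox) n1 Wx; have W1 := Wa 1%N.
have [s23 sJ] := (space_WP (HC Ox) _).1 ((space_W1P (HC Ox) _).1 W1).1.
have s12 A B E : tform A B E x = - tform B A E x by exact: (lower_W1_skew (HC Ox)).
split; first split.
- by move=> a A A' B E; exact: (lower_linear1 (HC Ox)).
- exact: s12.
- exact: s23.
- move=> A B E; rewrite s12 [tform B _ _ _]s23 opprK.
  by rewrite -[LHS]sJ [LHS]s23 [RHS]sJ; rewrite -[RHS]/(tform A B _ x) s12.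
Qed.

(** For a form of type (3,0) + (0,3) the three cyclic terms coincide, hence the coefficient 2 times
    3. *)
Lemma ext2_kahf14 x X Y Z : O x -> ext2 kahf X Y Z x =
  wedge12 (leef^~ x) (fun A B => kahf A B x) X Y Z + 6 * tform (J x *m X) Y Z x.
Proof.
move=> Ox; have Ft := form30_tform Ox.
rewrite ext2_kahf// !lower14//.
have := wedge12_w4form (leev x) X Y Z Ox.
have -> : tform X Y (J x *m Z) x = tform (J x *m X) Y Z x := form30_acs3 X Y Z Ft.
have -> : tform Y Z (J x *m X) x = tform (J x *m X) Y Z x.
  by rewrite (skew3_swap23 Ft) (skew3_swap12 Ft) opprK.
have -> : tform Z X (J x *m Y) x = tform (J x *m X) Y Z x.
  rewrite (skew3_swap12 Ft) (form30_acs3 X Z Y Ft) (skew3_swap23 Ft).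
  by rewrite opprK.
rewrite /= /wedge12 -!(lee_formE HL n1)// /leef; lra.
Qed.

(** The component is defined through a choice, so smoothness is obtained from xi minus its explicit
    W_4 part. *)
Lemma smooth_tform A B E : smooth_on O (tform A B E).
Proof.
have sh X Y := smooth_metric HL X Y; have sk X Y := smooth_kahler HL X Y.
have sl X := smooth_leef X.
have slJ X : smooth_on O (fun y => leef (J y *m X) y).
  have s1 : smooth_on O (fun x => theta x *m (J x *m X)).
    apply: smooth_on_mulmx => //; first exact: smooth_lee HL n1.
    by apply: smooth_on_mulmxr => //; exact: loc_acs HL.
  exact: (smooth_on_mxP _ oO).1 s1 0 0.
apply: (@smooth_on_eq _ _ _ _ (fun y => lower (g y) (xi y) A B E
  - 4^-1 * (bilin (g y) A B * leef E y - leef B y * bilin (g y) A E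
    - bilin (g y) A (J y *m B) * leef (J y *m E) y
    + leef (J y *m B) y * bilin (g y) A (J y *m E)))) => //.
  move=> y /set_mem Oy; have H := compatible_hermitian (HC Oy).
  rewrite lower14// /w4form /leef !(lee_formE HL n1)// !(herm_acsl H); ring.
apply: smooth_onB => //; first exact: smooth_lower.
apply: smooth_onM => //; first exact: smooth_on_cst.
apply: smooth_onD => //; last by apply: smooth_onM.
by apply: smooth_onB => //; [apply: smooth_onB => //|]; apply: smooth_onM.
Qed.

Let smooth_wlk A B E :
  smooth_on O (fun y => wedge12 (leef^~ y) (fun A B => kahf A B y) A B E).
Proof.
by apply: smooth_onD => //; [apply: smooth_onB => //|]; apply: smooth_onM.
Qed.

(* The part of type (3,0) + (0,3) of the exterior derivative of the Kahler form. *)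
Definition psif (A B E x : V) : R := 6 * tform (J x *m A) B E x.

Lemma smooth_psif A B E : smooth_on O (psif A B E).
Proof.
apply: (@smooth_on_eq _ _ _ _ (fun y => ext2 kahf A B E y
  - wedge12 (leef^~ y) (fun A B => kahf A B y) A B E)) => //.
  by move=> y /set_mem Oy; rewrite ext2_kahf14// /psif; ring.
apply: smooth_onB => //.
apply: smooth_onD => //; last exact: smooth_on_derive.
by apply: smooth_onB => //; exact: smooth_on_derive.
Qed.

Lemma ext3_psif x X Y Z W : O x -> ext3 psif X Y Z W x =
  wedge13 (leef^~ x) (fun A B E => psif A B E x) X Y Z W
  - wedge22 (fun A B => leed A B x) (fun A B => kahf A B x) X Y Z W.
Proof.
move=> Ox; have E0 := ext_ext2 oO Ox X Y Z W smooth_kahf.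
pose wk X Y Z y := wedge12 (leef^~ y) (fun A B => kahf A B y) X Y Z + psif X Y Z y.
have Ew : ext3 (ext2 kahf) X Y Z W x = ext3 wk X Y Z W x.
  by apply: ext3_eq => // y Oy A B E; exact: ext2_kahf14.
have sm f : smooth_on O f -> differentiable (f : V -> R) x.
  by move=> sf; exact: smooth_on_differentiable sf Ox.
have Es : ext3 wk X Y Z W x =
    ext3 (fun X Y Z y => wedge12 (leef^~ y) (fun A B => kahf A B y) X Y Z) X Y Z W x
    + ext3 psif X Y Z W x.
  pose w A B E y := wedge12 (leef^~ y) (fun A B => kahf A B y) A B E.
  have E A B F G : 'D_A (wk B F G) x = 'D_A (w B F G) x + 'D_A (psif B F G) x.
    by apply: derive_addf; apply: sm; [exact: smooth_wlk|exact: smooth_psif].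
  rewrite /ext3 !E -!/(w _ _ _).
  move: ('D_X _ x) ('D_X _ x) ('D_Y _ x) ('D_Y _ x) => a1 a2 b1 b2.
  move: ('D_Z _ x) ('D_Z _ x) ('D_W _ x) ('D_W _ x) => c1 c2 e1 e2.
  by ring.
move: E0; rewrite Ew Es (ext_wedge12 Ox _ _ _ _ smooth_leef smooth_kahf).
rewrite /wedge22 -!leedE// /wedge13 !ext2_kahf14// /wedge12 -!/(psif _ _ _ x).
move: (ext3 psif X Y Z W x) => e.
pose l A := leef A x; have lE A : leef A x = l A by [].
pose k A B := kahf A B x; have kE A B : kahf A B x = k A B by [].
pose p A B E := psif A B E x; have pE A B E : psif A B E x = p A B E by [].
pose q A B := leed A B x; have qE A B : leed A B x = q A B by [].
rewrite !lE !kE !pE !qE; clearbody l k p q; lra.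
Qed.

Lemma tform_linear1 y a A A' B E :
  tform (a *: A + A') B E y = a * tform A B E y + tform A' B E y.
Proof. by rewrite /tform /lower tens_linear mulmxDl -scalemxAl bilin_linear_l. Qed.

Lemma tform_linear2 y a A B B' E :
  tform A (a *: B + B') E y = a * tform A B E y + tform A B' E y.
Proof. by rewrite /tform /lower mulmxDr -scalemxAr bilin_linear_l. Qed.

Lemma derive_moving (F : V -> V -> R) (W : V -> V) x A : O x ->
  (forall y a X X', F y (a *: X + X') = a * F y X + F y X') ->
  (forall X, smooth_on O (F^~ X)) -> smooth_on O W ->
  'D_A (fun y => F y (W y)) x = 'D_A (F^~ (W x)) x + F x ('D_A W x).
Proof.
move=> Ox Fl sF sW; have dW := smooth_on_differentiable sW Ox.
by have [_ ->] := derive_contract A Fl (fun X => smooth_on_differentiable (sF X) Ox) dW.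
Qed.

Lemma smooth_acs_app (X : V) : smooth_on O (fun y => J y *m X).
Proof. by apply: smooth_on_mulmxr => //; exact: loc_acs HL. Qed.

Lemma derive_acs_app x (A X : V) : O x ->
  'D_A (fun y => J y *m X) x = J x *m (C x A *m X) - C x A *m (J x *m X).
Proof.
move=> Ox; have [_ ->] := derive_mulmx A (dJ HL Ox) (differentiable_cst X x).
by rewrite derive_cst mulmx0 addr0 (derive_acs_h HL)// mulmxBl !mulmxA.
Qed.

(** Covariant derivative of the lowered xi_(1) for nabla + xi, evaluated on constant vectors. *)
Definition Dtform x A B E F := 'D_A (tform B E F) x - tform (C x A *m B) E F x
  - tform B (C x A *m E) F x - tform B E (C x A *m F) x.

Lemma derive_lin2 (f h : V -> R) a x A : O x -> smooth_on O f -> smooth_on O h ->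
  'D_A (fun y => a * f y + h y) x = a * 'D_A f x + 'D_A h x.
Proof.
move=> Ox sf sh; have df := smooth_on_differentiable sf Ox.
have dh := smooth_on_differentiable sh Ox; have dc := differentiable_cst a x.
rewrite derive_addf; [|exact: differentiable_mulf|by []].
by rewrite derive_mulf// derive_cst mul0r add0r.
Qed.

Lemma derive_opp_sm (f : V -> R) x A : O x -> smooth_on O f ->
  'D_A (fun y => - f y) x = - 'D_A f x.
Proof. by move=> Ox sf; rewrite derive_oppf//; exact: smooth_on_differentiable sf Ox. Qed.

Lemma derive_tform_acs1 x A B E F : O x -> 'D_A (fun y => tform (J y *m B) E F y) x =
  'D_A (tform (J x *m B) E F) x + tform (J x *m (C x A *m B)) E F x
  - tform (C x A *m (J x *m B)) E F x.
Proof.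
move=> Ox; apply: etrans.
  apply: (@derive_moving (fun y X => tform X E F y) (fun y => J y *m B) x A Ox).
  - by move=> y a X X'; exact: tform_linear1.
  - by move=> X; exact: smooth_tform.
  - exact: smooth_acs_app.
rewrite derive_acs_app// -addrA; congr (_ + _) => /=.
by rewrite -[- (_ *m _)]scaleN1r [_ + _ *: _]addrC tform_linear1; ring.
Qed.

Lemma derive_tform_acs2 x A B E F : O x -> 'D_A (fun y => tform B (J y *m E) F y) x =
  'D_A (tform B (J x *m E) F) x + tform B (J x *m (C x A *m E)) F x
  - tform B (C x A *m (J x *m E)) F x.
Proof.
move=> Ox; apply: etrans.
  apply: (@derive_moving (fun y X => tform B X F y) (fun y => J y *m E) x A Ox).
  - by move=> y a X X'; exact: tform_linear2.
  - by move=> X; exact: smooth_tform.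
  - exact: smooth_acs_app.
rewrite derive_acs_app// -addrA; congr (_ + _) => /=.
by rewrite -[- (_ *m _)]scaleN1r [_ + _ *: _]addrC tform_linear2; ring.
Qed.

(** The connection preserves J, so differentiating the identities that define the type reproduces
    them for the derivative. *)
Lemma form30_Dtform x A : O x -> form30 (mulmx (J x)) (Dtform x A).
Proof.
move=> Ox; have Ft := form30_tform Ox; have t1 := skew3_linear Ft.
have t2 := skew3_linear2 Ft; have t3 := skew3_linear3 Ft.
split; first split.
- move=> a B B' E F; rewrite /Dtform.
  have -> : 'D_A (tform (a *: B + B') E F) x =
      a * 'D_A (tform B E F) x + 'D_A (tform B' E F) x.
    rewrite -derive_lin2//; [|exact: smooth_tform|exact: smooth_tform].
    by apply: near_derive_eq => // y _; exact: tform_linear1.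
  by rewrite mulmxDr -scalemxAr !t1; ring.
- move=> B E F; rewrite /Dtform.
  have -> : 'D_A (tform B E F) x = - 'D_A (tform E B F) x.
    rewrite -derive_opp_sm//; last exact: smooth_tform.
    by apply: near_derive_eq => // y Oy; exact: (skew3_swap12 (form30_tform Oy)).
  rewrite (skew3_swap12 Ft (C x A *m B)) (skew3_swap12 Ft B) (skew3_swap12 Ft B E).
  by ring.
- move=> B E F; rewrite /Dtform.
  have -> : 'D_A (tform B E F) x = - 'D_A (tform B F E) x.
    rewrite -derive_opp_sm//; last exact: smooth_tform.
    by apply: near_derive_eq => // y Oy; exact: (skew3_swap23 (form30_tform Oy)).
  rewrite (skew3_swap23 Ft (C x A *m B)) (skew3_swap23 Ft B (C x A *m E)).
  by rewrite (skew3_swap23 Ft B E); ring.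
- move=> B E F; rewrite /Dtform.
  have := near_derive_eq A Ox (fun y Oy => form30_acs (form30_tform Oy) B E F).
  rewrite derive_tform_acs1// derive_tform_acs2//.
  have a1 := form30_acs Ft (C x A *m B) E F; have a2 := form30_acs Ft B (C x A *m E) F.
  have a3 := form30_acs Ft B E (C x A *m F).
  move: a1 a2 a3 => /= -> a2 -> E'; rewrite a2; lra.
Qed.

End TypeW1W4.
End StructureEquations.

(** * The part of type (1,1) of the derivative of the Lee form *)

Section TorsionStructure.
Variables (R : realType) (n : nat).
Local Notation m := (2 * n)%N.
Local Notation V := 'cV[R]_m.
Local Notation d := (@basis_vec R m).
Variables (O : set V) (g J : V -> 'M[R]_m).
Hypotheses (HL : local_structure O g J) (n1 : (1 < n)%N).
Hypothesis H14 : forall x, O x ->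
  torsion_component g J 2 x = 0 /\ torsion_component g J 3 x = 0.
Let oO := loc_open HL.
Let HC := loc_compatible HL.
Local Notation xi := (intrinsic_torsion g J).
Local Notation theta := (lee_form g J).
Local Notation C := (hconn g J).
Local Notation leev x := (lee_vector (g x) (xi x)).
Local Notation tform := (tform g J).
Local Notation leef := (leef g J).
Local Notation leed := (leed g J).
Local Notation kahf := (kahf g J).
Local Notation psif := (psif g J).
Local Notation Dt := (Dtform g J).

Definition skew_torsion (x A B : V) : V := tens (torsion_component g J 1 x) A *m B.
Local Notation tau := skew_torsion.
Local Notation T x := (torsion14 (bilin (g x)) (mulmx (J x)) (tau x) (leev x)).

Lemma leef_metric x A : O x -> leef A x = bilin (g x) (leev x) A.
Proof. exact: lee_formE HL n1 x A. Qed.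

Lemma hconn_torsion14 x A B : O x -> C x A *m B - C x B *m A = T x A B.
Proof.
move=> Ox; have H := compatible_hermitian (HC Ox); have Ft := form30_tform HL n1 Ox.
apply: (herm_inj (HC Ox)) => Z.
rewrite (@herm_torsion14 _ _ _ _ H (tau x) (leev x) (fun A B E => tform A B E x))//.
rewrite (hconn_torsion HL)// (hermDl H) (hermNl H) -!/(lower _ _ _ _ _).
rewrite !(lower14 HL n1 H14)// (skew3_swap12 Ft B A) /w4form.
rewrite !(herm_acsl H) (herm_sym H B A) (herm_acsC H B A).
by field.
Qed.

Lemma derive_psif x A X Y Z : O x -> 'D_A (psif X Y Z) x =
  6 * (Dt x A (J x *m X) Y Z + tform (J x *m (C x A *m X)) Y Z x
    - tform (J x *m (C x A *m Y)) X Z x + tform (J x *m (C x A *m Z)) X Y x).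
Proof.
move=> Ox; have H := compatible_hermitian (HC Ox).
have Fu := form30_twist H (form30_tform HL n1 Ox).
have s1 := smooth_tform HL n1 H14; have s2 := smooth_psif HL n1 H14 X Y Z.
have E : 'D_A (psif X Y Z) x = 6 * 'D_A (fun y => tform (J y *m X) Y Z y) x.
  have dt : differentiable (fun y => tform (J y *m X) Y Z y) x.
    have -> : (fun y => tform (J y *m X) Y Z y) = fun y => 6^-1 * psif X Y Z y.
      apply/funext => y; rewrite /psif mulrA mulVf ?mul1r//; exact: lt0r_neq0.
    apply: differentiable_mulf; first exact: differentiable_cst.
    exact: smooth_on_differentiable s2 Ox.
  have /= -> := derive_mulf A (differentiable_cst (6 : R) x) dt.
  by rewrite derive_cst mul0r add0r.
rewrite E (derive_tform_acs1 HL n1 H14)// /Dtform.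
have -> : tform (J x *m (C x A *m Y)) X Z x = - tform (J x *m X) (C x A *m Y) Z x.
  by rewrite (skew3_swap12 Fu).
have -> : tform (J x *m (C x A *m Z)) X Y x = tform (J x *m X) Y (C x A *m Z) x.
  by rewrite (skew3_swap12 Fu) (skew3_swap23 Fu) opprK.
move: ('D_A _ x) => e; ring.
Qed.

(** On constant vectors there are no brackets, so the connection terms pair up into C_A B - C_B A,
    which is the torsion. *)
Lemma ext3_psif_dform3 x X Y Z W : O x -> ext3 psif X Y Z W x =
  6 * dform3 (fun A X Y Z => Dt x A (J x *m X) Y Z) (T x)
    (fun X Y Z => tform (J x *m X) Y Z x) X Y Z W.
Proof.
move=> Ox; have H := compatible_hermitian (HC Ox).
have Fu := form30_twist H (form30_tform HL n1 Ox).
pose u A B E := tform (J x *m A) B E x.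
have uT A B E F : u (T x A B) E F = u (C x A *m B) E F - u (C x B *m A) E F.
  by rewrite -hconn_torsion14// [LHS](skew3Dl Fu) (skew3Nl Fu).
rewrite /ext3 !derive_psif// /dform3 -!/(u _ _ _) !uT; ring.
Qed.

Lemma ext3_psif_type22 x X Y Z : O x ->
  ext3 psif X (J x *m X) Y Z x + ext3 psif X (J x *m X) (J x *m Y) (J x *m Z) x = 0.
Proof.
move=> Ox; have H := compatible_hermitian (HC Ox).
rewrite !ext3_psif_dform3// -mulrDr.
have FD A := form30_twist H (form30_Dtform HL n1 H14 A Ox).
have tE A B E : bilin (g x) (tau x A B) E = tform A B E x by [].
by rewrite (dform3_type22 H _ (form30_tform HL n1 Ox) tE FD) mulr0.
Qed.

Lemma form30_psif x : O x -> form30 (mulmx (J x)) (fun A B E => psif A B E x).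
Proof.
move=> Ox; have H := compatible_hermitian (HC Ox).
have Fu := form30_twist H (form30_tform HL n1 Ox); rewrite /psif.
split; first split.
- by move=> a A A' B E; rewrite (skew3_linear Fu); ring.
- by move=> A B E; rewrite (skew3_swap12 Fu); ring.
- by move=> A B E; rewrite (skew3_swap23 Fu); ring.
- by move=> A B E; rewrite (form30_acs Fu).
Qed.

Lemma leed_acs14 x A B : (2 < n)%N -> O x -> leed A B x + leed (J x *m A) (J x *m B) x = 0.
Proof.
move=> n2 Ox; have H := compatible_hermitian (HC Ox).
have [e [oe eE e1]] := exists_frame (HC Ox).
(* Twice the (1,1)-part of d theta. Adding the values of d theta /\ omega at (X, JX, Y, Z) and (X,
   JX, JY, JZ) replaces d theta by [al], while d Psi and theta /\ Psi have no part of type (2,2) and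
   contribute nothing. *)
pose al A B := leed A B x + leed (J x *m A) (J x *m B) x.
have ll := @leed_linear _ _ g J x; have ls := @leed_skew _ _ g J x.
have a1 a A1 A2 B' : al (a *: A1 + A2) B' = a * al A1 B' + al A2 B'.
  by rewrite /al (herm_acs_linear H) !ll; ring.
have a2 A' B' : al A' B' = - al B' A' by rewrite /al !(ls A') (ls (J x *m A')); ring.
apply: (@wedge22_kahler_inj _ _ _ _ H _ _ eE e1 al a1 a2 n erefl n2) => X Y Z.
have E1 := ext3_psif HL n1 H14 X (J x *m X) Y Z Ox.
have E2 := ext3_psif HL n1 H14 X (J x *m X) (J x *m Y) (J x *m Z) Ox.
have E3 := ext3_psif_type22 X Y Z Ox.
have Fp := form30_psif Ox.
have lN A' B' : leed (- A') B' x = - leed A' B' x.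
  have := ll (- 1) A' 0 B'; have := ll 1 0 0 B'; rewrite scale1r addr0 scaleN1r addr0; lra.
have W : wedge13 (leef^~ x) (fun A B E => psif A B E x) X (J x *m X) Y Z
    + wedge13 (leef^~ x) (fun A B E => psif A B E x) X (J x *m X) (J x *m Y) (J x *m Z) = 0.
  rewrite /wedge13 /=.
  have p1 A' B' E : psif A' (J x *m B') E x = psif (J x *m A') B' E x.
    by rewrite [RHS](form30_acs Fp).
  have p2 A' B' E : psif A' B' (J x *m E) x = psif (J x *m A') B' E x.
    exact: form30_acs3 A' B' E Fp.
  have p3 A' E : psif (J x *m A') A' E x = 0 by exact: (form30_acs12 A' E Fp).
  have p4 A' B' E : psif (J x *m (J x *m A')) B' E x = - psif A' B' E x.
    exact: (form30_acs_sqr H A' B' E Fp).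
  have p5 A' E : psif A' A' E x = 0 by exact: (skew3_12 Fp).
  by rewrite !(p1, p2, p4, p3, p5); ring.
have al2 : wedge22 al (fun A B => bilin (g x) A (J x *m B)) X (J x *m X) Y Z =
  wedge22 (fun A B => leed A B x) (fun A B => kahf A B x) X (J x *m X) Y Z
  + wedge22 (fun A B => leed A B x) (fun A B => kahf A B x)
      X (J x *m X) (J x *m Y) (J x *m Z).
  rewrite /wedge22 /kahf /al !(herm_acs_sqr H) !(hermNr H) !(herm_acs_isom H).
  rewrite ?(ls _ (- _)) ?lN ?(herm_acsl H).
  rewrite ?(ls (J x *m X) X); ring.
rewrite al2; lra.
Qed.

Lemma lambda11_0_lee14 x : (2 < n)%N -> O x ->
  lambda11_0 g J x (ext_deriv1 theta x) = 0.
Proof.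
move=> n2 Ox; have H := compatible_hermitian (HC Ox).
have aJ A B : leed A B x + leed (J x *m A) (J x *m B) x = 0 by exact: leed_acs14.
have ll := @leed_linear _ _ g J x; have ls := @leed_skew _ _ g J x.
have lr a A B B' : leed A (a *: B + B') x = a * leed A B x + leed A B' x.
  by rewrite !(ls A) ll; ring.
(* A form that changes sign under J in both slots is orthogonal to omega, so the trace term of
   [lambda11_0] vanishes as well. *)
have l0 A : leed A (J x *m A) x = 0.
  have := aJ A (J x *m A); rewrite (herm_acs_sqr H) -scaleN1r -[-1 *: A]addr0 lr.
  have := lr 1 (J x *m A) 0 0; rewrite (ls (J x *m A) A) scale1r addr0; lra.
have [e [oe eE e1]] := exists_frame (HC Ox).
rewrite /lambda11_0.
have -> : form2_inner (g x) (ext_deriv1 theta x) (kahler g J x) = 0.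
  rewrite /form2_inner -(mtrace_frame _ _ oe).
  - rewrite big1 ?mulr0// => i _; rewrite -(mtrace_frame _ _ oe).
    + transitivity (- \sum_j bilin (g x) (J x *m e i) (e j) * leed (e i) (e j) x).
        rewrite -sumrN; apply: eq_bigr => j _.
        by rewrite -kahfE /kahf (herm_acsl H) mulNr opprK mulrC.
      by rewrite (frame_expand eE (f := fun B => leed (e i) B x)) ?l0 ?oppr0.
    + by move=> Y a A A' /=; rewrite bilin_linear_r mulrDl scalerA.
    + by move=> A a B B' /=; rewrite bilin_linear_r mulrDr mulrCA.
  - move=> Y a A A' /=; rewrite /mtrace scaler_sumr -big_split; apply: eq_bigr => i _ /=.
    rewrite scaler_sumr -big_split; apply: eq_bigr => j _ /=.
    by rewrite bilin_linear_l /GRing.scale /=; ring.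
  - move=> A a B B' /=; rewrite /mtrace scaler_sumr -big_split; apply: eq_bigr => i _ /=.
    rewrite scaler_sumr -big_split; apply: eq_bigr => j _ /=.
    by rewrite bilin_linear_l /GRing.scale /=; ring.
rewrite mulr0 scale0r subr0.
have -> : ext_deriv1 theta x + (J x)^T *m ext_deriv1 theta x *m J x = 0; last exact: scaler0.
by apply: bilinP => A B; rewrite bilinDm -bilin_mulmx [LHS]aJ /bilin mulmx0 mul0mx mxE.
Qed.

End TorsionStructure.

(** * The first Bianchi identity *)

Lemma derive_mulmx_cst (R : realType) k p q r (F : 'cV[R]_k -> 'M[R]_(p, q))
    (N : 'M[R]_(q, r)) x v : differentiable F x ->
  differentiable (fun y => F y *m N) x /\ 'D_v (fun y => F y *m N) x = 'D_v F x *m N.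
Proof.
move=> dF; have [d1 D1] := derive_mulmx v dF (differentiable_cst N x).
by split=> //; rewrite D1 derive_cst mulmx0 addr0.
Qed.

Lemma derive_mulmx_sub (R : realType) k p q r (F G : 'cV[R]_k -> 'M[R]_(p, q))
    (N P : 'M[R]_(q, r)) x v : differentiable F x -> differentiable G x ->
  'D_v (fun y => F y *m N - G y *m P) x = 'D_v F x *m N - 'D_v G x *m P.
Proof.
move=> dF dG; have [d1 D1] := derive_mulmx_cst N v dF.
have [d2 D2] := derive_mulmx_cst P v dG; rewrite -D1 -D2.
by rewrite -derive_oppf// -derive_addf//; exact: differentiableN.
Qed.

Section BianchiIdentity.
Variables (R : realType) (n : nat).
Local Notation m := (2 * n)%N.
Local Notation V := 'cV[R]_m.
Local Notation d := (@basis_vec R m).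
Variables (O : set V) (g J : V -> 'M[R]_m).
Hypotheses (HL : local_structure O g J) (n1 : (1 < n)%N).
Hypothesis H14 : forall x, O x ->
  torsion_component g J 2 x = 0 /\ torsion_component g J 3 x = 0.
Let oO := loc_open HL.
Let HC := loc_compatible HL.
Local Notation xi := (intrinsic_torsion g J).
Local Notation theta := (lee_form g J).
Local Notation C := (hconn g J).
Local Notation leev x := (lee_vector (g x) (xi x)).
Local Notation tform := (tform g J).
Local Notation leef := (leef g J).
Local Notation leed := (leed g J).
Local Notation kahf := (kahf g J).
Local Notation psif := (psif g J).
Local Notation Dt := (Dtform g J).

Local Notation tau := (skew_torsion g J).
Local Notation T x := (torsion14 (bilin (g x)) (mulmx (J x)) (tau x) (leev x)).

(** Curvature endomorphism of nabla + xi; the directions are constant, hence no bracket term. *)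
Definition hcurv (x A B : V) : 'M[R]_m := 'D_A (fun y => C y B) x - 'D_B (fun y => C y A) x
  + C x A *m C x B - C x B *m C x A.

Let sC A : smooth_on O (fun y => C y A). Proof. exact: smooth_hconn. Qed.
Let dC x A : O x -> differentiable (fun y => C y A) x.
Proof. by move=> Ox; exact: smooth_on_differentiable (sC A) Ox. Qed.

(** Integrability condition of D_A J = J C_A - C_A J: differentiate once more and use the symmetry
    of the second derivatives of J. *)
Lemma hcurv_acs x (A B : V) : O x -> hcurv x A B *m J x = J x *m hcurv x A B.
Proof.
move=> Ox; have dJx := dJ HL Ox.
have E A' B' : 'D_B' ('D_A' J) x = 'D_B' J x *m C x A' + J x *m 'D_B' (fun y => C y A') x
    - ('D_B' (fun y => C y A') x *m J x + C x A' *m 'D_B' J x).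
  have [d1 D1] := derive_mulmx B' dJx (dC A' Ox).
  have [d2 D2] := derive_mulmx B' (dC A' Ox) dJx.
  rewrite -D1 -D2 -derive_oppf// -derive_addf//; last exact: differentiableN.
  apply: near_eq_derive; apply: (near_open oO Ox) => y Oy; by have := derive_acs_h HL A' Oy.
have := smooth_on_derive_mx_comm A B oO (loc_acs HL) Ox.
rewrite !E !(derive_acs_h HL)// /hcurv.
move: ('D_A _ x) ('D_B _ x) (C x A) (C x B) (J x) => a b c e j.
move=> /eqP; rewrite -subr_eq0 => /eqP; rewrite !(mulmxDl, mulmxDr, mulmxN, mulNmx, mulmxA).
move: (a *m j) (j *m a) (b *m j) (j *m b) => p1 p2 p3 p4.
move: (j *m c *m e) (c *m j *m e) (c *m e *m j) => p5 p6 p7.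
move: (j *m e *m c) (e *m j *m c) (e *m c *m j) => p8 p9 p10 E0.
apply/eqP; rewrite -subr_eq0; apply/eqP; rewrite -[RHS]E0.
by apply/matrixP => i k; rewrite !mxE; ring.
Qed.

Definition Dlee x A B := 'D_A (leef B) x - leef (C x A *m B) x.

Let sl A : smooth_on O (leef A). Proof. exact: smooth_lee_form HL n1 A. Qed.

Let leefD y (A B : V) : leef (A + B) y = leef A y + leef B y.
Proof. by have := app_form_linear (theta y) 1 A B; rewrite scale1r mul1r. Qed.
Let leefN y (A : V) : leef (- A) y = - leef A y.
Proof. by rewrite -[LHS]/((theta y *m - A) 0 0) mulmxN mxE. Qed.

Lemma derive_leef_acs x A B : O x -> 'D_A (fun y => leef (J y *m B) y) x =
  Dlee x A (J x *m B) + leef (J x *m (C x A *m B)) x.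
Proof.
move=> Ox; apply: etrans.
  apply: (@derive_moving _ _ O (fun y X => leef X y) (fun y => J y *m B) x A Ox).
  - by move=> y a X X'; exact: app_form_linear.
  - exact: sl.
  - exact: smooth_acs_app HL B.
rewrite (derive_acs_app HL)//= leefD leefN /Dlee; ring.
Qed.

Lemma Dlee_opp x A B : O x -> Dlee x A (- B) = - Dlee x A B.
Proof.
move=> Ox; rewrite /Dlee mulmxN leefN.
have -> : 'D_A (leef (- B)) x = - 'D_A (leef B) x.
  rewrite -(derive_opp_sm A Ox (sl B)); apply: (near_derive_eq HL A Ox) => y _; exact: leefN.
by ring.
Qed.

Lemma derive_lincomb6 (f1 f2 f3 f4 f5 f6 : V -> R) x A :
  differentiable f1 x -> differentiable f2 x -> differentiable f3 x ->
  differentiable f4 x -> differentiable f5 x -> differentiable f6 x ->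
  'D_A (fun y => f1 y + 4^-1 * (f2 y - f3 y - f4 y + f5 y - 2 * f6 y)) x = 'D_A f1 x
    + 4^-1 * ('D_A f2 x - 'D_A f3 x - 'D_A f4 x + 'D_A f5 x - 2 * 'D_A f6 x).
Proof.
move=> d1 d2 d3 d4 d5 d6.
have dc (c : R) (f : V -> R) : differentiable f x -> differentiable (fun y => c * f y) x.
  by move=> df; apply: differentiable_mulf => //; exact: differentiable_cst.
have Dc (c : R) (f : V -> R) : differentiable f x -> 'D_A (fun y => c * f y) x = c * 'D_A f x.
  move=> df; rewrite (derive_mulf A (differentiable_cst c x) df).
  by rewrite derive_cst mul0r add0r.
have e1 := differentiable_subf d2 d3; have e2 := differentiable_subf e1 d4.
have e3 := differentiable_addf e2 d5; have e4 := differentiable_subf e3 (dc 2 _ d6).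
rewrite (derive_addf A d1 (dc 4^-1 _ e4)) Dc// (derive_subf A e3 (dc 2 _ d6)) Dc//.
by rewrite (derive_addf A e2 d5) (derive_subf A e1 d4) (derive_subf A d2 d3).
Qed.

(** The torsion is built from xi_(1), theta, g and J, and the last two are parallel. Its covariant
    derivative thus has the same shape with the derivatives of xi_(1) and theta; the other terms
    correct for the constant arguments. *)
Lemma derive_torsion_form x A B E W : O x ->
  'D_A (fun y => bilin (g y) (T y B E) W) x =
  Dtorsion14 (bilin (g x)) (mulmx (J x)) (Dt x) (Dlee x) A B E W
  + bilin (g x) (T x (C x A *m B) E) W + bilin (g x) (T x B (C x A *m E)) W
  + bilin (g x) (T x B E) (C x A *m W).
Proof.
move=> Ox; pose k B E y := kahf B E y.
have sE y B' E' W' : O y -> bilin (g y) (T y B' E') W' = 2 * tform B' E' W' y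
   + 4^-1 * (leef B' y * hmet g E' W' y - leef E' y * hmet g B' W' y
     - leef (J y *m B') y * kahf E' W' y + leef (J y *m E') y * kahf B' W' y
     - 2 * (kahf B' E' y * leef (J y *m W') y)).
  move=> Oy; have H := compatible_hermitian (HC Oy).
  rewrite (@herm_torsion14 _ _ _ _ H (tau y) (leev y) (fun A B E => tform A B E y))//.
  by rewrite !(leef_metric HL n1)// !(herm_acsl H) /hmet /kahf; ring.
have sm f : smooth_on O f -> differentiable (f : V -> R) x.
  by move=> sf; exact: smooth_on_differentiable sf Ox.
have st := smooth_tform HL n1 H14; have sk := smooth_kahler HL.
have sh := smooth_metric HL.
have slJ X : smooth_on O (fun y => leef (J y *m X) y).
  have s1 : smooth_on O (fun x => theta x *m (J x *m X)).
    by apply: smooth_on_mulmx => //; [exact: smooth_lee HL n1|exact: smooth_acs_app HL X].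
  exact: (smooth_on_mxP _ oO).1 s1 0 0.
pose f1 y := 2 * tform B E W y.
pose f2 y := leef B y * hmet g E W y; pose f3 y := leef E y * hmet g B W y.
pose f4 y := leef (J y *m B) y * kahf E W y; pose f5 y := leef (J y *m E) y * kahf B W y.
pose f6 y := kahf B E y * leef (J y *m W) y.
have D1 : 'D_A f1 x = 2 * 'D_A (tform B E W) x.
  rewrite (derive_mulf A (differentiable_cst (2 : R) x) (sm _ (st B E W))).
  by rewrite derive_cst mul0r add0r.
have D2 := derive_mulf_sm Ox A (sl B) (sh E W).
have D3 := derive_mulf_sm Ox A (sl E) (sh B W).
have D4 := derive_mulf_sm Ox A (slJ B) (sk E W).
have D5 := derive_mulf_sm Ox A (slJ E) (sk B W).
have D6 := derive_mulf_sm Ox A (sk B E) (slJ W).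
rewrite -/f2 in D2; rewrite -/f3 in D3; rewrite -/f4 in D4; rewrite -/f5 in D5.
rewrite -/f6 in D6.
have -> : 'D_A (fun y => bilin (g y) (T y B E) W) x = 'D_A f1 x
    + 4^-1 * ('D_A f2 x - 'D_A f3 x - 'D_A f4 x + 'D_A f5 x - 2 * 'D_A f6 x).
  have d1 : differentiable f1 x.
    by apply: differentiable_mulf; [exact: differentiable_cst|exact: sm (st _ _ _)].
  have d2 := differentiable_mulf (sm _ (sl B)) (sm _ (sh E W)).
  have d3 := differentiable_mulf (sm _ (sl E)) (sm _ (sh B W)).
  have d4 := differentiable_mulf (sm _ (slJ B)) (sm _ (sk E W)).
  have d5 := differentiable_mulf (sm _ (slJ E)) (sm _ (sk B W)).
  have d6 := differentiable_mulf (sm _ (sk B E)) (sm _ (slJ W)).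
  rewrite -(derive_lincomb6 A d1 d2 d3 d4 d5 d6).
  by apply: (near_derive_eq HL A Ox) => y Oy; exact: sE.
rewrite D1 D2 D3 D4 D5 D6 !sE// !derive_leef_acs// !(derive_hmet HL)// !(derive_kahf HL)//.
have H := compatible_hermitian (HC Ox).
have kE F G : kahf F G x = bilin (g x) F (J x *m G) by [].
rewrite /Dtorsion14 /Dtform /Dlee /hmet !kE !(herm_acsl H).
pose p1 := 'D_A (tform B E W) x; have p1E : 'D_A (tform B E W) x = p1 by [].
pose p2 F := 'D_A (leef F) x; have p2E F : 'D_A (leef F) x = p2 F by [].
pose q F G := bilin (g x) F G; have qE F G : bilin (g x) F G = q F G by [].
pose t F G K := tform F G K x; have tE F G K : tform F G K x = t F G K by [].
pose l F := leef F x; have lE F : leef F x = l F by [].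
rewrite !p1E !p2E !qE !tE !lE; clearbody p1 p2 q t l; by field.
Qed.

Lemma derive_torsion x A B E : O x ->
  'D_A (fun y => T y B E) x =
  'D_A (fun y => C y B) x *m E - 'D_A (fun y => C y E) x *m B.
Proof.
move=> Ox; apply: etrans; last exact: (derive_mulmx_sub E B A (dC B Ox) (dC E Ox)).
apply: near_eq_derive; apply: (near_open oO Ox) => y Oy.
by have := hconn_torsion14 HL n1 H14 B E Oy.
Qed.

Lemma smooth_torsion14 B E : smooth_on O (fun y => T y B E).
Proof.
apply: (@smooth_on_eq _ _ _ _ (fun y => C y B *m E + (-1) *: (C y E *m B))) => //.
  by move=> y /set_mem Oy; rewrite scaleN1r; have := hconn_torsion14 HL n1 H14 B E Oy.
by apply: smooth_onD => //; [|apply: smooth_on_scale => //]; exact: smooth_on_mulmxr.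
Qed.

(** The function <T(B, E), W> is differentiated in two ways, through the explicit formula of T and
    through T(B, E) = C_B E - C_E B; comparison expresses the covariant derivative of T by
    derivatives of C. *)
Lemma Dtorsion14E x A B E W : O x ->
  Dtorsion14 (bilin (g x)) (mulmx (J x)) (Dt x) (Dlee x) A B E W =
  bilin (g x) ('D_A (fun y => C y B) x *m E - 'D_A (fun y => C y E) x *m B
    + C x A *m T x B E - T x (C x A *m B) E - T x B (C x A *m E)) W.
Proof.
move=> Ox; have H := compatible_hermitian (HC Ox).
have := derive_torsion_form A B E W Ox.
have -> : 'D_A (fun y => bilin (g y) (T y B E) W) x =
    'D_A (fun y => hmet g (T x B E) W y) x + bilin (g x) ('D_A (fun y => T y B E) x) W.
  apply: (@derive_moving _ _ O (fun y X => hmet g X W y) (fun y => T y B E) x A Ox).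
  - by move=> y a X X'; exact: bilin_linear_l.
  - by move=> X; exact: smooth_metric HL X W.
  - exact: smooth_torsion14.
rewrite derive_torsion// (derive_hmet HL)// /hmet !(hermDl H, hermNl H) => E0.
lra.
Qed.

End BianchiIdentity.

Section BianchiCyclic.
Variables (R : realType) (n : nat).
Local Notation m := (2 * n)%N.
Local Notation V := 'cV[R]_m.
Local Notation d := (@basis_vec R m).
Variables (O : set V) (g J : V -> 'M[R]_m).
Hypotheses (HL : local_structure O g J) (n1 : (1 < n)%N).
Hypothesis H14 : forall x, O x ->
  torsion_component g J 2 x = 0 /\ torsion_component g J 3 x = 0.
Let oO := loc_open HL.
Let HC := loc_compatible HL.
Local Notation xi := (intrinsic_torsion g J).
Local Notation theta := (lee_form g J).
Local Notation C := (hconn g J).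
Local Notation leev x := (lee_vector (g x) (xi x)).
Local Notation tform := (tform g J).
Local Notation leef := (leef g J).
Local Notation leed := (leed g J).
Local Notation kahf := (kahf g J).
Local Notation psif := (psif g J).
Local Notation Dt := (Dtform g J).

Local Notation Dlee := (Dlee g J).
Local Notation hcurv := (hcurv g J).
Local Notation tau := (skew_torsion g J).
Local Notation T x := (torsion14 (bilin (g x)) (mulmx (J x)) (tau x) (leev x)).

(** Once everything is written in C, the derivatives of C and the products of two C in the cyclic
    sum assemble to curvatures. *)
Lemma hconn_bianchi x X Y Z W : O x ->
  bianchi_rhs (bilin (g x)) (mulmx (J x)) (tau x) (leev x) (Dt x) (Dlee x) X Y Z W =
  bilin (g x) (hcurv x X Y *m Z + hcurv x Y Z *m X + hcurv x Z X *m Y) W.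
Proof.
move=> Ox; have H := compatible_hermitian (HC Ox).
have DE A B E F := Dtorsion14E HL n1 H14 A B E F Ox; rewrite /bianchi_rhs.
move: (Dtorsion14 _ _ _ _) DE => f DE.
have hD a a' b b' c c' : bilin (g x) a W + bilin (g x) a' W
    + (bilin (g x) b W + bilin (g x) b' W) + (bilin (g x) c W + bilin (g x) c' W) =
    bilin (g x) (a + a' + (b + b') + (c + c')) W by rewrite !(hermDl H).
rewrite !DE; apply: (etrans (hD _ _ _ _ _ _)); congr (bilin _ _ _).
have TB A B := hconn_torsion14 HL n1 H14 A B Ox.
have tE A B E : bilin (g x) (tau x A B) E = tform A B E x by [].
have TL := torsion14_linear_l H (leev x) (form30_tform HL n1 Ox) tE.
(* These terms cancel in the cyclic sum against the corrections T(C_A B, E) and T(B, C_A E) left by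
   the covariant derivative of T. *)
have TT A B E : T x (T x A B) E = T x (C x A *m B) E - T x (C x B *m A) E.
  rewrite -(TB A B); have := TL (-1) (C x B *m A) (C x A *m B) E.
  rewrite !scaleN1r => E0.
  by rewrite [X in T x X E]addrC E0 addrC.
have Tskew A B : T x A B = - T x B A by rewrite -!TB opprB.
rewrite !TT (Tskew Y (_ *m _)) (Tskew Z (_ *m _)) (Tskew X (_ *m _)).
rewrite -(TB X Y) -(TB Y Z) -(TB Z X) /hcurv.
pose t (A B E : V) : V := T x (C x A *m B) E; have tT A B E : T x (C x A *m B) E = t A B E by [].
pose c (A : V) : 'M[R]_m := C x A; have cE A : C x A = c A by [].
pose e (A B : V) : 'M[R]_m := 'D_A (fun y => C y B) x; have eE A B : 'D_A (fun y => C y B) x = e A B by [].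
rewrite !tT !cE !eE; clearbody t c e.
rewrite !(mulmxDl, mulmxDr, mulmxN, mulNmx, mulmxA).
pose cc (A B E : V) : V := c A *m c B *m E; have ccE A B E : c A *m c B *m E = cc A B E by [].
pose ee (A B E : V) : V := e A B *m E; have eeE A B E : e A B *m E = ee A B E by [].
rewrite !ccE !eeE; clearbody cc ee.
by apply/matrixP => i k; rewrite !mxE; ring.
Qed.

End BianchiCyclic.

(** * Dimension six *)

Section SquaredNorm.
Variables (R : realType) (n : nat).
Local Notation m := (2 * n)%N.
Local Notation V := 'cV[R]_m.
Variables G J : 'M[R]_m.
Hypothesis HC : compatible G J.
Let H := compatible_hermitian HC.
Implicit Types xi : tensor12 R m.

Lemma mtrace_ext (T T' : V -> V -> R) : (forall X Y, T X Y = T' X Y) ->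
  mtrace (W := R^o) G T = mtrace (W := R^o) G T'.
Proof.
by move=> TT'; apply: eq_bigr => i _; apply: eq_bigr => j _; rewrite TT'.
Qed.

Lemma mtrace_comb (T T' : V -> V -> R) a :
  mtrace (W := R^o) G (fun X Y => a * T X Y + T' X Y) =
  a * mtrace (W := R^o) G T + mtrace (W := R^o) G T'.
Proof.
rewrite /mtrace mulr_sumr -big_split; apply: eq_bigr => i _ /=.
rewrite mulr_sumr -big_split; apply: eq_bigr => j _ /=.
by rewrite /GRing.scale /=; ring.
Qed.

Lemma sqnorm_frame xi (e : 'I_m -> V) : orthonormal G e -> tensor_sqnorm G xi =
  \sum_i \sum_j bilin G (tens xi (e i) *m e j) (tens xi (e i) *m e j).
Proof.
move=> oe; rewrite /tensor_sqnorm -(mtrace_frame _ _ oe).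
- apply: eq_bigr => i _; rewrite -(mtrace_frame _ _ oe)//.
  + by move=> Y a X X'; rewrite mulmxDr -scalemxAr bilin_linear_l.
  + by move=> Y a X X'; rewrite mulmxDr -scalemxAr bilin_linear_r.
- move=> Y a X X' /=; rewrite -mtrace_comb; apply: mtrace_ext => Z Z'.
  by rewrite tens_linear mulmxDl -scalemxAl bilin_linear_l.
- move=> Y a X X' /=; rewrite -mtrace_comb; apply: mtrace_ext => Z Z'.
  by rewrite tens_linear mulmxDl -scalemxAl bilin_linear_r.
Qed.

Lemma herm_ge0 X : 0 <= bilin G X X.
Proof.
have [->|/(herm_pos H)/ltW//] := eqVneq X 0; by rewrite (herm0l H).
Qed.

Lemma sqnorm_ge0 xi : 0 <= tensor_sqnorm G xi.
Proof.
have [e [oe _ _]] := exists_frame HC; rewrite (sqnorm_frame _ oe).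
by do 2!apply: sumr_ge0 => ? _; exact: herm_ge0.
Qed.

Lemma tens_eq0 xi : (forall X Y : V, tens xi X *m Y = 0) -> xi = 0.
Proof.
by move=> xi0; apply: (lower_inj HC) => X Y Z; rewrite /lower xi0 tens0 mul0mx.
Qed.

Lemma sqnorm_eq0 xi : tensor_sqnorm G xi = 0 -> xi = 0.
Proof.
have [e [oe eE _]] := exists_frame HC; rewrite (sqnorm_frame _ oe) => /eqP s0.
have xi0 i j : tens xi (e i) *m e j = 0.
  apply/eqP/negPn/negP => /(herm_pos H); move: s0.
  rewrite psumr_eq0 => [/allP/(_ i (mem_index_enum i))|k _]; last first.
    by apply: sumr_ge0 => ? _; exact: herm_ge0.
  rewrite psumr_eq0 => [/allP/(_ j (mem_index_enum j)) /eqP ->|k _]; last exact: herm_ge0.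
  by rewrite ltxx.
apply: tens_eq0 => X Y; rewrite [Y]eE mulmx_sumr big1// => j _.
rewrite -scalemxAr -[RHS](scaler0 _ (bilin G Y (e j))); congr (_ *: _).
rewrite [X]eE; elim/big_rec: _ => [|i Z _ Z0].
  by rewrite /tens big1 ?mul0mx// => k _; rewrite mxE scale0r.
by rewrite tens_linear mulmxDl -scalemxAl xi0 scaler0 Z0 addr0.
Qed.

Lemma sqnorm0 : tensor_sqnorm G 0 = 0.
Proof.
have [e [oe _ _]] := exists_frame HC; rewrite (sqnorm_frame _ oe).
by rewrite big1// => i _; rewrite big1// => j _; rewrite tens0 mul0mx (herm0l H).
Qed.

End SquaredNorm.

(** The four vectors and their images under J are the rows of a matrix with eight rows and fewer
    columns; a row vector in its left kernel contains both lists of coefficients. *)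
Lemma cdim_le3_mulmx (R : realType) (m : nat) (J : 'M[R]_m) : (m < 8)%N ->
  cdim_le3 (mulmx J : 'cV[R]_m -> 'cV[R]_m).
Proof.
move=> m8 v; pose M := col_mx (\matrix_(i < 4) (v i)^T) (\matrix_(i < 4) (J *m v i)^T).
have : kermx M != 0.
  rewrite -mxrank_eq0 mxrank_ker subn_eq0 -ltnNge.
  exact: leq_ltn_trans (rank_leq_col M) m8.
case/rowV0Pn => u /sub_kermxP; rewrite -[u]hsubmxK mul_row_col => uM u0.
exists (fun i => lsubmx u 0 i), (fun i => rsubmx u 0 i); split.
  apply/existsP; apply: contraNT u0 => /existsPn ab0.
  rewrite -[u]hsubmxK -[0]row_mx0; apply/eqP; congr row_mx; apply/rowP => i; rewrite [RHS]mxE;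
  by have := ab0 i; rewrite hsubmxK negb_or !negbK => /andP[/eqP a0 /eqP b0].
apply: trmx_inj; rewrite trmx0 -uM linear_sum.
rewrite !mulmx_sum_row; rewrite -big_split; apply: eq_bigr => i _ /=.
by rewrite !rowK linearD !linearZ.
Qed.


(** * The derivative of the squared norm of xi_(1) *)

Section NormDerivative.
Variables (R : realType) (n : nat).
Local Notation m := (2 * n)%N.
Local Notation V := 'cV[R]_m.
Local Notation d := (@basis_vec R m).
Variables (O : set V) (g J : V -> 'M[R]_m).
Hypotheses (HL : local_structure O g J) (n1 : (1 < n)%N).
Hypothesis H14 : forall x, O x ->
  torsion_component g J 2 x = 0 /\ torsion_component g J 3 x = 0.
Let oO := loc_open HL.
Let HC := loc_compatible HL.
Local Notation xi := (intrinsic_torsion g J).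
Local Notation theta := (lee_form g J).
Local Notation C := (hconn g J).
Local Notation leev x := (lee_vector (g x) (xi x)).
Local Notation tform := (tform g J).
Local Notation leef := (leef g J).
Local Notation leed := (leed g J).
Local Notation kahf := (kahf g J).
Local Notation psif := (psif g J).
Local Notation Dt := (Dtform g J).

Local Notation tau := (skew_torsion g J).

(** Metric contraction is parallel: differentiating g^-1 g = 1 gives D_A g^-1 = - (g^-1 C_A^T + C_A
    g^-1), and these two factors C_A are moved onto the arguments of T. *)
Lemma derive_mtrace (T : V -> V -> V -> R) x A : O x ->
  (forall X Y, differentiable (T X Y) x) ->
  (forall a X X' Y y, T (a *: X + X') Y y = a * T X Y y + T X' Y y) ->
  (forall a X Y Y' y, T X (a *: Y + Y') y = a * T X Y y + T X Y' y) ->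
  'D_A (fun y => mtrace (W := R^o) (g y) (fun X Y => T X Y y)) x =
  mtrace (W := R^o) (g x) (fun X Y => 'D_A (T X Y) x
    - T (C x A *m X) Y x - T X (C x A *m Y) x).
Proof.
move=> Ox dT T1 T2; have gu y : O y -> g y \in unitmx.
  by move=> Oy; exact: posdef_unitmx (comp_pos (HC Oy)).
have di : differentiable (fun y => invmx (g y)) x.
  exact: smooth_on_differentiable (smooth_on_invmx oO gu (loc_metric HL)) Ox.
have Di : 'D_A (fun y => invmx (g y)) x =
    - (invmx (g x) *m (C x A)^T + C x A *m invmx (g x)).
  have [_ D1] := derive_mulmx A di (dg HL Ox).
  have D0 : 'D_A (fun y => invmx (g y) *m g y) x = 0.
    rewrite -[RHS](derive_cst (1%:M : 'M[R]_m) x A); apply: near_eq_derive.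
    by apply: (near_open oO Ox) => y Oy; rewrite mulVmx ?gu.
  move: D1; rewrite D0 (derive_metric_h HL)// => D1.
  rewrite -[LHS](mulmxK (gu x Ox)).
  have -> : 'D_A (fun y => invmx (g y)) x *m g x =
      - (invmx (g x) *m ((C x A)^T *m g x + g x *m C x A)).
    by apply/eqP; rewrite -addr_eq0 -D1.
  rewrite mulmxDr mulNmx mulmxDl !mulmxA mulVmx ?gu// mul1mx.
  by rewrite -[_ *m g x *m _]mulmxA mulmxV ?gu// mulmx1.
have dij i j : differentiable (fun y => invmx (g y) i j) x.
  exact: (differentiable_mxP _ _).1 di i j.
have E i j : 'D_A (fun y => invmx (g y) i j * T (d i) (d j) y) x =
    invmx (g x) i j * 'D_A (T (d i) (d j)) x
    - (\sum_k invmx (g x) i k * C x A j k) * T (d i) (d j) x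
    - (\sum_k C x A i k * invmx (g x) k j) * T (d i) (d j) x.
  rewrite (derive_mulf A (dij i j) (dT _ _)) -(derive_mxE A i j di) Di !mxE.
  have -> : \sum_k invmx (g x) i k * (C x A)^T k j = \sum_k invmx (g x) i k * C x A j k.
    by apply: eq_bigr => k _; rewrite mxE.
  by ring.
have T0 (F : V -> R) : (forall a X X', F (a *: X + X') = a * F X + F X') ->
    forall X, F X = \sum_k X k 0 * F (d k).
  move=> Fl X; have F0 : F 0 = 0 by have := Fl 1 0 0; rewrite scale1r addr0; lra.
  rewrite {1}[X]vec_expand; elim/big_rec2: _ => // k y z _ <-; exact: Fl.
have Cd k i : (C x A *m d k) i 0 = C x A i k by rewrite -colE mxE.
transitivity (\sum_i \sum_j 'D_A (fun y => invmx (g y) i j * T (d i) (d j) y) x).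
  have dd i j : differentiable (fun y => invmx (g y) i j * T (d i) (d j) y) x.
    exact: differentiable_mulf.
  have [_ ->] := derive_bigsum (index_enum 'I_m) A (fun i =>
    (derive_bigsum (index_enum 'I_m) A (dd i)).1).
  by apply: eq_bigr => i _; have [_ ->] := derive_bigsum (index_enum 'I_m) A (dd i).
under eq_bigr => i _ do under eq_bigr => j _ do rewrite E.
rewrite /mtrace.
transitivity (\sum_i \sum_j (invmx (g x) i j * 'D_A (T (d i) (d j)) x)
  - (\sum_i \sum_j (\sum_k invmx (g x) i k * C x A j k) * T (d i) (d j) x)
  - \sum_i \sum_j (\sum_k C x A i k * invmx (g x) k j) * T (d i) (d j) x).
  rewrite -!sumrB; apply: eq_bigr => i _; rewrite -!sumrB; exact: eq_bigr.
have -> : \sum_i \sum_j (\sum_k invmx (g x) i k * C x A j k) * T (d i) (d j) x =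
    \sum_i \sum_k invmx (g x) i k * T (d i) (C x A *m d k) x.
  apply: eq_bigr => i _; under eq_bigr do rewrite mulr_suml.
  rewrite exchange_big; apply: eq_bigr => k _ /=.
  rewrite [in RHS](T0 (fun Y => T (d i) Y x)) ?mulr_sumr; last by move=> *; exact: T2.
  by apply: eq_bigr => j _; rewrite Cd mulrA.
have -> : \sum_i \sum_j (\sum_k C x A i k * invmx (g x) k j) * T (d i) (d j) x =
    \sum_k \sum_j invmx (g x) k j * T (C x A *m d k) (d j) x.
  transitivity (\sum_k \sum_j \sum_i invmx (g x) k j * (C x A i k * T (d i) (d j) x)).
    under eq_bigr do under eq_bigr do rewrite mulr_suml.
    rewrite [RHS]exchange_big [LHS]exchange_big; apply: eq_bigr => j _ /=.
    rewrite exchange_big; apply: eq_bigr => k _; apply: eq_bigr => i _ /=.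
    by rewrite mulrCA mulrA.
  apply: eq_bigr => k _; apply: eq_bigr => j _.
  rewrite [in RHS](T0 (fun Y => T Y (d j) x)); last by move=> *; exact: T1.
  by rewrite mulr_sumr; apply: eq_bigr => i _; rewrite Cd.
rewrite -!sumrB; apply: eq_bigr => i _; rewrite -!sumrB; apply: eq_bigr => j _.
by rewrite /GRing.scale /=; ring.
Qed.

Lemma skew_torsion_sharp y X Y : O y ->
  tau y X Y = sharp (g y) (\row_j tform X Y (d j) y).
Proof.
move=> Oy; have ts := trilinear_lower (HC Oy) (torsion_component g J 1 y).
apply: (herm_inj (HC Oy)) => Z; rewrite (sharpE (HC Oy)) -[LHS]/(tform X Y Z y).
move: Z; apply: linear_ext => [a Z Z'|a Z Z'|j].
- exact: (tri3 ts).
- exact: app_form_linear.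
- by rewrite app_form_basis mxE.
Qed.

Lemma smooth_skew_torsion X Y : smooth_on O (fun y => tau y X Y).
Proof.
apply: (@smooth_on_eq _ _ _ _ (fun y => sharp (g y) (\row_j tform X Y (d j) y))) => //.
  by move=> y /set_mem Oy; rewrite skew_torsion_sharp.
apply: smooth_on_mulmx => //.
  apply: smooth_on_invmx => // [y Oy|]; last exact: loc_metric HL.
  exact: posdef_unitmx (comp_pos (HC Oy)).
apply: smooth_on_trmx => //; apply/(smooth_on_mxP _ oO) => i j.
by under eq_fun do rewrite mxE; exact: smooth_tform.
Qed.

Definition torsion_sqnorm y := tensor_sqnorm (g y) (torsion_component g J 1 y).

Let B X Y X' Y' y := bilin (g y) (tau y X Y) (tau y X' Y').

Let sB X Y X' Y' : smooth_on O (B X Y X' Y').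
Proof.
apply: smooth_on_bilin => //; [exact: loc_metric HL| |]; exact: smooth_skew_torsion.
Qed.

Lemma smooth_torsion_sqnorm : smooth_on O torsion_sqnorm.
Proof.
have gu y : O y -> g y \in unitmx.
  by move=> Oy; exact: posdef_unitmx (comp_pos (HC Oy)).
apply: smooth_on_mtrace => //; first exact: loc_metric HL.
move=> a b; apply: smooth_on_mtrace => //; first exact: loc_metric HL.
by move=> *; exact: sB.
Qed.

Lemma derive_skew_torsion x A X Y Z : O x ->
  bilin (g x) ('D_A (fun y => tau y X Y) x) Z =
  Dt x A X Y Z + tform (C x A *m X) Y Z x + tform X (C x A *m Y) Z x
  - bilin (g x) (C x A *m tau x X Y) Z.
Proof.
move=> Ox; have : 'D_A (tform X Y Z) x =
    'D_A (fun y => hmet g (tau x X Y) Z y) x + bilin (g x) ('D_A (fun y => tau y X Y) x) Z.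
  apply: (@derive_moving _ _ O (fun y X => hmet g X Z y) (fun y => tau y X Y) x A Ox).
  - by move=> y a E E'; exact: bilin_linear_l.
  - by move=> E; exact: smooth_metric HL E Z.
  - exact: smooth_skew_torsion.
have D1 : 'D_A (hmet g (tau x X Y) Z) x = bilin (g x) (C x A *m tau x X Y) Z
    + tform X Y (C x A *m Z) x := derive_hmet HL A (tau x X Y) Z Ox.
have aux (a b c p q s r : R) : a = b + c -> b = p + q -> c = a - s - r - q + s + r - p.
  by move=> -> ->; ring.
by move=> E0; exact: aux E0 D1.
Qed.

Let derive_B x A X Y X' Y' : O x -> 'D_A (B X Y X' Y') x =
  Dt x A X Y (tau x X' Y') + Dt x A X' Y' (tau x X Y)
  + B (C x A *m X) Y X' Y' x + B X (C x A *m Y) X' Y' x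
  + B X Y (C x A *m X') Y' x + B X Y X' (C x A *m Y') x.
Proof.
move=> Ox; have H := compatible_hermitian (HC Ox).
have -> : 'D_A (B X Y X' Y') x =
    'D_A (fun y => bilin (g y) (tau x X Y) (tau y X' Y')) x
    + bilin (g x) ('D_A (fun y => tau y X Y) x) (tau x X' Y').
  apply: (@derive_moving _ _ O (fun y E => bilin (g y) E (tau y X' Y'))
    (fun y => tau y X Y) x A Ox).
  - by move=> y a E E'; exact: bilin_linear_l.
  - move=> E; apply: smooth_on_bilin => //; [exact: loc_metric HL|exact: smooth_on_cst|].
    exact: smooth_skew_torsion.
  - exact: smooth_skew_torsion.
have -> : 'D_A (fun y => bilin (g y) (tau x X Y) (tau y X' Y')) x =
    'D_A (fun y => hmet g (tau x X Y) (tau x X' Y') y) x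
    + bilin (g x) (tau x X Y) ('D_A (fun y => tau y X' Y') x).
  apply: (@derive_moving _ _ O (fun y E => hmet g (tau x X Y) E y)
    (fun y => tau y X' Y') x A Ox).
  - by move=> y a E E'; exact: bilin_linear_r.
  - by move=> E; exact: smooth_metric HL (tau x X Y) E.
  - exact: smooth_skew_torsion.
have D0 : 'D_A (hmet g (tau x X Y) (tau x X' Y')) x =
    bilin (g x) (C x A *m tau x X Y) (tau x X' Y')
    + bilin (g x) (tau x X Y) (C x A *m tau x X' Y') :=
  derive_hmet HL A (tau x X Y) (tau x X' Y') Ox.
have D1 := derive_skew_torsion A X Y (tau x X' Y') Ox.
have D2 := derive_skew_torsion A X' Y' (tau x X Y) Ox.
have S0 := herm_sym H (tau x X Y) ('D_A (fun y => tau y X' Y') x).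
have S1 := herm_sym H (tau x X Y) (C x A *m tau x X' Y').
have S2 : B X Y (C x A *m X') Y' x = tform (C x A *m X') Y' (tau x X Y) x.
  exact: herm_sym H _ _.
have S3 : B X Y X' (C x A *m Y') x = tform X' (C x A *m Y') (tau x X Y) x.
  exact: herm_sym H _ _.
have aux (a b b' c p q q' s r s' r' k l z1 z2 : R) : a = p + q ->
  b' = l + s' + r' - q' -> c = k + s + r - p -> b = b' -> q = q' -> z1 = s' -> z2 = r' ->
  a + b + c = k + l + s + r + z1 + z2 by move=> -> -> -> -> -> -> ->; ring.
exact: aux D0 D2 D1 S0 S1 S2 S3.
Qed.


(** Both contractions and the inner metric are parallel, so all connection terms cancel and only the
    covariant derivative of xi_(1) is left, once in each factor. *)
Lemma derive_torsion_sqnorm x A : O x -> 'D_A torsion_sqnorm x =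
  mtrace (W := R^o) (g x) (fun X X' => mtrace (W := R^o) (g x) (fun Y Y' =>
    Dt x A X Y (tau x X' Y') + Dt x A X' Y' (tau x X Y))).
Proof.
move=> Ox.
have B1 a X X' Y Z W y : B (a *: X + X') Y Z W y = a * B X Y Z W y + B X' Y Z W y.
  by rewrite /B /skew_torsion tens_linear mulmxDl -scalemxAl bilin_linear_l.
have B2 a X X' Y Z W y : B Y (a *: X + X') Z W y = a * B Y X Z W y + B Y X' Z W y.
  by rewrite /B /skew_torsion mulmxDr -scalemxAr bilin_linear_l.
have B3 a X X' Y Z W y : B Y Z (a *: X + X') W y = a * B Y Z X W y + B Y Z X' W y.
  by rewrite /B /skew_torsion tens_linear mulmxDl -scalemxAl bilin_linear_r.
have B4 a X X' Y Z W y : B Y Z W (a *: X + X') y = a * B Y Z W X y + B Y Z W X' y.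
  by rewrite /B /skew_torsion mulmxDr -scalemxAr bilin_linear_r.
have gu y : O y -> g y \in unitmx.
  by move=> Oy; exact: posdef_unitmx (comp_pos (HC Oy)).
pose T X X' y := mtrace (W := R^o) (g y) (fun Y Y' => B X Y X' Y' y).
have T1 a X X' Z y : T (a *: X + X') Z y = a * T X Z y + T X' Z y.
  by rewrite /T -mtrace_comb; apply: mtrace_ext => Y Y'.
have T2 a X X' Z y : T Z (a *: X + X') y = a * T Z X y + T Z X' y.
  by rewrite /T -mtrace_comb; apply: mtrace_ext => Y Y'.
have sT X Y : smooth_on O (T X Y).
  by apply: smooth_on_mtrace => //; exact: loc_metric HL.
rewrite -[torsion_sqnorm]/(fun y => mtrace (W := R^o) (g y) (fun X X' => T X X' y)).
rewrite derive_mtrace//; last by move=> *; exact: smooth_on_differentiable (sT _ _) Ox.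
apply: mtrace_ext => X X'; rewrite /T.
rewrite (@derive_mtrace (fun Y Y' => B X Y X' Y'))//; last first.
  by move=> *; exact: smooth_on_differentiable (sB _ _ _ _) Ox.
have mB (F F' : V -> V -> R) : mtrace (W := R^o) (g x) F - mtrace (W := R^o) (g x) F' =
    mtrace (W := R^o) (g x) (fun Y Y' => F Y Y' - F' Y Y').
  rewrite -[X in _ - X]mul1r -mulNr addrC -mtrace_comb; apply: mtrace_ext => Y Y'.
  by rewrite mulN1r addrC.
rewrite !mB; apply: mtrace_ext => Y Y'; rewrite derive_B//; ring.
Qed.

End NormDerivative.

Lemma skew4_wedge (R : realType) (V : lmodType R) (be : V -> R) (ps : V -> V -> V -> R)
    (al om : V -> V -> R) :
  (forall a X X', be (a *: X + X') = a * be X + be X') -> skew3 ps ->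
  (forall a X X' Y, al (a *: X + X') Y = a * al X Y + al X' Y) ->
  (forall X Y, al X Y = - al Y X) ->
  (forall a X X' Y, om (a *: X + X') Y = a * om X Y + om X' Y) ->
  (forall X Y, om X Y = - om Y X) ->
  skew4 (fun X Y Z W => wedge13 be ps X Y Z W + wedge22 al om X Y Z W).
Proof.
move=> bl sp all als oml oms; rewrite /wedge13 /wedge22.
split.
- move=> a X X' Y Z W; rewrite bl !all !oml.
  by rewrite !(skew3_linear sp); ring.
- move=> X Y Z W; rewrite (als Y X) (oms Y X) (skew3_swap12 sp Y X Z) (skew3_swap12 sp Y X W).
  by ring.
- move=> X Y Z W; rewrite (als Z Y) (oms Z Y) (skew3_swap12 sp Z Y W) (skew3_swap23 sp X Z Y).
  by ring.
- move=> X Y Z W; rewrite (als W Z) (oms W Z) (skew3_swap23 sp Y W Z) (skew3_swap23 sp X W Z).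
  by ring.
Qed.

(** The second hypothesis is the exterior derivative of the first relation, with d be = al, d al = 0
    and the values of d ps and d om inserted. The wedge products of the first relation with [be] and
    with [th] cancel everything in it except 2 al /\ ps. *)
Lemma ext4_rigidity (R : realType) m (th be : 'cV[R]_m -> R) ps
    (al om : 'cV[R]_m -> 'cV[R]_m -> R) X Y Z W U :
  (forall X Y Z W, wedge13 be ps X Y Z W + wedge22 al om X Y Z W = 0) ->
  wedge23 al ps X Y Z W U
  - wedge14 be (fun X Y Z W => wedge13 th ps X Y Z W - wedge22 al om X Y Z W) X Y Z W U
  + wedge23 al (fun X Y Z => wedge12 th om X Y Z + ps X Y Z) X Y Z W U = 0 ->
  wedge23 al ps X Y Z W U = 0.
Proof.
move=> H0 E.
have K f : wedge14 f (fun X Y Z W => wedge13 be ps X Y Z W + wedge22 al om X Y Z W)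
   X Y Z W U = 0 by rewrite /wedge14 !H0 !mulr0; ring.
have : 2 * wedge23 al ps X Y Z W U = 0; last by lra.
rewrite -[RHS]E; have := K be; have := K th.
rewrite /wedge14 /wedge13 /wedge22 /wedge23 /wedge12; lra.
Qed.

(** * The logarithmic derivative of the norm and the Lee form *)

Section DimensionSix.
Variables (R : realType) (n : nat).
Local Notation m := (2 * n)%N.
Local Notation V := 'cV[R]_m.
Local Notation d := (@basis_vec R m).
Variables (O : set V) (g J : V -> 'M[R]_m).
Hypotheses (HL : local_structure O g J) (n1 : (1 < n)%N).
Hypothesis H14 : forall x, O x ->
  torsion_component g J 2 x = 0 /\ torsion_component g J 3 x = 0.
Let oO := loc_open HL.
Let HC := loc_compatible HL.
Local Notation xi := (intrinsic_torsion g J).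
Local Notation theta := (lee_form g J).
Local Notation C := (hconn g J).
Local Notation leev x := (lee_vector (g x) (xi x)).
Local Notation tform := (tform g J).
Local Notation leef := (leef g J).
Local Notation leed := (leed g J).
Local Notation kahf := (kahf g J).
Local Notation psif := (psif g J).
Local Notation Dt := (Dtform g J).

Local Notation Dlee := (Dlee g J).
Local Notation hcurv := (hcurv g J).
Local Notation tau := (skew_torsion g J).
Local Notation T x := (torsion14 (bilin (g x)) (mulmx (J x)) (tau x) (leev x)).
Local Notation u := (torsion_sqnorm g J).
Hypothesis n3 : n = 3%N.

Lemma tform_neq0 x : O x -> u x != 0 -> exists P Q S, tform P Q S x != 0.
Proof.
move=> Ox; apply: contraNP => /forallNP t0.
rewrite /torsion_sqnorm (_ : torsion_component g J 1 x = 0) ?(sqnorm0 (HC Ox))//.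
apply: (lower_inj (HC Ox)) => X Y Z; rewrite [RHS]/lower tens0 mul0mx.
rewrite (herm0l (compatible_hermitian (HC Ox))).
have /forallNP/(_ Y)/forallNP/(_ Z)/negP := t0 X.
by rewrite negbK => /eqP.
Qed.

Lemma Dtform_linear x k A A' X Y Z : O x ->
  Dt x (k *: A + A') X Y Z = k * Dt x A X Y Z + Dt x A' X Y Z.
Proof.
move=> Ox; have Ft := form30_tform HL n1 Ox.
have dt := smooth_on_differentiable (smooth_tform HL n1 H14 X Y Z) Ox.
have /= L := derive_linearE dt k A A'.
have hD E : C x (k *: A + A') *m E = k *: (C x A *m E) + C x A' *m E.
  by rewrite hconn_linear mulmxDl -scalemxAl.
rewrite /Dtform L !hD.
rewrite (skew3_linear Ft) (skew3_linear2 Ft) (skew3_linear3 Ft) /=.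
move: ('D_A _ x) ('D_A' _ x) => a b; rewrite /GRing.scale /=; ring.
Qed.

Lemma Dtform_coef x : O x -> u x != 0 -> exists a b : V -> R, forall A X Y Z,
  Dt x A X Y Z = a A * tform X Y Z x + b A * tform (J x *m X) Y Z x.
Proof.
move=> Ox u0; have [P [Q [S t0]]] := tform_neq0 Ox u0.
have m8 : (m < 8)%N by rewrite n3.
have E A : exists ab : R * R, forall X Y Z,
    Dt x A X Y Z = ab.1 * tform X Y Z x + ab.2 * tform (J x *m X) Y Z x.
  have [|a [b ab]] := form30_colinear (compatible_hermitian (HC Ox))
    (@cdim_le3_mulmx _ _ (J x) m8) (P := P) (Q := Q) (S := S)
    (form30_Dtform HL n1 H14 A Ox) (form30_tform HL n1 Ox).
    by rewrite t0.
  by exists (a, b).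
have [ab abE] := choice E.
by exists (fun A => (ab A).1), (fun A => (ab A).2).
Qed.

(** The b-part contributes <J tau, tau'> + <J tau', tau>, up to sign, which is zero because J is
    skew; the a-part occurs in both factors, hence the 2. *)
Lemma derive_sqnorm_coef x a b A : O x -> (forall X Y Z,
  Dt x A X Y Z = a * tform X Y Z x + b * tform (J x *m X) Y Z x) ->
  'D_A u x = 2 * a * u x.
Proof.
move=> Ox E; have H := compatible_hermitian (HC Ox); have Ft := form30_tform HL n1 Ox.
rewrite (derive_torsion_sqnorm HL n1 H14)// /torsion_sqnorm /tensor_sqnorm.
have mZ (F : V -> V -> R) c : c * mtrace (W := R^o) (g x) F =
    mtrace (W := R^o) (g x) (fun X Y => c * F X Y).
  rewrite /mtrace mulr_sumr; apply: eq_bigr => i _; rewrite mulr_sumr.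
  by apply: eq_bigr => j _; rewrite /GRing.scale /=; ring.
rewrite mZ; apply: mtrace_ext => X X'; rewrite mZ; apply: mtrace_ext => Y Y'.
have tE A' B' E' : bilin (g x) (tau x A' B') E' = tform A' B' E' x by [].
have tJ A' B' : tau x (J x *m A') B' = - (J x *m tau x A' B').
  by have := tau_acsl H Ft tE A' B'.
rewrite !E -!tE !tJ !(hermNl H) !(herm_acsl H) (herm_acsC H (tau x X' Y')).
rewrite (herm_sym H (tau x X' Y')).
rewrite -/(tau x X Y) -/(tau x X' Y'); ring.
Qed.

Let O' := [set y | O y /\ u y != 0].
Let su : smooth_on O u. Proof. exact: smooth_torsion_sqnorm. Qed.

Let oO' : open O'.
Proof.
rewrite openE => x [Ox u0]; have du := smooth_on_differentiable su Ox.
have cu := differentiable_continuous du.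
have N1 : \forall y \near x, O y by exact: open_nbhs_nbhs.
have N2 : \forall y \near x, u y != 0 by exact: cvgr_neq0 cu u0.
by apply: filterS2 N1 N2 => y Oy uy.
Qed.

Let O'O : O' `<=` O. Proof. by move=> y []. Qed.

Let lnu y := ln (u y).

Let u_gt0 y : O' y -> 0 < u y.
Proof.
by case=> Oy uy; rewrite lt_neqAle eq_sym uy (sqnorm_ge0 (HC Oy)).
Qed.

Let slnu : smooth_on O' lnu.
Proof. by apply: smooth_on_ln => //; exact: smooth_on_sub O'O su. Qed.

Definition lee_defect A y := 'D_A lnu y + leef A y.
Local Notation be := lee_defect.

Let be_linear y : O' y -> forall a X X', be (a *: X + X') y = a * be X y + be X' y.
Proof.
move=> Oy a X X'; have dl := smooth_on_differentiable slnu Oy.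
rewrite /be; have /= -> := derive_linearE dl a X X'.
have -> : leef (a *: X + X') y = a * leef X y + leef X' y by exact: app_form_linear.
move: ('D_X _ y) ('D_X' _ y) => p q.
by rewrite /GRing.scale /=; ring.
Qed.

(** By [skew4_polarized] it suffices to argue on (X, JX, Y, Z). There the connection gives d Psi =
    (2 a + 2 theta) /\ Psi, the equation for d omega gives d Psi = theta /\ Psi - d theta /\ omega,
    and d ln u + theta = 2 a + theta. *)
Lemma lee_defect_wedge y X Y Z W : O' y ->
  wedge13 (be^~ y) (fun A B E => psif A B E y) X Y Z W
  + wedge22 (fun A B => leed A B y) (fun A B => kahf A B y) X Y Z W = 0.
Proof.
move=> Oy'; have [Oy u0] := Oy'; have H := compatible_hermitian (HC Oy).
have m8 : (m < 8)%N by rewrite n3.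
have dim3 := @cdim_le3_mulmx _ _ (J y) m8.
have Fp := form30_psif HL n1 Oy; have Ft := form30_tform HL n1 Oy.
have ll := @leed_linear _ _ g J y; have ls := @leed_skew _ _ g J y.
have kl a A A' B : kahf (a *: A + A') B y = a * kahf A B y + kahf A' B y.
  exact: bilin_linear_l.
have ks A B := kahf_skew HL A B Oy.
move: X Y Z W; apply: (skew4_polarized H dim3
  (skew4_wedge (be_linear Oy') Fp ll ls kl ks)) => X Y Z.
have [a [b ab]] := Dtform_coef Oy u0.
have [P [Q [S t0]]] := tform_neq0 Oy u0.
have tE A B E : bilin (g y) (tau y A B) E = tform A B E y by [].
have t1 : (tform P Q S y != 0) || (tform (J y *m P) Q S y != 0) by rewrite t0.
have RJ (A B E : V) : hcurv y A B *m (J y *m E) = J y *m (hcurv y A B *m E).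
  by rewrite !mulmxA (hcurv_acs HL).
have E1 := @dform3_coef _ _ _ _ H dim3 (tau y) (leev y) (fun A B E => tform A B E y)
  Ft tE (Dt y) (Dlee y) (fun A B E => hcurv y A B *m E)
  (fun A => form30_Dtform HL n1 H14 A Oy) (fun k A A' X Y Z => Dtform_linear k A A' X Y Z Oy)
  (fun A B => Dlee_opp HL n1 A B Oy) RJ
  (fun X Y Z W => hconn_bianchi HL n1 H14 X Y Z W Oy) a b P Q S t1 ab X Y Z.
have E2 := ext3_psif_dform3 HL n1 H14 X (J y *m X) Y Z Oy.
have E3 := ext3_psif HL n1 H14 X (J y *m X) Y Z Oy.
have beE A : be A y = 2 * a A + leef A y.
  rewrite /be /lnu; have [_ ->] := derive_lnf A (smooth_on_differentiable su Oy) (u_gt0 Oy').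
  rewrite (derive_sqnorm_coef Oy (ab A)); congr (_ + _).
  by rewrite mulrC mulfK.
have W13 f : wedge13 f (fun A B E => psif A B E y) X (J y *m X) Y Z =
    - (6 * (f X * tform X Y Z y + f (J y *m X) * tform (J y *m X) Y Z y)).
  rewrite /wedge13 -(form30_acs Fp X X Z) -(form30_acs Fp X X Y).
  rewrite (form30_acs12 X Z Fp) (form30_acs12 X Y Fp) /psif.
  rewrite (form30_acs_sqr H _ _ _ Ft); ring.
move: E3; rewrite E2 E1 !W13 !beE -!(leef_metric HL n1)//.
move: (wedge22 _ _ _ _ _ _) => w22; lra.
Qed.

Lemma smooth_lee_defect A : smooth_on O' (be A).
Proof.
apply: smooth_onD => //; first exact: smooth_on_derive slnu.
exact: smooth_on_sub O'O (smooth_lee_form HL n1 A).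
Qed.

Lemma ext1_lee_defect A B y : O' y -> ext1 be A B y = leed A B y.
Proof.
move=> Oy'; have [Oy u0] := Oy'.
have d1 F := smooth_on_differentiable (smooth_on_derive F slnu) Oy'.
have d2 F := smooth_on_differentiable (smooth_lee_form HL n1 F) Oy.
have aux (a b p p' q r : R) : a = p + q -> b = p' + r -> p = p' -> a - b = q - r.
  by move=> -> -> ->; ring.
rewrite (leedE HL n1)//; exact: aux (derive_addf A (d1 B) (d2 B))
  (derive_addf B (d1 A) (d2 A)) (smooth_on_derive_comm B A oO' slnu Oy').
Qed.

Lemma ext2_leed X Y Z y : O y -> ext2 leed X Y Z y = 0.
Proof.
move=> Oy; rewrite -[RHS](ext_ext1 oO Oy X Y Z (smooth_lee_form HL n1)) /ext2.
have E A B E : 'D_E (leed A B) y = 'D_E (ext1 leef A B) y.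
  by apply: (near_derive_eq HL E Oy) => z Oz; exact: (leedE HL n1).
by rewrite !E.
Qed.

Lemma leed_psif x X Y Z W U : O' x ->
  wedge23 (fun A B => leed A B x) (fun A B E => psif A B E x) X Y Z W U = 0.
Proof.
move=> Ox'; have [Ox u0] := Ox'.
have sp A B E := smooth_on_sub O'O (smooth_psif HL n1 H14 A B E).
have sl A B := smooth_on_sub O'O (smooth_leed HL n1 A B).
have sk A B := smooth_on_sub O'O (smooth_kahler HL A B).
apply: (@ext4_rigidity _ _ (leef^~ x) (be^~ x) _ _ (fun A B => kahf A B x)).
  by move=> *; exact: lee_defect_wedge.
have E1 := ext_wedge13 Ox' X Y Z W U smooth_lee_defect sp.
have E2 := ext_wedge22 Ox' X Y Z W U sl sk.
pose w13 X Y Z W y := wedge13 (be^~ y) (fun A B E => psif A B E y) X Y Z W.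
pose w22 X Y Z W y := wedge22 (fun A B => leed A B y) (fun A B => kahf A B y) X Y Z W.
have E0 : ext4 w13 X Y Z W U x = - ext4 w22 X Y Z W U x.
  have E A B F G K : 'D_A (w13 B F G K) x = - 'D_A (w22 B F G K) x.
    have sw : smooth_on O' (w22 B F G K).
      have M P Q S T : smooth_on O' (fun y => leed P Q y * kahf S T y).
        exact: smooth_onM oO' (sl P Q) (sk S T).
      exact: smooth_onD oO' (smooth_onB oO' (smooth_onD oO' (smooth_onD oO'
        (smooth_onB oO' (M _ _ _ _) (M _ _ _ _)) (M _ _ _ _)) (M _ _ _ _))
        (M _ _ _ _)) (M _ _ _ _).
    rewrite -derive_oppf; last exact: smooth_on_differentiable sw Ox'.
    apply: near_eq_derive; apply: (near_open oO' Ox') => y Oy.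
    by apply/eqP; rewrite -addr_eq0; apply/eqP; exact: lee_defect_wedge.
  by rewrite /ext4 !E; ring.
have K A B : ext1 be A B x = leed A B x by exact: ext1_lee_defect.
have K2 A B E : ext2 leed A B E x = 0 by exact: ext2_leed.
have K3 A B E : ext2 kahf A B E x =
    wedge12 (leef^~ x) (fun A B => kahf A B x) A B E + psif A B E x.
  by have := ext2_kahf14 HL n1 H14 A B E Ox.
have K4 A B E F := ext3_psif HL n1 H14 A B E F Ox.
have aux (p q r s : R) : p = - q -> p = r -> q = s -> r + s = 0 by move=> -> <- <-; ring.
have := aux _ _ _ _ E0 E1 E2; rewrite /wedge14 !K4 => E3; rewrite /wedge14 -[RHS]E3.
rewrite /wedge23 !K !K3 /wedge32 !K2; ring.
Qed.


Lemma lee_defect_eq0 x : O' x ->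
  (forall A, be A x = 0) /\ (forall A B, leed A B x = 0).
Proof.
move=> Ox'; have [Ox u0] := Ox'; have H := compatible_hermitian (HC Ox).
have [e [oe eE e1]] := exists_frame (HC Ox).
have [P [Q [S t0]]] := tform_neq0 Ox u0.
pose w := sharp (g x) (\row_j be (d j) x).
have wE A : bilin (g x) w A = be A x.
  rewrite (sharpE (HC Ox)); move: A; apply: linear_ext => [|a X X'|j].
  - exact: app_form_linear.
  - exact: be_linear.
  - by rewrite app_form_basis mxE.
have m8 : (m < 8)%N by rewrite n3.
have m6 : m = 6%N by rewrite n3.
have Fp := form30_psif HL n1 Ox.
have p0 : (psif P Q S x != 0) || (psif (J x *m P) Q S x != 0).
  apply/orP; right; rewrite /psif (form30_acs_sqr H _ _ _ (form30_tform HL n1 Ox)).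
  by rewrite mulrN oppr_eq0 mulf_neq0// pnatr_eq0.
have hw X Y Z W : wedge13 (bilin (g x) w) (fun A B E => psif A B E x) X Y Z W
    + wedge22 (fun A B => leed A B x) (fun A B => kahf A B x) X Y Z W = 0.
  by rewrite -[RHS](lee_defect_wedge X Y Z W Ox') /wedge13 !wE.
have h5 X Y Z W U := leed_psif X Y Z W U Ox'.
have [w0 l0] := @lee_rigidity _ _ _ _ H m e eE e1 (fun A B => leed A B x)
  (@leed_linear _ _ g J x) (@leed_skew _ _ g J x) (fun A B E => psif A B E x) w Fp
  (@cdim_le3_mulmx _ _ (J x) m8) m6 P Q S p0 hw h5.
by split=> // A; rewrite -wE w0 (herm0l H).
Qed.

Lemma derive_sqnorm_lee x A : O x -> 'D_A u x = - leef A x * u x.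
Proof.
move=> Ox; have [u0|u0] := eqVneq (u x) 0; last first.
  have Ox' : O' x by []; have := (lee_defect_eq0 Ox').1 A; rewrite /lee_defect /lnu.
  have [_ ->] := derive_lnf A (smooth_on_differentiable su Ox) (u_gt0 Ox').
  move: ('D_A u x) => p; move=> /eqP; rewrite addrC addr_eq0 => /eqP ->.
  by rewrite opprK mulrC mulVKf.
(* At a zero of u the tensor xi_(1) itself vanishes, and every term of the derivative contains it
   once undifferentiated. *)
have t0 := sqnorm_eq0 (HC Ox) u0; rewrite u0 mulr0 (derive_torsion_sqnorm HL n1 H14)//.
have Fd := form30_Dtform HL n1 H14 A Ox.
have tau0 X Y : tau x X Y = 0 by rewrite /skew_torsion t0 tens0 mul0mx.
have D0 X Y : Dt x A X Y 0 = 0.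
  by rewrite (skew3_swap23 Fd) (skew3_swap12 Fd) (skew30l Fd) !oppr0.
have z : mtrace (W := R^o) (g x) (fun _ _ : V => 0) = 0.
  by rewrite /mtrace big1// => i _; rewrite big1// => j _; rewrite scaler0.
rewrite -[RHS]z; apply: mtrace_ext => X X'; rewrite -[RHS]z; apply: mtrace_ext => Y Y'.
by rewrite !tau0 !D0 addr0.
Qed.

Lemma lee_closed14 x : O x -> ext_deriv1 theta x = 0.
Proof.
move=> Ox; apply: leed_eq0 => A B; have [//|l0] := eqVneq (leed A B x) 0.
(* On this open set u must vanish, because d theta = 0 wherever u is nonzero. So xi_(1) = 0 on a
   full neighbourhood, which is what the result for type W_2 + W_4 requires. *)
pose O1 := [set y | O y /\ leed A B y != 0].
have O1u y : O1 y -> u y = 0.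
  move=> [Oy ly]; have [//|u0] := eqVneq (u y) 0.
  have Oy' : O' y by [].
  by move: ly; rewrite (lee_defect_eq0 Oy').2 eqxx.
have sl := smooth_leed HL n1 A B.
have oO1 : open O1.
  rewrite openE => y [Oy ly].
  have cl := differentiable_continuous (smooth_on_differentiable sl Oy).
  have N1 : \forall z \near y, O z by exact: open_nbhs_nbhs.
  have N2 : \forall z \near y, leed A B z != 0 by exact: cvgr_neq0 cl ly.
  by apply: filterS2 N1 N2 => z Oz lz.
have O1O : O1 `<=` O by move=> y [].
have HL1 : local_structure O1 g J.
  split=> //; [exact: smooth_on_sub (loc_metric HL)|exact: smooth_on_sub (loc_acs HL)|].
  by move=> y [/HC].
have H24 y : O1 y -> torsion_component g J 1 y = 0 /\ torsion_component g J 3 y = 0.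
  move=> Oy; have Oy1 := O1O y Oy; split; last exact: (H14 Oy1).2.
  by have := sqnorm_eq0 (HC Oy1) (O1u y Oy).
have n2 : (2 < n)%N by rewrite n3.
suff : leed A B x = 0 by move/eqP; rewrite (negPf l0).
rewrite -[leed A B x]/(bilin (ext_deriv1 theta x) A B) (lee_closed24 HL1 n1 H24 n2)//.
by rewrite /bilin mulmx0 mul0mx mxE.
Qed.

End DimensionSix.

(** * Changes of coordinates *)

Section LinearNaturality.
Variables (R : realType) (n : nat).
Local Notation m := (2 * n)%N.
Local Notation V := 'cV[R]_m.
Local Notation d := (@basis_vec R m).
Variables G J G' J' D : 'M[R]_m.
Hypotheses (HC : compatible G J) (HC' : compatible G' J').
Hypotheses (DG : G = D^T *m G' *m D) (DJ : D *m J = J' *m D).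
Let H := compatible_hermitian HC.
Let H' := compatible_hermitian HC'.

Lemma bilin_natural (X Y : V) : bilin G' (D *m X) (D *m Y) = bilin G X Y.
Proof. by rewrite bilin_mulmx -DG. Qed.

Lemma natural_unitmx : D \in unitmx.
Proof.
have Gu := posdef_unitmx (comp_pos HC).
have : invmx G *m (D^T *m G' *m D) = 1%:M by rewrite -DG mulVmx.
by rewrite !mulmxA => /mulmx1_unit[].
Qed.

Lemma acs_natural (X : V) : D *m (J *m X) = J' *m (D *m X).
Proof. by rewrite !mulmxA DJ. Qed.

Let DK (X : V) : D *m (invmx D *m X) = X.
Proof. by rewrite mulKVmx// natural_unitmx. Qed.

Lemma orthonormal_natural (e : 'I_m -> V) :
  orthonormal G e -> orthonormal G' (fun i => D *m e i).
Proof. by move=> oe i j; rewrite bilin_natural oe. Qed.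

Section Tensor.
Variables xi xi' : tensor12 R m.
Hypotheses (n1 : (1 < n)%N) (Wxi : space_W G J xi) (Wxi' : space_W G' J' xi').
Hypothesis xiE : forall X Y Z : V,
  lower G xi X Y Z = lower G' xi' (D *m X) (D *m Y) (D *m Z).

Lemma lee_vector_natural : D *m lee_vector G xi = lee_vector G' xi'.
Proof.
apply: (herm_inj HC') => Z; rewrite -{1}[Z]DK bilin_natural.
have [e [oe _ _]] := exists_frame HC; have oe' := orthonormal_natural oe.
have c0 : (n%:R - 1) / 2 != 0 :> R.
  rewrite mulf_neq0 ?invr_eq0 ?pnatr_eq0//.
  by rewrite subr_eq0 (eqr_nat _ n 1) gtn_eqF.
apply: (mulfI c0); rewrite -(lee_vector_trace HC _ _ n1 oe).
rewrite -(lee_vector_trace HC' _ _ n1 oe').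
by apply: eq_bigr => i _; rewrite xiE DK.
Qed.

(** The projections use only the metric, J and the trace, all of which are carried along by D. *)
Lemma gh_form_natural a X Y Z :
  gh_form G J xi a X Y Z = gh_form G' J' xi' a (D *m X) (D *m Y) (D *m Z).
Proof.
have w4 : w4form G J (lee_vector G xi) X Y Z =
    w4form G' J' (lee_vector G' xi') (D *m X) (D *m Y) (D *m Z).
  by rewrite /w4form -lee_vector_natural -!acs_natural !bilin_natural.
have p12 A B E : part12 J (lower G xi) A B E =
    part12 J' (lower G' xi') (D *m A) (D *m B) (D *m E).
  by rewrite /part12 !xiE !acs_natural.
by case: a => [|[|[|[|[|a]]]]] //=; rewrite /w1form ?p12 ?w4 ?xiE.
Qed.

Lemma gh_component_natural a X Y Z : lower G (gh_component G J xi a) X Y Z =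
  lower G' (gh_component G' J' xi' a) (D *m X) (D *m Y) (D *m Z).
Proof.
rewrite !gh_componentE// (lower_raise HC (gh_form_trilinear HC xi a)).
rewrite (lower_raise HC' (gh_form_trilinear HC' xi' a)).
exact: gh_form_natural.
Qed.

Lemma tens_natural (X Y : V) : D *m (tens xi X *m Y) = tens xi' (D *m X) *m (D *m Y).
Proof.
apply: (herm_inj HC') => Z; rewrite -{1}[Z]DK bilin_natural -[LHS]/(lower G xi _ _ _).
by rewrite xiE DK.
Qed.

Lemma tensor_natural_eq0 : xi = 0 <-> xi' = 0.
Proof.
split=> x0; [apply: (lower_inj HC')|apply: (lower_inj HC)] => X Y Z.
  have := xiE (invmx D *m X) (invmx D *m Y) (invmx D *m Z); rewrite !DK => <-.
  by rewrite x0 /lower !tens0 !mul0mx (herm0l H) (herm0l H').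
by rewrite xiE x0 /lower !tens0 !mul0mx (herm0l H) (herm0l H').
Qed.

Lemma sqnorm_natural : tensor_sqnorm G xi = tensor_sqnorm G' xi'.
Proof.
have [e [oe _ _]] := exists_frame HC; have oe' := orthonormal_natural oe.
rewrite (sqnorm_frame _ oe) (sqnorm_frame _ oe'); apply: eq_bigr => i _.
by apply: eq_bigr => j _; rewrite -!tens_natural bilin_natural.
Qed.

End Tensor.
End LinearNaturality.

(** Six alternating uses of the two symmetries return to the same arguments with the opposite sign.
    This is the uniqueness argument for the Levi-Civita connection, used below to compare two
    connections. *)
Lemma braid_eq0 (R : realType) (T : Type) (f : T -> T -> T -> R) :
  (forall A B E, f A B E = f B A E) -> (forall A B E, f A B E = - f A E B) ->
  forall A B E, f A B E = 0.
Proof.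
move=> fs fa A B E; suff : f A B E = - f A B E by lra.
by rewrite {1}fa fs fa fs fa fs; ring.
Qed.

Lemma bilin_leibniz (R : realType) m (a c G D : 'M[R]_m) X Y :
  bilin ((a^T *m G + D^T *m (c^T *m G + G *m c)) *m D + D^T *m G *m a) X Y =
  bilin G (a *m X + c *m (D *m X)) (D *m Y) + bilin G (D *m X) (a *m Y + c *m (D *m Y)).
Proof.
rewrite /bilin !linearD /= !trmx_mul !(mulmxDl, mulmxDr, mulmxA).
have mxD (A B : 'M[R]_1) : (A + B) 0 0 = A 0 0 + B 0 0 by rewrite mxE.
by rewrite !mxD; ring.
Qed.

Lemma mulmx_ext (R : realType) p q (A B : 'M[R]_(p, q)) :
  (forall X : 'cV[R]_q, A *m X = B *m X) -> A = B.
Proof.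
move=> AB; apply/matrixP => i j.
by have := AB (delta_mx j 0); rewrite -!colE => /colP/(_ i); rewrite !mxE.
Qed.

(** Here s stands for the derivative of D, p for that of j and c for the connection: the
    inhomogeneous terms in the laws for p and c cancel in the covariant derivative. *)
Lemma endo_natural (R : realType) m (s p p' c c' j j' D : 'M[R]_m) :
  s *m j + D *m p = p' *m D + j' *m s -> D *m c = s + c' *m D -> D *m j = j' *m D ->
  D *m (p + c *m j - j *m c) = (p' + c' *m j' - j' *m c') *m D.
Proof.
move=> E N K; rewrite mulmxBr mulmxDr !mulmxBl !mulmxDl !mulmxA N K -mulmxA N.
rewrite !mulmxDl !mulmxDr !mulmxA -(mulmxA c') K !mulmxA.
have -> : D *m p = p' *m D + j' *m s - s *m j by rewrite -E addrC addKr.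
move: (s *m j) (p' *m D) (j' *m s) (_ *m D) (_ *m D) => a1 a2 a3 a4 a5.
by apply/matrixP => k l; rewrite !mxE; ring.
Qed.

(** * Naturality of the intrinsic torsion *)

Section CoordinateChange.
Variables (R : realType) (n : nat).
Local Notation m := (2 * n)%N.
Local Notation V := 'cV[R]_m.
Local Notation d := (@basis_vec R m).
Variables (O O' : set V) (g J g' J' : V -> 'M[R]_m) (phi : V -> V).
Hypotheses (HL : local_structure O g J) (HL' : local_structure O' g' J').
Hypotheses (sphi : smooth_on O phi) (phiO : forall y, O y -> O' (phi y)).
Local Notation D := (Jac phi).
Hypotheses (DG : forall y, O y -> g y = (D y)^T *m g' (phi y) *m D y)
  (DJ : forall y, O y -> D y *m J y = J' (phi y) *m D y).
Let oO := loc_open HL.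
Let HC := loc_compatible HL.
Let HC' := loc_compatible HL'.

Lemma derive_transition x A : O x -> 'D_A phi x = D x *m A.
Proof.
move=> Ox; rewrite (derive_expand A (smooth_on_differentiable sphi Ox)).
apply/matrixP => k o; rewrite ord1 summxE mxE; apply: eq_bigr => i _.
by rewrite !mxE mulrC.
Qed.

Lemma smooth_Jac : smooth_on O D.
Proof.
apply/(smooth_on_mxP _ oO) => k i; under eq_fun do rewrite mxE.
exact: (smooth_on_mxP _ oO).1 (smooth_on_derive (d i) sphi) k 0.
Qed.

Let dD x : O x -> differentiable D x.
Proof. by move=> Ox; exact: smooth_on_differentiable smooth_Jac Ox. Qed.

Lemma derive_Jac_sym x (A B : V) : O x -> 'D_A D x *m B = 'D_B D x *m A.
Proof.
move=> Ox; have E (P Q : V) : 'D_P D x *m Q = 'D_P ('D_Q phi) x.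
  have [_ <-] := derive_mulmx_cst Q P (dD Ox).
  apply: near_eq_derive; apply: (near_open oO Ox) => y Oy.
  by rewrite derive_transition.
apply: (etrans (E A B)); apply: (etrans _ (esym (E B A))).
exact: (smooth_on_derive_mx_comm B A oO sphi Ox).
Qed.

Let dphi x : O x -> differentiable phi x.
Proof. by move=> Ox; exact: smooth_on_differentiable sphi Ox. Qed.

Lemma derive_pullback (W : normedModType R) (F : V -> W) x A : O x ->
  differentiable F (phi x) -> 'D_A (fun y => F (phi y)) x = 'D_(D x *m A) F (phi x).
Proof.
move=> Ox dF; rewrite -derive_transition//.
exact: derive_compE A (dphi Ox) dF.
Qed.

Lemma differentiable_pullback (W : normedModType R) (F : V -> W) x : O x ->
  differentiable F (phi x) -> differentiable (fun y => F (phi y)) x.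
Proof. by move=> Ox dF; exact: differentiable_comp (dphi Ox) dF. Qed.

(** Uniqueness instead of the explicit symbols: the lowered difference of the two sides is symmetric
    in A and B, as both connections are torsion-free and second derivatives of [phi] commute, and
    skew in its last two slots, as both are metric. Then [braid_eq0] applies. *)
Lemma conn_natural x (A B : V) : O x -> D x *m (conn g x A *m B) =
  'D_A D x *m B + conn g' (phi x) (D x *m A) *m (D x *m B).
Proof.
move=> Ox; have Ox' := phiO Ox; have H' := compatible_hermitian (HC' Ox').
have Dg := bilin_natural (DG Ox).
have Du := natural_unitmx (HC Ox) (DG Ox).
have dg' := dg HL' Ox'; have dgp := differentiable_pullback Ox dg'.
pose h P Q := bilin (g' (phi x)) P Q.
pose k (A B : V) : V := 'D_A D x *m B + conn g' (phi x) (D x *m A) *m (D x *m B).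
pose f (A B E : V) := h (D x *m (conn g x A *m B) - k A B) (D x *m E).
have f0 : forall A B E, f A B E = 0.
  apply: braid_eq0 => P Q E.
    have e1 := conn_torsion_free HL P Q Ox.
    have ek : k P Q = k Q P.
      exact: congr2 (derive_Jac_sym P Q Ox) (conn_torsion_free HL' (D x *m P) (D x *m Q) Ox').
    by have := f_equal2 (fun a b : V => h (D x *m a - b) (D x *m E)) e1 ek.
  have E1 : bilin ('D_P g x) Q E =
      h (D x *m (conn g x P *m Q)) (D x *m E) + h (D x *m Q) (D x *m (conn g x P *m E)).
    rewrite (derive_metric HL)// bilinDm -bilin_mulmxl -bilin_mulmxr.
    by rewrite /h !Dg.
  have E2 : bilin ('D_P g x) Q E = h (k P Q) (D x *m E) + h (D x *m Q) (k P E).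
    have -> : 'D_P g x = 'D_P (fun y => (D y)^T *m g' (phi y) *m D y) x.
      by apply: near_eq_derive; apply: (near_open oO Ox) => y Oy; exact: DG.
    have dT : differentiable (fun y => (D y)^T) x.
      exact: smooth_on_differentiable (smooth_on_trmx oO smooth_Jac) Ox.
    have [d1 D1] := derive_mulmx P dT dgp.
    have [_ ->] := derive_mulmx P d1 (dD Ox).
    rewrite D1 (derive_trmx P (dD Ox)) (derive_pullback P Ox dg').
    by rewrite (derive_metric HL')// bilin_leibniz.
  have hB a b c : h (a - b) c = h a c - h b c by rewrite /h (hermDl H') (hermNl H').
  have aux (z p q r s q' s' : R) : z = p + q -> z = r + s -> q = q' -> s = s' ->
    p - r = - (q' - s') by move=> -> E0 <- <-; lra.
  rewrite /f !hB; apply: (aux _ _ _ _ _ _ _ E1 E2); exact: (herm_sym H').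
apply/eqP; rewrite -subr_eq0; apply/eqP; apply: (herm_inj (HC' Ox')) => Z.
rewrite -(mulKVmx Du Z) (herm0l H'); exact: f0.
Qed.

Lemma nablaJ_natural x (A B : V) : O x -> D x *m (nablaJ g J x A *m B) =
  nablaJ g' J' (phi x) (D x *m A) *m (D x *m B).
Proof.
move=> Ox; have Ox' := phiO Ox; have dJ' := dJ HL' Ox'.
have E : 'D_A D x *m J x + D x *m 'D_A J x =
    'D_(D x *m A) J' (phi x) *m D x + J' (phi x) *m 'D_A D x.
  have [_ <-] := derive_mulmx A (dD Ox) (dJ HL Ox).
  rewrite -(derive_pullback A Ox dJ').
  have [_ <-] := derive_mulmx A (differentiable_pullback Ox dJ') (dD Ox).
  by apply: near_eq_derive; apply: (near_open oO Ox) => y Oy; exact: DJ.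
have N : D x *m conn g x A = 'D_A D x + conn g' (phi x) (D x *m A) *m D x.
  by apply: mulmx_ext => X; rewrite -mulmxA mulmxDl -!mulmxA conn_natural.
have := endo_natural E N (DJ Ox); rewrite /nablaJ => E1.
by rewrite !mulmxA; congr (_ *m B).
Qed.

Lemma intrinsic_natural x (A B : V) : O x ->
  D x *m (tens (intrinsic_torsion g J x) A *m B) =
  tens (intrinsic_torsion g' J' (phi x)) (D x *m A) *m (D x *m B).
Proof.
move=> Ox; have Ox' := phiO Ox.
have E1 := tens_intrinsic HL A Ox; have E2 := tens_intrinsic HL' (D x *m A) Ox'.
have E3 : D x *m (J x *m (nablaJ g J x A *m B)) =
    J' (phi x) *m (nablaJ g' J' (phi x) (D x *m A) *m (D x *m B)).
  have aux (a b c : 'M[R]_m) (w w' : V) : a *m b = c *m a -> a *m w = w' ->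
      a *m (b *m w) = c *m w' by move=> E <-; rewrite !mulmxA E.
  exact: aux (DJ Ox) (nablaJ_natural A B Ox).
have aux (t t' N N' j j' a : 'M[R]_m) (w w' : V) (c : R) : t = c *: (j *m N) ->
    t' = c *: (j' *m N') -> a *m (j *m (N *m w)) = j' *m (N' *m w') ->
    a *m (t *m w) = t' *m w'.
  by move=> -> -> E; rewrite -!scalemxAl -scalemxAr -!mulmxA E.
exact: aux E1 E2 E3.
Qed.

Lemma lower_intrinsic_natural x (A B E : V) : O x ->
  lower (g x) (intrinsic_torsion g J x) A B E =
  lower (g' (phi x)) (intrinsic_torsion g' J' (phi x)) (D x *m A) (D x *m B) (D x *m E).
Proof.
move=> Ox; apply/esym; apply: etrans (bilin_natural (DG Ox) _ _).
exact: (congr1 (fun w => bilin (g' (phi x)) w (D x *m E)) (esym (intrinsic_natural A B Ox))).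
Qed.

Hypothesis n1 : (1 < n)%N.

Lemma lower_torsion_component_natural a x (A B E : V) : O x ->
  lower (g x) (torsion_component g J a x) A B E =
  lower (g' (phi x)) (torsion_component g' J' a (phi x)) (D x *m A) (D x *m B) (D x *m E).
Proof.
move=> Ox; have Ox' := phiO Ox.
apply: (gh_component_natural (HC Ox) (HC' Ox') (DG Ox) (DJ Ox) n1
  (space_W_intrinsic HL Ox) (space_W_intrinsic HL' Ox')) => X Y Z.
exact: lower_intrinsic_natural.
Qed.

Lemma torsion_component_natural_eq0 a x : O x ->
  torsion_component g J a x = 0 <-> torsion_component g' J' a (phi x) = 0.
Proof.
move=> Ox; have Ox' := phiO Ox.
apply: (tensor_natural_eq0 (HC Ox) (HC' Ox') (DG Ox)) => X Y Z.
exact: lower_torsion_component_natural.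
Qed.

Lemma torsion_sqnorm_natural x : O x ->
  torsion_sqnorm g J x = torsion_sqnorm g' J' (phi x).
Proof.
move=> Ox; have Ox' := phiO Ox.
apply: (sqnorm_natural (HC Ox) (HC' Ox') (DG Ox)) => X Y Z.
exact: lower_torsion_component_natural.
Qed.

End CoordinateChange.

(** * Conformal changes *)

Section ConformalAlgebra.
Variables (R : realType) (n : nat).
Local Notation m := (2 * n)%N.
Local Notation V := 'cV[R]_m.
Variables (G J : 'M[R]_m) (c : R).
Hypotheses (HC : compatible G J) (c0 : 0 < c).

Lemma bilinZm m' (B : 'M[R]_m') (k : R) X Y : bilin (k *: B) X Y = k * bilin B X Y.
Proof. by rewrite /bilin -scalemxAr -scalemxAl mxE. Qed.

Lemma compatible_scale : compatible (c *: G) J.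
Proof.
split.
- by rewrite linearZ /= (comp_sym HC).
- by move=> v v0; rewrite bilinZm mulr_gt0// (comp_pos HC).
- exact: comp_sqr HC.
- by move=> v w; rewrite !bilinZm (comp_isom HC).
Qed.

Lemma space_W1_scale xi : space_W1 G J xi -> space_W1 (c *: G) J xi.
Proof.
move=> [[sk ac] x0]; split=> //; split=> // X Y Z.
by rewrite !bilinZm sk mulrN.
Qed.

Lemma space_0 a : gh_space G J a (0 : tensor12 R m).
Proof.
have H := compatible_hermitian HC.
have W0 : space_W G J (0 : tensor12 R m).
  split=> [X Y Z|X]; rewrite !tens0 ?mul0mx ?mulmx0 ?addr0//.
  by rewrite (herm0l H) (herm0r H) oppr0.
case: a => [|[|[|[|[|a]]]]] //=; split=> //.
- by move=> X; rewrite tens0 mul0mx.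
- by move=> X Y Z; rewrite !tens0 !mul0mx !(herm0l H) !addr0.
- split=> [X Y|]; first by rewrite !tens0 !mul0mx.
  by rewrite /mtrace big1// => i _; rewrite big1// => j _; rewrite tens0 mul0mx scaler0.
- exists 0 => X Y; rewrite tens0 mul0mx /sharp trmx0 mulmx0 mulmx0 !scaler0.
  have F0 : form_J J (0 : 'rV[R]_m) = 0 by rewrite /form_J mul0mx oppr0.
  have A0 (Z : V) : app_form (0 : 'rV[R]_m) Z = 0 by rewrite /app_form mul0mx mxE.
  by rewrite F0 !A0 !scale0r !subr0 !addr0.
Qed.

Lemma gh_component_W1 xi a : (1 < n)%N -> space_W1 G J xi -> a != 1%N ->
  gh_component G J xi a = 0.
Proof.
move=> n1 W1 a1.
rewrite (@gh_component_unique _ _ _ _ HC xi (fun b => if b == 1%N then xi else 0))//.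
  by rewrite (negPf a1).
split=> [b|]; last by rewrite sum_1_4 /= !addr0.
by case: eqP => [->//|_]; exact: space_0.
Qed.

End ConformalAlgebra.

(** * Removing the Lee form by the conformal factor u *)

Section ConformalChange.
Variables (R : realType) (n : nat).
Local Notation m := (2 * n)%N.
Local Notation V := 'cV[R]_m.
Variables (O : set V) (g J : V -> 'M[R]_m) (u : V -> R).
Hypotheses (HL : local_structure O g J) (n1 : (1 < n)%N).
Hypothesis H14 : forall x, O x ->
  torsion_component g J 2 x = 0 /\ torsion_component g J 3 x = 0.
Hypotheses (su : smooth_on O u) (u_gt0 : forall y, O y -> 0 < u y).
Local Notation leef := (leef g J).
Hypothesis du : forall x A, O x -> 'D_A u x = - leef A x * u x.
Let oO := loc_open HL.
Let HC := loc_compatible HL.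
Local Notation xi := (intrinsic_torsion g J).
Local Notation leev x := (lee_vector (g x) (xi x)).

Definition conformal_metric (y : V) : 'M[R]_m := u y *: g y.
Local Notation g' := conformal_metric.

Lemma smooth_conformal_metric : smooth_on O g'.
Proof.
apply/(smooth_on_mxP _ oO) => i j; under eq_fun do rewrite mxE.
apply: smooth_onM => //; exact: (smooth_on_mxP _ oO).1 (loc_metric HL) i j.
Qed.

Lemma conformal_structure : local_structure O g' J.
Proof.
split=> //; [exact: smooth_conformal_metric|exact: loc_acs HL|].
by move=> x Ox; exact: compatible_scale (HC Ox) (u_gt0 Ox).
Qed.
Let HL' := conformal_structure.

(** If u = e^{2f}, the equation for du gives df = - theta / 2, and this is the classical difference
    df(A) B + df(B) A - <A, B> grad f of the two Levi-Civita connections. *)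
Let kap x A B : V := - 2^-1 *: (leef A x *: B + leef B x *: A - bilin (g x) A B *: leev x).

(** The lowered difference is symmetric by torsion-freeness; it is skew because the derivative of u
    g, computed with either connection, must agree. [braid_eq0] concludes. *)
Lemma conn_conformal x (A B : V) : O x -> conn g' x A *m B = conn g x A *m B + kap x A B.
Proof.
move=> Ox; have H := compatible_hermitian (HC Ox); have u0 := lt0r_neq0 (u_gt0 Ox).
pose h P Q := bilin (g x) P Q.
have lv P : bilin (g x) (leev x) P = leef P x by rewrite (leef_metric HL n1).
pose f (A B E : V) := h (conn g' x A *m B - (conn g x A *m B + kap x A B)) E.
have hk P Q E : h (kap x P Q) E =
    - 2^-1 * (leef P x * h Q E + leef Q x * h P E - h P Q * leef E x).
  rewrite /h /kap; move: (leev x) lv => w lv.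
  by rewrite (hermZl H) (hermDl H) (hermNl H) (hermDl H) !(hermZl H) lv.
have hB a b c e : h (a - (b + c)) e = h a e - h b e - h c e.
  by rewrite /h (hermDl H) (hermNl H) (hermDl H); ring.
have hC a b : h a b = h b a by exact: (herm_sym H).
have f0 : forall A B E, f A B E = 0.
  apply: braid_eq0 => P Q E.
    have ek : h (kap x P Q) E = h (kap x Q P) E by rewrite !hk (hC Q P); ring.
    have e1 := congr1 (h^~ E) (conn_torsion_free HL' P Q Ox).
    have e2 := congr1 (h^~ E) (conn_torsion_free HL P Q Ox).
    have aux (p p' r r' k k' : R) : p = p' -> r = r' -> k = k' -> p - r - k = p' - r' - k'.
      by move=> -> -> ->.
    by rewrite /f !hB; exact: aux e1 e2 ek.
  have E1 : bilin ('D_P g' x) Q E = u x * (h (conn g' x P *m Q) E + h (conn g' x P *m E) Q).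
    rewrite (derive_metric HL')// bilinDm -bilin_mulmxl -bilin_mulmxr /g' !bilinZm -mulrDr.
    by rewrite (herm_sym H Q).
  have E2 : bilin ('D_P g' x) Q E = - leef P x * u x * h Q E
      + u x * (h (conn g x P *m Q) E + h (conn g x P *m E) Q).
    rewrite -(derive_bilin_cst _ _ _ (dg HL' Ox)).
    have -> : 'D_P (fun y => bilin (g' y) Q E) x = 'D_P (fun y => u y * hmet g Q E y) x.
      by congr ('D_P _ x); apply/funext => y; rewrite /g' bilinZm.
    rewrite (derive_mulf_sm Ox P su (smooth_metric HL Q E)) du//.
    rewrite (derive_bilin_cst _ _ _ (dg HL Ox)) (derive_metric HL)// bilinDm.
    by rewrite -bilin_mulmxl -bilin_mulmxr /hmet /h (herm_sym H Q (_ *m E)).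
  have aux (z v a b c e1 e1' e2 e3 p q r s k1 k2 : R) : z = v * (p + q) ->
      z = - a * v * e1 + v * (r + s) -> k1 = - 2^-1 * (a * e1 + b * e2 - e3 * c) ->
      k2 = - 2^-1 * (a * e1' + c * e3 - e2 * b) -> e1 = e1' ->
      v * (p - r - k1) = v * - (q - s - k2).
    move=> -> E0 -> -> <-; apply/eqP; rewrite -subr_eq0; apply/eqP.
    transitivity (v * (p + q) - (- a * v * e1 + v * (r + s))); first by field.
    by rewrite E0 subrr.
  rewrite /f !hB; apply: (mulfI u0).
  exact: aux E1 E2 (hk P Q E) (hk P E Q) (hC Q E).
apply/eqP; rewrite -subr_eq0; apply/eqP; apply: (herm_inj (HC Ox)) => Z.
by rewrite (herm0l H); exact: f0.
Qed.

Let herm_kap x P Q E : O x -> bilin (g x) (kap x P Q) E = - 2^-1 *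
  (leef P x * bilin (g x) Q E + leef Q x * bilin (g x) P E - bilin (g x) P Q * leef E x).
Proof.
move=> Ox; have H := compatible_hermitian (HC Ox).
rewrite /kap (leef_metric HL n1 E Ox); move: (leev x) => w.
by rewrite (hermZl H) (hermDl H) (hermNl H) (hermDl H) !(hermZl H).
Qed.

Lemma tens_conformal x (A B : V) : O x -> tens (intrinsic_torsion g' J x) A *m B =
  tens (xi x) A *m B - 2^-1 *: (J x *m kap x A (J x *m B)) - 2^-1 *: kap x A B.
Proof.
move=> Ox; have JJ := comp_sqr (HC Ox).
have E1 := tens_intrinsic HL A Ox; have E2 := tens_intrinsic HL' A Ox.
have c1 := conn_conformal A B Ox; have c2 := conn_conformal A (J x *m B) Ox.
have aux (t t' N c c' j : 'M[R]_m) (w k1 k2 : V) : t = - 2^-1 *: (j *m (N + c *m j - j *m c)) ->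
    t' = - 2^-1 *: (j *m (N + c' *m j - j *m c')) -> j *m j = - 1%:M ->
    c' *m w = c *m w + k1 -> c' *m (j *m w) = c *m (j *m w) + k2 ->
    t' *m w = t *m w - 2^-1 *: (j *m k2) - 2^-1 *: k1.
  move=> -> -> jj e1 e2.
  have k1E : k1 = - (j *m (j *m k1)) by rewrite mulmxA jj mulNmx mul1mx opprK.
  rewrite [in RHS]k1E -!scalemxAl !mulmxBr !mulmxDr !mulmxBl !mulmxDl -!mulmxA e1 e2 !mulmxDr.
  move: (j *m (N *m w)) (j *m (c *m (j *m w))) (j *m (j *m (c *m w))) (j *m k2).
  move: (j *m (j *m k1)) => a1 a2 a3 a4 a5.
  by apply/matrixP => k l; rewrite !mxE; ring.
exact: aux E1 E2 JJ c1 c2.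
Qed.

(** The intrinsic torsion changes by minus the part of [kap] that anticommutes with J, and this part
    is precisely the W_4 component of xi. *)
Lemma intrinsic_conformal x : O x ->
  intrinsic_torsion g' J x = torsion_component g J 1 x.
Proof.
move=> Ox; have H := compatible_hermitian (HC Ox).
apply: (lower_inj (HC Ox)) => A B E; rewrite {1}/lower tens_conformal//.
have hD c p q r : bilin (g x) (p - c *: q - c *: r) E =
    bilin (g x) p E - c * bilin (g x) q E - c * bilin (g x) r E.
  by rewrite !(hermDl H) !(hermNl H) !(hermZl H).
rewrite hD (herm_acsl H) !herm_kap//.
have l14 := lower14 HL n1 H14 A B E Ox.
have w4 : w4form (g x) (J x) (leev x) A B E = 4^-1 * (bilin (g x) A B * leef E x
   - leef B x * bilin (g x) A E - bilin (g x) A (J x *m B) * leef (J x *m E) x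
   + leef (J x *m B) x * bilin (g x) A (J x *m E)).
  rewrite /w4form !(leef_metric HL n1)// !(herm_acsl H).
  by move: (leev x) => w; ring.
rewrite -[bilin _ (tens _ _ *m _) _]/(lower (g x) (xi x) A B E) l14 w4.
rewrite (comp_isom (HC Ox)) -[RHS]/(tform g J A B E x).
move: (tform _ _ _ _ _ _) (leef A x) (leef B x) (leef E x) => t l1 l2 l3.
move: (leef _ x) (leef _ x) (bilin _ A B) (bilin _ A E) (bilin _ B E) => l4 l5 b1 b2 b3.
by move: (bilin _ _ _) (bilin _ _ _) => b4 b5; field.
Qed.

Lemma torsion_component_conformal a x : O x -> a != 1%N ->
  torsion_component g' J a x = 0.
Proof.
move=> Ox a1; rewrite /torsion_component intrinsic_conformal//.
apply: (gh_component_W1 (loc_compatible HL' Ox) n1 _ a1).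
apply: space_W1_scale.
have [+ _] := gh_componentP (HC Ox) n1 (space_W_intrinsic HL Ox).
by move/(_ 1%N).
Qed.

End ConformalChange.

(** * Globalization *)

Section Propagation.
Variables (R : realType) (m : nat).
Local Notation V := 'cV[R]_m.
Variables (O : set V) (u : V -> R) (l : V -> V -> R) (x : V).
Hypotheses (oO : open O) (Ox : O x) (du : forall y, O y -> differentiable u y).
Hypotheses (u_ge0 : forall y, O y -> 0 <= u y).
Hypotheses (Du : forall y A, O y -> 'D_A u y = - l A y * u y).
Hypotheses (l_linear : forall y a A B, l (a *: A + B) y = a * l A y + l B y).
Hypotheses (l_cont : forall A, {for x, continuous (l A)}).

(* Gronwall on the segments issued from x. *)
Lemma near_eq0_of_derive : u x = 0 -> \forall y \near x, u y = 0.
Proof.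
(* The summand 1 leaves room for continuity: the coefficients stay below these bounds on a ball
   around x. *)
move=> ux0; pose k i := `|l (basis_vec R i) x| + 1.
have : \forall y \near x, O y /\ forall i, `|l (basis_vec R i) y| <= k i.
  have N1 : \forall y \near x, O y by exact: open_nbhs_nbhs.
  have N2 : \forall y \near x, forall i, `|l (basis_vec R i) y| <= k i.
    have N i : \forall y \near x, `|l (basis_vec R i) y| <= k i.
      by apply: (cvgr_norm_le _ (@l_cont (basis_vec R i))); rewrite /k ltrDl.
    exact: filter_forall N.
  exact: filterI N1 N2.
move=> /nbhs_normP[r /= r0 rP]; apply/nbhs_normP; exists r => //= y yr.
pose v := y - x; pose p (s : R) := x + s *: v.
have pP (s : R) : 0 <= s <= 1 -> O (p s) /\ forall i, `|l (basis_vec R i) (p s)| <= k i.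
  move=> /andP[s0 s1]; apply: rP; rewrite /= /p opprD addrA subrr add0r normrN normrZ.
  move: yr; rewrite /= distrC -/v; apply: le_lt_trans.
  by rewrite (ger0_norm s0) ler_piMl.
pose C : R := \sum_i `|v i 0| * k i.
have lC (s : R) : 0 <= s <= 1 -> `|l v (p s)| <= C.
  move=> /pP[_ lk]; have l0 z : l 0 z = 0.
    by have := l_linear z 1 0 0; rewrite scale1r addr0; lra.
  have -> : l v (p s) = \sum_i v i 0 * l (basis_vec R i) (p s).
    rewrite {1}[v]matrix_sum_delta; under eq_bigr do rewrite big_ord1.
    by elim/big_rec2: _ => // i a b _ <-; exact: l_linear.
  rewrite (le_trans (ler_norm_sum _ _ _))//; apply: ler_sum => i _.
  by rewrite normrM ler_wpM2l.
(* Along the segment the derivative of u is at most C u, so this integrating factor makes [phi]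
   nonincreasing; it starts at 0 and cannot be negative. *)
pose phi (s : R) : R := u (p s) * expR (- C * s).
have dphi (s : R) : 0 <= s <= 1 -> is_derive s 1 phi
    ((- l v (p s) - C) * (u (p s) * expR (- C * s)) : R).
  move=> s01; have [Op _] := pP _ s01.
  have d1 : is_derive s 1 (fun r => u (p r)) ('D_v u (p s)).
    exact: is_derive_line (du Op).
  have d2 : is_derive s 1 (fun r : R => expR (- C * r)) (expR (- C * s) * - C).
    have dl : is_derive s 1 ( *%R (- C)) (- C).
      rewrite -[X in is_derive _ _ _ X](mulr1 (- C)); exact: is_deriveZ.
    exact: is_derive1_comp.
  rewrite (_ : phi = (fun r => u (p r)) * (fun r : R => expR (- C * r)))//.
  apply: is_derive_eq.
  by rewrite Du// /GRing.scale /=; ring.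
have : phi 1 <= phi 0.
  apply: (@ler0_derive1_nincr _ phi 0 1) => //.
  - by move=> s; rewrite in_itv /= => /andP[s0 s1]; have [|//] := dphi s; rewrite !ltW.
  - move=> s; rewrite in_itv /= => /andP[/ltW s0 /ltW s1]; rewrite derive1E.
    have s01 : 0 <= s <= 1 by rewrite s0.
    have [_ ->] := dphi s s01; have [Op _] := pP _ s01.
    apply: mulr_le0_ge0; last by rewrite mulr_ge0 ?expR_ge0// u_ge0.
    by have := lC _ s01; rewrite ler_norml => /andP[+ _]; lra.
  - apply: derivable_within_continuous => s; rewrite in_itv /= => s01.
    by have [] := dphi s s01.
have [Oy _] : O (p 1) /\ forall i, `|l (basis_vec R i) (p 1)| <= k i.
  by apply: pP; rewrite ler01 lexx.
rewrite /phi /p scale0r addr0 ux0 mul0r scale1r /v addrC subrK => ule.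
have Oy' : O y by move: Oy; rewrite /p scale1r /v addrC subrK.
apply/eqP; rewrite eq_le u_ge0// andbT.
by move: ule; rewrite pmulr_lle0 ?expR_gt0.
Qed.

End Propagation.

Section Charts.
Variables (R : realType) (m : nat) (M : topologicalType) (c : chart R m M).
Local Notation V := 'cV[R]_m.

Lemma nbhs_chart (p : M) (N : set V) : dom c p -> nbhs (coord c p) N ->
  nbhs p (dom c `&` coord c @^-1` N).
Proof.
move=> cp Np; apply: filterI; first exact: (open_nbhs_nbhs (conj (dom_open c) cp)).
have := @coord_cont _ _ _ c; rewrite (continuous_open_subspace _ (dom_open c)).
by move=> /(_ p (mem_set cp)); apply.
Qed.

Lemma patch_open (A : set M) : open A -> open (patch c A).
Proof.
move=> oA; rewrite openE => _ [p [cp Ap] <-].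
have Ix : chart_img c (coord c p) by exists p.
have N1 : nbhs (coord c p) (chart_img c) := open_nbhs_nbhs (conj (@img_open _ _ _ c) Ix).
have N2 : nbhs (coord c p) (point c @^-1` A).
  have := @point_cont _ _ _ c; rewrite (continuous_open_subspace _ (@img_open _ _ _ c)).
  move=> /(_ _ (mem_set Ix)); apply; rewrite coordK//; exact: open_nbhs_nbhs.
apply: filterS2 N1 N2 => y [q cq <-] /=; rewrite coordK// => Aq.
by exists q.
Qed.

Lemma patchT : patch c setT = chart_img c.
Proof. by rewrite /patch setIT. Qed.

Lemma patch_sub (A : set M) : patch c A `<=` chart_img c.
Proof. by move=> _ [p [cp _] <-]; exists p. Qed.

End Charts.

Lemma local_structure_sub (R : realType) (n : nat) (O O' : set 'cV[R]_(2 * n))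
    (g J : 'cV[R]_(2 * n) -> 'M[R]_(2 * n)) : open O' -> O' `<=` O ->
  local_structure O g J -> local_structure O' g J.
Proof.
move=> oO' OO HL; split=> //.
- exact: (smooth_on_sub OO (loc_metric HL)).
- exact: (smooth_on_sub OO (loc_acs HL)).
- by move=> x /OO /(loc_compatible HL).
Qed.

(** * From charts to the manifold *)

Section AlmostHermitianCharts.
Variables (R : realType) (n : nat) (M : topologicalType).
Local Notation m := (2 * n)%N.
Local Notation V := 'cV[R]_m.
Variables (X : smooth_manifold R m M) (g J : chart R m M -> V -> 'M[R]_m).
Hypotheses (HM : almost_hermitian X setT g J) (n1 : (1 < n)%N).

Lemma chart_structure c : atlas X c -> local_structure (chart_img c) (g c) (J c).
Proof.
move=> Xc; rewrite -patchT; split.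
- by rewrite patchT; exact: img_open.
- exact (metric_smooth HM Xc).
- exact (acs_smooth HM Xc).
- move=> x cx; split.
  + exact: (metric_sym HM Xc cx).
  + exact: (metric_pos HM Xc cx).
  + exact: (acs_sqr HM Xc cx).
  + exact: (acs_isometry HM Xc cx).
Qed.

Section Overlap.
Variables c c' : chart R m M.
Hypotheses (Xc : atlas X c) (Xc' : atlas X c').
Let O := patch c (dom c').
Let phi := coord c' \o point c.

Let HL : local_structure O (g c) (J c).
Proof.
apply: local_structure_sub (chart_structure Xc); last exact: patch_sub.
exact: (patch_open (dom_open c')).
Qed.

Let phiO y : O y -> chart_img c' (phi y).
Proof. by move=> [p [cp cp'] <-]; exists p => //; rewrite /phi /= coordK. Qed.

Let DG y : O y -> g c y = (Jac phi y)^T *m g c' (phi y) *m Jac phi y.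
Proof.
move=> [p [cp cp'] <-]; rewrite {2}/phi /= coordK//.
exact: (metric_transform HM Xc Xc' cp cp').
Qed.

Let DJ y : O y -> Jac phi y *m J c y = J c' (phi y) *m Jac phi y.
Proof.
move=> [p [cp cp'] <-]; rewrite {2}/phi /= coordK//.
exact: (acs_transform HM Xc Xc' cp cp').
Qed.

Let sphi : smooth_on O phi := atlas_compat Xc Xc'.

Lemma torsion_component_overlap a p : dom c p -> dom c' p ->
  torsion_component (g c) (J c) a (coord c p) = 0 <->
  torsion_component (g c') (J c') a (coord c' p) = 0.
Proof.
move=> cp cp'; have Op : O (coord c p) by exists p.
have := torsion_component_natural_eq0 HL (chart_structure Xc') sphi phiO DG DJ n1 a Op.
by rewrite /phi /= coordK.
Qed.

Lemma torsion_sqnorm_overlap p : dom c p -> dom c' p ->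
  torsion_sqnorm (g c) (J c) (coord c p) = torsion_sqnorm (g c') (J c') (coord c' p).
Proof.
move=> cp cp'; have Op : O (coord c p) by exists p.
have := torsion_sqnorm_natural HL (chart_structure Xc') sphi phiO DG DJ n1 Op.
by rewrite /phi /= coordK.
Qed.

End Overlap.

(** By naturality under transition maps, vanishing can be tested in a single chart. *)
Lemma component_vanishes_atP a p c : atlas X c -> dom c p ->
  component_vanishes_at X g J a p <-> torsion_component (g c) (J c) a (coord c p) = 0.
Proof.
move=> Xc cp; split=> [v|t0 c' Xc' cp']; first exact: v.
have [h _] := torsion_component_overlap Xc Xc' a cp cp'; exact (h t0).
Qed.

Lemma component_vanishes_at1P p c : atlas X c -> dom c p ->
  component_vanishes_at X g J 1 p <-> torsion_sqnorm (g c) (J c) (coord c p) = 0.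
Proof.
move=> Xc cp; rewrite (component_vanishes_atP _ Xc cp).
have HC : compatible (g c (coord c p)) (J c (coord c p)).
  by apply: (loc_compatible (chart_structure Xc)); exists p.
split=> [t0|]; first by rewrite /torsion_sqnorm t0 (sqnorm0 HC).
by move/(sqnorm_eq0 HC).
Qed.

Lemma of_type_chart s a c x : of_type X g J setT s -> a \in [:: 1; 2; 3; 4]%N ->
  a \notin s -> atlas X c -> chart_img c x -> torsion_component (g c) (J c) a x = 0.
Proof.
by move=> ts a4 as_ Xc [p cp <-]; exact: (ts a p a4 as_ I c Xc cp).
Qed.

Lemma lee_closed_W2W4 : (2 < n)%N -> of_type X g J setT [:: 2; 4]%N -> lee_closed X g J.
Proof.
move=> n2 ts c x Xc cx; apply: (lee_closed24 (chart_structure Xc) n1 _ n2 cx) => y cy.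
by split; apply: of_type_chart ts _ _ Xc cy.
Qed.

Section TypeW1W4.
Hypothesis ts : of_type X g J setT [:: 1; 4]%N.

Let H14 c : atlas X c -> forall x, chart_img c x ->
  torsion_component (g c) (J c) 2 x = 0 /\ torsion_component (g c) (J c) 3 x = 0.
Proof. by move=> Xc x cx; split; apply: of_type_chart ts _ _ Xc cx. Qed.

Lemma lee_lambda11_0_W1W4 : (2 < n)%N -> lee_lambda11_0_vanishes X g J.
Proof.
by move=> n2 c x Xc cx; exact: (lambda11_0_lee14 (chart_structure Xc) n1 (H14 Xc) n2 cx).
Qed.

Hypothesis n3 : n = 3%N.

Lemma lee_closed_W1W4 : lee_closed X g J.
Proof. by move=> c x Xc cx; exact: (lee_closed14 (chart_structure Xc) n1 (H14 Xc) n3 cx). Qed.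

Let Z := component_vanishes_at X g J 1.
Let u c := torsion_sqnorm (g c) (J c).

Let su c : atlas X c -> smooth_on (chart_img c) (u c).
Proof. by move=> Xc; exact: (smooth_torsion_sqnorm (chart_structure Xc) n1 (H14 Xc)). Qed.

Let chart_of (p : M) : exists2 c, atlas X c & dom c p := atlas_cover X p.

Lemma open_vanishing : open Z.
Proof.
rewrite openE => p Zp; have [c Xc cp] := chart_of p.
have HL := chart_structure Xc; have Ip : chart_img c (coord c p) by exists p.
have u0 : u c (coord c p) = 0 by have [h _] := component_vanishes_at1P Xc cp; exact (h Zp).
have dl A := smooth_on_differentiable (smooth_lee_form HL n1 A) Ip.
have N : \forall y \near coord c p, u c y = 0.
  apply: (near_eq0_of_derive (O := chart_img c) (l := leef (g c) (J c))) u0.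
  - exact: img_open.
  - by [].
  - by move=> y Iy; exact: (smooth_on_differentiable (su Xc) Iy).
  - by move=> y Iy; exact: (sqnorm_ge0 (loc_compatible HL Iy) _).
  - by move=> y A Iy; exact: (derive_sqnorm_lee HL n1 (H14 Xc) n3 A Iy).
  - by move=> y a A B; exact: app_form_linear.
  - by move=> A; exact: (differentiable_continuous (dl A)).
apply: filterS (nbhs_chart cp N) => q [cq uq].
by have [_ h] := component_vanishes_at1P Xc cq; exact (h uq).
Qed.

Lemma closed_vanishing : closed Z.
Proof.
rewrite -openC openE => p Zp; have [c Xc cp] := chart_of p.
have Ip : chart_img c (coord c p) by exists p.
have u0 : u c (coord c p) != 0.
  by apply/eqP => u0; have [_ h] := component_vanishes_at1P Xc cp; exact (Zp (h u0)).
have cu := differentiable_continuous (smooth_on_differentiable (su Xc) Ip).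
have N : \forall y \near coord c p, u c y != 0 by exact: (cvgr_neq0 _ cu u0).
suff : nbhs p (~` Z) by [].
apply: filterS (nbhs_chart cp N) => q [cq /eqP uq] Zq.
by have [h _] := component_vanishes_at1P Xc cq; exact (uq (h Zq)).
Qed.

Lemma vanishing_component p q : connected_component setT p q -> Z p -> Z q.
Proof.
move=> pq Zp; have conn : connected (connected_component setT p).
  exact: component_connected.
have E : connected_component setT p `&` Z = connected_component setT p.
  apply: conn.
  - by exists p; split=> //; exact: connected_component_refl.
  - by exists Z => //; exact: open_vanishing.
  - by exists Z => //; exact: closed_vanishing.
by move: pq; rewrite -E => -[].
Qed.

Lemma of_type_vanishing p : Z p -> of_type X g J (connected_component setT p) [:: 4]%N.
Proof.
move=> Zp a q; rewrite !inE => /or4P[]/eqP -> // _ pq; first exact: (vanishing_component pq).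
  exact: (ts (a := 2%N)).
exact: (ts (a := 3%N)).
Qed.

(** * Components on which xi_(1) has no zero *)

Section NonVanishing.
Variable p : M.
Hypothesis Zp : ~ Z p.
Local Notation A := (connected_component setT p).

Let U c := [set x | chart_img c x /\ 0 < u c x].

Lemma patch_nonvanishing c : atlas X c -> patch c A `<=` U c.
Proof.
move=> Xc _ [q [cq Aq] <-]; have Iq : chart_img c (coord c q) by exists q.
split=> //; rewrite lt_neqAle (sqnorm_ge0 (loc_compatible (chart_structure Xc) Iq)) andbT.
apply/eqP => u0; apply: Zp; apply: (vanishing_component (connected_component_sym Aq)).
by have [_ h] := component_vanishes_at1P Xc cq; exact (h (esym u0)).
Qed.

Let oU c : atlas X c -> open (U c).
Proof.
move=> Xc; rewrite openE => x [cx ux].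
have cu := differentiable_continuous (smooth_on_differentiable (su Xc) cx).
have N1 : \forall y \near x, 0 < u c y by exact: (cvgr_gt _ cu _ ux).
have N2 : \forall y \near x, chart_img c y.
  exact: (open_nbhs_nbhs (conj (@img_open _ _ _ c) cx)).
by apply: filterS2 N2 N1 => y cy uy.
Qed.

Let UI c : U c `<=` chart_img c. Proof. by move=> x []. Qed.

Lemma lee_dlog_W1W4 : lee_is_dlog_xi1 X g J A.
Proof.
move=> c x Xc /(patch_nonvanishing Xc)[cx ux] v.
have HL := chart_structure Xc.
have du := smooth_on_differentiable (su Xc) cx.
have [dl Dl] := derive_lnf v du ux.
have lnV : \forall y \near x, - ln (u c y) = ln (u c y)^-1.
  have N : U c x by split.
  by apply: (near_open (oU Xc) N) => y [_ uy]; rewrite lnV.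
apply: DeriveDef.
  apply: diff_derivable; apply: near_eq_differentiable lnV _; exact: differentiableN.
rewrite -(near_eq_derive _ lnV) derive_oppf// Dl.
rewrite (derive_sqnorm_lee HL n1 (H14 Xc) n3 v cx).
by rewrite mulNr mulrN opprK mulrC mulfK// gt_eqF.
Qed.

Definition conformal_to_W1 c x : 'M[R]_m := u c x *: g c x.
Local Notation g' := conformal_to_W1.

Let HU c : atlas X c -> local_structure (U c) (g c) (J c).
Proof. by move=> Xc; apply: local_structure_sub (chart_structure Xc); [exact: oU|exact: UI]. Qed.

Let suU c : atlas X c -> smooth_on (U c) (u c).
Proof. by move=> Xc; exact: (smooth_on_sub (@UI c) (su Xc)). Qed.

Let HU' c : atlas X c -> local_structure (U c) (g' c) (J c).
Proof. by move=> Xc; exact: (conformal_structure (HU Xc) (suU Xc) (fun y (Uy : U c y) => Uy.2)). Qed.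

Lemma conformal_almost_hermitian : almost_hermitian X A g' J.
Proof.
split.
- move=> c Xc; exact (smooth_on_sub (patch_nonvanishing Xc) (loc_metric (HU' Xc))).
- move=> c Xc; exact (smooth_on_sub (patch_nonvanishing Xc) (loc_acs (HU' Xc))).
- by move=> c x Xc /(patch_nonvanishing Xc) Ux; exact: (comp_sym (loc_compatible (HU' Xc) Ux)).
- by move=> c x Xc /(patch_nonvanishing Xc) Ux v; exact: (comp_pos (loc_compatible (HU' Xc) Ux)).
- by move=> c x Xc /(patch_nonvanishing Xc) Ux; exact: (comp_sqr (loc_compatible (HU' Xc) Ux)).
- by move=> c x Xc /(patch_nonvanishing Xc) Ux; exact: (comp_isom (loc_compatible (HU' Xc) Ux)).
(* The factor u is a scalar invariant, with the same value in both charts, so the law for g carries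
   over to u g. *)
- move=> c c' q Xc Xc' cq cq' Aq D; rewrite /g' (metric_transform HM Xc Xc' cq cq' I).
  rewrite -/D {1}/u (torsion_sqnorm_overlap Xc Xc' cq cq').
  by rewrite -scalemxAr -scalemxAl.
- by move=> c c' q Xc Xc' cq cq' Aq; exact: (acs_transform HM Xc Xc' cq cq' I).
Qed.

Let chart_at q : {c : chart R m M | atlas X c /\ dom c q}.
Proof. by apply: cid; have [c Xc cq] := chart_of q; exists c. Qed.

(** A function on the manifold itself, hence a chart chosen at each point; the choice is immaterial
    since u agrees on overlaps. The factor 1/2 gives e^{2f} = u. *)
Definition conformal_factor q : R := 2^-1 * ln (u (sval (chart_at q)) (coord (sval (chart_at q)) q)).

Local Notation f := conformal_factor.

Let fE c q : atlas X c -> dom c q -> f q = 2^-1 * ln (u c (coord c q)).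
Proof.
move=> Xc cq; rewrite /f; case: (chart_at q) => c' [Xc' cq'] /=.
have E := torsion_sqnorm_overlap Xc' Xc cq' cq.
exact (congr1 (fun z : R => 2^-1 * ln z) E).
Qed.

Lemma conformal_W1W4 : globally_conformal X g J A g' J.
Proof.
exists f => [c Xc|c _ Xc [q [cq Aq] <-]].
  apply: (smooth_on_sub (patch_nonvanishing Xc)).
  apply: (@smooth_on_eq _ _ _ _ (fun y => 2^-1 * ln (u c y))); first exact: oU.
    move=> _ /set_mem[[q cq <-] _]; have E := fE Xc cq.
    exact (etrans (esym E) (congr1 f (esym (coordK cq)))).
  apply: smooth_onM; [exact: oU|exact: smooth_on_cst|].
  by apply: smooth_on_ln; [exact: oU|move=> y []|exact: suU].
split=> //; have [|_ u0] := @patch_nonvanishing c Xc (coord c q); first by exists q.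
have E : expR (2 * f q) = u c (coord c q).
  by rewrite (fE Xc cq) mulrA mulfV ?pnatr_eq0// mul1r lnK.
exact (congr1 (fun z => z *: g c (coord c q))
  (esym (etrans (congr1 (fun z => expR (2 * f z)) (coordK cq)) E))).
Qed.

Lemma of_type_conformal : of_type X g' J A [:: 1]%N.
Proof.
move=> a q _ a1 Aq c Xc cq.
have Uq : U c (coord c q) by apply: (patch_nonvanishing Xc); exists q.
apply: (torsion_component_conformal (HU Xc) n1 _ (suU Xc) _ _ Uq).
- by move=> x Ux; exact: (H14 Xc (UI Ux)).
- by move=> y [].
- by move=> x v Ux; exact: (derive_sqnorm_lee (chart_structure Xc) n1 (H14 Xc) n3 v (UI Ux)).
- by move: a1; rewrite inE.
Qed.

End NonVanishing.
End TypeW1W4.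
End AlmostHermitianCharts.

Theorem proposition3p6 (R : realType) (n : nat) (hn : (2 < n)%N)
    (M : topologicalType) (X : smooth_manifold R (2 * n) M)
    (g J : chart R (2 * n) M -> 'cV[R]_(2 * n) -> 'M[R]_(2 * n))
    (HM : almost_hermitian X setT g J) :
  (* (i) *)
  (of_type X g J setT [:: 2; 4]%N -> lee_closed X g J) /\
  (* (ii) *)
  (of_type X g J setT [:: 1; 4]%N ->
    lee_lambda11_0_vanishes X g J /\
    (n = 3%N ->
      lee_closed X g J /\
      forall p : M,
        (component_vanishes_at X g J 1 p ->
          (forall q, connected_component setT p q ->
             component_vanishes_at X g J 1 q) /\
          of_type X g J (connected_component setT p) [:: 4]%N) /\
        (~ component_vanishes_at X g J 1 p ->
          lee_is_dlog_xi1 X g J (connected_component setT p) /\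
          exists g' J',
            [/\ almost_hermitian X (connected_component setT p) g' J',
                globally_conformal X g J (connected_component setT p) g' J' &
                of_type X g' J' (connected_component setT p) [:: 1]%N]))).
Proof.
have n1 : (1 < n)%N by exact: ltnW.
split=> [ts|ts]; first exact: (lee_closed_W2W4 HM n1 hn ts).
split=> [|n3]; first exact: (lee_lambda11_0_W1W4 HM n1 ts hn).
split=> [|p]; first exact: (lee_closed_W1W4 HM n1 ts n3).
split=> [Zp|Zp].
  split=> [q pq|]; first exact: (vanishing_component HM n1 ts n3 pq Zp).
  exact: (of_type_vanishing HM n1 ts n3 Zp).
split; first exact: (lee_dlog_W1W4 HM n1 ts n3 Zp).
exists (conformal_to_W1 g J), J; split.
- exact: (conformal_almost_hermitian HM n1 ts n3 Zp).
- exact: (conformal_W1W4 HM n1 ts n3 Zp).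
- exact: (of_type_conformal HM n1 ts n3 Zp).
Qed.
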